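(* There is a hypersurface $\Sigma$ in the space $\mathring{\mathrm{B}}\mathrm{ir}_2$ of quadratic birational maps of $\mathbb{P}^2_\mathbb{C}$ such that the following holds: if $\mathcal{F}$ is a foliation of degree $2$ on $\mathbb{P}^2_\mathbb{C}$ and there is $\phi\in\mathring{\mathrm{B}}\mathrm{ir}_2\smallsetminus\Sigma$ such that $\mathcal{F}$ is numerically invariant under the action of $\phi$ (that is, $\deg\phi^*\mathcal{F}=2$), then $\mathcal{F}$ is transversely projective.
   Context: A (singular holomorphic) foliation of degree $d$ on $\mathbb{P}^2_\mathbb{C}$ is given, in homogeneous coordinates $(x:y:z)$, by a $1$-form $\omega=A\,\mathrm{d}x+B\,\mathrm{d}y+C\,\mathrm{d}z$ with $A,B,C$ homogeneous polynomials of degree $d+1$ without common factor and $xA+yB+zC=0$. A birational map $\phi=(\phi_0:\phi_1:\phi_2)$ of $\mathbb{P}^2_\mathbb{C}$, with $\phi_i$ homogeneous of the same degree $k$ without common factor, has degree $k$. $\mathring{\mathrm{B}}\mathrm{ir}_2$ is the set of birational maps of degree exactly $2$, viewed as a subset of the projective space of triples of quadratic forms up to a scalar. The foliation $\phi^*\mathcal{F}$ is the one defined by $\phi^*\omega$ after dividing its coefficients by their greatest common divisor. A foliation $\mathcal{F}$ on a complex manifold $M$ is (singular) transversely projective if there exist a $\mathbb{P}^1$-bundle $\pi\colon P\to M$, a codimension one singular holomorphic foliation $\mathcal{G}$ on $P$ transversal to the generic fibers of $\pi$, and a meromorphic section $\varsigma\colon M\to P$ generically transverse to $\mathcal{G}$,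 such that $\mathcal{F}=\varsigma^*\mathcal{G}$. On $\mathbb{P}^2_\mathbb{C}$ this holds in particular if there are rational $1$-forms $\theta_0,\theta_1,\theta_2$ with $\mathcal{F}$ defined by $\theta_0$ and $\mathrm{d}\theta_0=\theta_0\wedge\theta_1$, $\mathrm{d}\theta_1=\theta_0\wedge\theta_2$, $\mathrm{d}\theta_2=\theta_1\wedge\theta_2$. Transversal projectivity is a birationally invariant notion. *)

(* Defs.v *)
(* The notations of multinomials' mpoly conflict with those of
   MathComp-Analysis, so only its other contents are imported. *)
From HB Require Import structures.
From mathcomp Require Import all_boot all_order all_algebra.
From mathcomp Require Import complex.
From mathcomp Require Import boolp classical_sets reals topology normedtype derive.
From mathcomp Require Import -(notations) mpoly.

Set Implicit Arguments.
Unset Strict Implicit.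
Unset Printing Implicit Defensive.

Import Order.TTheory GRing.Theory Num.Theory numFieldNormedType.Exports.
Local Open Scope classical_set_scope.
Local Open Scope ring_scope.

(* The ascription to a structure gives access to the canonical topology that
   MathComp-Analysis puts on every numFieldType. *)
Definition CC (R : realType) : numClosedFieldType := complex R.

Section Algebra.
Variable C : numFieldType.

Definition form3 : Type := mpoly 3 C.
Definition triple : Type := 3.-tuple form3.

Definition homog (n d : nat) (p : mpoly n C) : Prop :=
  p \is @ishomog1 n C d mdeg.

Definition var3 (i : 'I_3) : form3 := mpolyX C (mnm1 i).

Definition homogeneous_triple (d : nat) (s : triple) : Prop :=
  forall i, homog d (tnth s i).

(* In particular s is not the zero triple, which every form divides. *)
Definition no_common_factor (s : triple) : Prop :=
  forall D : form3,
    (forall i, exists E : form3, tnth s i = D * E) -> (msize D <= 1)%N.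

(* The triple w = (A, B, C) stands for the 1-form A dx + B dy + C dz. *)
Definition foliation (d : nat) (w : triple) : Prop :=
  [/\ homogeneous_triple d.+1 w, no_common_factor w
    & \sum_(i < 3) var3 i * tnth w i = 0].

(* f o phi *)
Definition subst3 (f : form3) (phi : triple) : form3 :=
  comp_mpoly phi f.

(* A triple stands for the rational map it defines; proportional triples
   define the same map. *)
Definition birational_map (k : nat) (phi : triple) : Prop :=
  [/\ homogeneous_triple k phi, no_common_factor phi
    & exists (l : nat) (psi : triple),
      [/\ homogeneous_triple l psi, no_common_factor psi,
          exists P : form3,
            P != 0 /\ forall i, subst3 (tnth psi i) phi = P * var3 i
        & exists Q : form3,
            Q != 0 /\ forall i, subst3 (tnth phi i) psi = Q * var3 i]].

Definition Bir2 : set triple := [set phi | birational_map 2 phi].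

Definition pullback_triple (phi w : triple) : triple :=
  [tuple \sum_(i < 3) subst3 (tnth w i) phi * mderiv j (tnth phi i)
     | j < 3].

(* phi^*w = D w' with w' without common factor, so D is the gcd of the
   coefficients of phi^*w and w' defines phi^*F. *)
Definition pullback_has_degree (phi w : triple) (d : nat) : Prop :=
  exists (D : form3) (w' : triple),
    [/\ D != 0, foliation d w'
      & forall j, tnth (pullback_triple phi w) j = D * tnth w' j].

Definition quadratic_monomials : seq (multinom 3) :=
  [seq mnm_add (mnm1 (inord ij.1)) (mnm1 (inord ij.2))
     | ij <- [:: (0, 0); (1, 1); (2, 2); (0, 1); (0, 2); (1, 2)]%N].

(* The 18 coefficients of a triple of quadratic forms, which are its
   homogeneous coordinates in P^17. *)
Definition quadratic_coord (phi : triple) (k : 'I_18) : C :=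
  mcoeff (nth mnm0 quadratic_monomials (k %% 6)%N)
               (nth 0 phi (k %/ 6)%N).

Definition at_triple (H : mpoly 18 C) (phi : triple) : C :=
  meval (quadratic_coord phi) H.

(* S is the intersection of X with a hypersurface of P^17, it is not empty,
   and X \ S is Zariski dense in X: S contains no component of X, so by
   Krull's principal ideal theorem it has pure codimension one in X. *)
Definition hypersurface_in (X S : set triple) : Prop :=
  exists (m : nat) (H : mpoly 18 C),
    [/\ homog m H,
        S = X `&` [set phi | at_triple H phi = 0],
        S !=set0
      & forall G : mpoly 18 C,
          (forall phi, (X `\` S) phi -> at_triple G phi = 0) ->
          forall phi, X phi -> at_triple G phi = 0].

End Algebra.

Section Forms.
Variables (C : numFieldType).

Definition holomorphic (V W : normedModType C) (U : set V) (f : V -> W) : Prop :=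
  forall x, U x -> differentiable f x.

(* A 1-form on V sends a point x and a tangent vector v to a scalar. *)
Definition form1 (V : normedModType C) : Type := V -> V -> C.

Definition holomorphic_form1 (V : normedModType C) (U : set V) (a : form1 V)
    : Prop :=
  (forall x, U x -> forall (c : C) (v w : V),
     a x (c *: v + w) = c * a x v + a x w) /\
  (forall v, holomorphic U (fun x => a x v : C^o)).

Definition ext_deriv (V : normedModType C) (a : form1 V) (x v w : V) : C :=
  'D_v (fun y => a y w : C^o) x - 'D_w (fun y => a y v : C^o) x.

(* a /\ da = 0 *)
Definition integrable_on (V : normedModType C) (U : set V) (a : form1 V) : Prop :=
  forall x, U x -> forall u v w,
    a x u * ext_deriv a x v w + a x v * ext_deriv a x w u
      + a x w * ext_deriv a x u v = 0.

Definition generically_nonzero (V : normedModType C) (U : set V) (a : form1 V)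
    : Prop :=
  forall O : set V, open O -> O !=set0 -> O `<=` U ->
    exists x v, O x /\ a x v != 0.

(* a /\ b = 0 at x *)
Definition collinear_at (V : normedModType C) (a b : form1 V) (x : V) : Prop :=
  forall v w, a x v * b x w = b x v * a x w.

Definition pullback_form1 (V W : normedModType C) (f : V -> W) (a : form1 W)
    : form1 V :=
  fun x v => a (f x) ('D_v f x).

End Forms.

(* Objects on P^2 and on P^1-bundles over P^2 are described in homogeneous
   coordinates: a point of P^2 is a nonzero x : V3 up to a scalar, and a point
   of the fibre P^1 is a nonzero q : V2 up to a scalar. *)
Section Bundles.
Variable C : numFieldType.
Local Notation V3 := ('rV[C]_3).
Local Notation V2 := ('rV[C]_2).
Local Notation V5 := ('rV[C]_3 * 'rV[C]_2)%type.

Definition eval3 (f : form3 C) (x : V3) : C := meval (x 0) f.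

(* A holomorphic P^1-bundle over P^2 is given by trivialisations over an open
   cover (bdom i) and holomorphic transition functions: the point with fibre
   coordinate q in chart i has fibre coordinate q *m btrans i j x in chart j.
   The cocycle condition holds in PGL_2; for a sufficiently fine cover the
   transition functions lift to GL_2. *)
Record p1_bundle := P1Bundle {
  bidx : Type;
  bdom : bidx -> set V3;
  btrans : bidx -> bidx -> V3 -> 'M[C]_2;
  bdom_open : forall i, open (bdom i);
  bdom_neq0 : forall i x, bdom i x -> x != 0;
  bdom_cone : forall i x (c : C), c != 0 -> bdom i x -> bdom i (c *: x);
  bdom_cover : forall x, x != 0 -> exists i, bdom i x;
  btrans_holo : forall i j, holomorphic (bdom i `&` bdom j) (btrans i j);
  btrans_unit : forall i j x, (bdom i `&` bdom j) x -> btrans i j x \in unitmx;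
  btrans_scale : forall i j x (c : C), c != 0 -> (bdom i `&` bdom j) x ->
    btrans i j (c *: x) = btrans i j x;
  btrans_cocycle : forall i j k x, (bdom i `&` bdom j `&` bdom k) x ->
    exists2 c : C, c != 0 & btrans i j x *m btrans j k x = c *: btrans i k x
}.

(* The chart bdom i x P^1 of the total space, in homogeneous coordinates. *)
Definition total_chart (B : p1_bundle) (i : bidx B) : set V5 :=
  [set p | bdom i p.1 /\ p.2 != 0].

(* From chart i to chart j, with arbitrary choices of the scalars in both
   sets of homogeneous coordinates. *)
Definition chart_change (B : p1_bundle) (i j : bidx B) (c c' : C) (p : V5) : V5 :=
  (c *: p.1, c' *: (p.2 *m btrans i j p.1)).

(* A codimension one singular holomorphic foliation on the total space: local
   nonzero integrable holomorphic 1-forms, given on open sets covering every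
   chart and proportional on overlaps.  A form in homogeneous coordinates
   must vanish on the two Euler vector fields.  Zeros of codimension one are
   permitted in the local forms: dividing them out does not change the
   foliation. *)
Record bundle_foliation (B : p1_bundle) := BundleFoliation {
  fidx : Type;
  fchart : fidx -> bidx B;
  fdom : fidx -> set V5;
  fform : fidx -> form1 V5;
  fdom_open : forall a, open (fdom a);
  fdom_sub : forall a, fdom a `<=` total_chart (fchart a);
  fdom_cover : forall i p, total_chart i p -> exists2 a, fchart a = i & fdom a p;
  fform_holo : forall a, holomorphic_form1 (fdom a) (fform a);
  fform_neq0 : forall a, generically_nonzero (fdom a) (fform a);
  fform_integrable : forall a, integrable_on (fdom a) (fform a);
  fform_euler3 : forall a p, fdom a p -> fform a p (p.1, 0) = 0;
  fform_euler2 : forall a p, fdom a p -> fform a p (0, p.2) = 0;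
  fform_glue : forall a b (c c' : C) p, c != 0 -> c' != 0 ->
    let f := chart_change (fchart b) (fchart a) c c' in
    fdom b p -> bdom (fchart a) p.1 -> fdom a (f p) ->
    collinear_at (pullback_form1 f (fform a)) (fform b) p
}.

(* A nonzero value of a local form on a vertical vector means that the
   foliation is regular and transverse to the fibre at that point.  A fibre is
   generic when its base point is off some algebraic curve D = 0; by Chow's
   theorem these curves are the proper analytic subsets of P^2 of
   codimension one. *)
Definition transversal_to_generic_fibres (B : p1_bundle)
    (G : bundle_foliation B) : Prop :=
  exists (d : nat) (D : form3 C),
    [/\ homog d D, D != 0
      & forall (i : bidx B) p, total_chart i p -> eval3 D p.1 != 0 ->
          exists a : fidx G, [/\ fchart a = i, fdom a p
                      & exists w : V2, fform a p (0, w) != 0]].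

(* A meromorphic section is given locally by a pair of holomorphic functions,
   not both zero, up to a common factor; it is undefined where both vanish. *)
Record meromorphic_section (B : p1_bundle) := MeromorphicSection {
  sidx : Type;
  schart : sidx -> bidx B;
  sdom : sidx -> set V3;
  smap : sidx -> V3 -> V2;
  sdom_open : forall a, open (sdom a);
  sdom_sub : forall a, sdom a `<=` bdom (schart a);
  sdom_cover : forall x, x != 0 -> exists a, sdom a x;
  smap_holo : forall a, holomorphic (sdom a) (smap a);
  smap_neq0 : forall a (O : set V3), open O -> O !=set0 -> O `<=` sdom a ->
    exists2 x, O x & smap a x != 0;
  smap_glue : forall a b (c : C) x, c != 0 -> sdom b x -> sdom a (c *: x) ->
    \det (col_mx (smap a (c *: x))
                 (smap b x *m btrans (schart b) (schart a) x) : 'M[C]_2) = 0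
}.

Definition form1_of_triple (w : triple C) : form1 V3 :=
  fun x v => \sum_(i < 3) eval3 (tnth w i) x * v 0 i.

(* The section s is generically transverse to G and F = s^*G, where F is
   defined by w. *)
Definition is_section_pullback (B : p1_bundle) (G : bundle_foliation B)
    (s : meromorphic_section B) (w : triple C) : Prop :=
  forall (a : sidx s) (b : fidx G), schart a = fchart b ->
    let graph := fun x : V3 => (x, smap a x) : V5 in
    let O := [set x | sdom a x /\ fdom b (graph x)] in
    let pb := pullback_form1 graph (fform b) in
    generically_nonzero O pb /\
    forall x, O x -> collinear_at pb (form1_of_triple w) x.

Definition transversely_projective (w : triple C) : Prop :=
  exists (B : p1_bundle) (G : bundle_foliation B) (s : meromorphic_section B),
    transversal_to_generic_fibres G /\ is_section_pullback G s w.

End Bundles.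

(* Main.v *)
(* Up to linear changes of coordinates on both sides, a quadratic birational map
   is de Jonquieres: (x n + k : y m : z m) with n, k forms in y, z of degrees 1, 2
   and m linear.  To see this, let b be the polar form of phi, so phi(x) = b(x,x).
   Let psi be the inverse, so psi(phi(x)) = P(x) x.  If b(x,v) = 0 with x, v
   independent, phi takes the same value at x + tv and x - tv, so P vanishes on
   the line xv and psi on its image; as psi has no common factor, the line is
   contracted.  Zeros of det b(x,.) provide such pairs, so some line is
   contracted, which means that two conics of the net share that line.
   The Jacobian cubic is then 2 m D with D = n m - alpha (x n + k) a binary form
   in y, z, where alpha = dm/dx.  Sigma
   is the vanishing of the discriminant of the Jacobian cubic on the line z = 0;
   off Sigma, phi = A sigma B with sigma = (yz : xz : xy), and any phi is a limit
   of such maps along a line in the space of normal forms.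

   If phi = A sigma B and deg phi^*F = 2, let w define A^*F.  The gcd of sigma^*w
   has degree 4.  As sigma^* sigma^* w = (xyz)^4 w, the gcd composed with sigma
   is a monomial up to a common factor of w, hence the gcd is a monomial, and,
   after a permutation of the coordinates, x^2 divides sigma^*w.  For
   w = A dx + B dy + C dz this says that A does not depend on x, and then
   B = x^2 z c + x B_2(y,z) + z h(y,z): F is of Riccati type with respect to the
   lines through (1:0:0).  It is therefore the pullback of a Riccati foliation
   on P^2 x P^1 by the section q = (x : z). *)
From HB Require Import structures.
From mathcomp Require Import all_boot all_order all_algebra.
From mathcomp Require Import perm ring zify.
From mathcomp Require Import boolp classical_sets reals topology normedtype derive.
From mathcomp Require Import -(notations) mpoly.
Require Import Defs.
Set Implicit Arguments.
Unset Strict Implicit.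
Unset Printing Implicit Defensive.
Import Order.TTheory GRing.Theory Num.Theory numFieldNormedType.Exports.
Local Open Scope classical_set_scope.
Local Open Scope ring_scope.

(** * Polynomials *)

(** The Jacobian cubic of a quadratic birational map always splits into three lines, so its
    discriminant as a plane cubic is identically zero and cannot detect degenerate maps. Restricting
    it to one fixed line gives a binary cubic whose discriminant can. The price is that Sigma also
    contains good maps whose Jacobian lines are badly placed with respect to z = 0; sigma itself is
    one, and it shows that Sigma is not empty. The degree of Sigma is 12 = 3 * 4: the determinant is
    cubic in the coefficients of phi, and the discriminant is quartic in the coefficients of the
    cubic.

    The factor D of [pullback_has_degree] is not assumed homogeneous, and it is controlled without
    unique factorisation: linear forms are prime because restriction to their hyperplane maps to a
    domain, and this suffices to split off monomials.

    The field is infinite, so identities between forms are checked on values. Density of a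
    complement, generic nonvanishing and comparison of coefficients are all reduced to polynomials
    in one variable along a line. *)

Section PolyFun.
Variable C : numFieldType.
Implicit Types f g : C -> C.

(** A predicate on functions rather than a chosen polynomial, so that matrix entries, determinants
    and values of forms along a line are treated by closure lemmas. *)
Definition polyfun f := exists p : {poly C}, forall t, f t = p.[t].

Lemma polyfun_cst c : polyfun (fun=> c).
Proof. by exists c%:P => t; rewrite hornerC. Qed.

Lemma polyfun_id : polyfun id.
Proof. by exists 'X => t; rewrite hornerX. Qed.

Lemma polyfunD f g : polyfun f -> polyfun g -> polyfun (fun t => f t + g t).
Proof. by move=> [p fp] [q gq]; exists (p + q) => t; rewrite hornerD fp gq. Qed.

Lemma polyfunM f g : polyfun f -> polyfun g -> polyfun (fun t => f t * g t).
Proof. by move=> [p fp] [q gq]; exists (p * q) => t; rewrite hornerM fp gq. Qed.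

Lemma polyfunN f : polyfun f -> polyfun (fun t => - f t).
Proof. by move=> [p fp]; exists (- p) => t; rewrite hornerN fp. Qed.

Lemma polyfunB f g : polyfun f -> polyfun g -> polyfun (fun t => f t - g t).
Proof. by move=> pf pg; apply: polyfunD => //; apply: polyfunN. Qed.

Lemma polyfunX f k : polyfun f -> polyfun (fun t => f t ^+ k).
Proof. by move=> [p fp]; exists (p ^+ k) => t; rewrite horner_exp fp. Qed.

Lemma polyfun_sum I (r : seq I) (F : I -> C -> C) :
  (forall i, polyfun (F i)) -> polyfun (fun t => \sum_(i <- r) F i t).
Proof.
move=> pF; elim: r => [|i r [p rp]].
  by exists 0 => t; rewrite big_nil horner0.
have [q iq] := pF i; exists (q + p) => t.
by rewrite big_cons hornerD rp iq.
Qed.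

Lemma polyfun_prod I (r : seq I) (F : I -> C -> C) :
  (forall i, polyfun (F i)) -> polyfun (fun t => \prod_(i <- r) F i t).
Proof.
move=> pF; elim: r => [|i r [p rp]].
  by exists 1 => t; rewrite big_nil hornerC.
have [q iq] := pF i; exists (q * p) => t.
by rewrite big_cons hornerM rp iq.
Qed.

Lemma polyfun_meval n (p : mpoly n C) (F : 'I_n -> C -> C) :
  (forall i, polyfun (F i)) -> polyfun (fun t => meval (fun i => F i t) p).
Proof.
move=> pF; have [q qP] : polyfun (fun t =>
    \sum_(m <- msupp p) mcoeff m p * \prod_(i < n) F i t ^+ m i).
  apply: polyfun_sum => m; apply: polyfunM; first exact: polyfun_cst.
  by apply: polyfun_prod => i; apply: polyfunX.
by exists q => t; rewrite mevalE qP.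
Qed.

Lemma horner_eq0_poly (p : {poly C}) : (forall t, p.[t] = 0) -> p = 0.
Proof.
move=> p0; apply/eqP/negPn/negP => pn0.
have := @max_poly_roots _ _ [seq i%:R | i <- iota 0 (size p)] pn0.
rewrite size_map size_iota ltnn => H; apply: notF; apply: H.
  by apply/allP => x _; rewrite rootE p0.
by rewrite map_inj_uniq ?iota_uniq //; apply: mulrIn; rewrite oner_neq0.
Qed.

(** The product of the two polynomials vanishes everywhere and polynomials form a domain. This
    carries an identity known off g = 0 across the exceptional points. *)
Lemma polyfun_eq0 f g t0 : polyfun f -> polyfun g -> g t0 != 0 ->
  (forall t, g t != 0 -> f t = 0) -> forall t, f t = 0.
Proof.
move=> [p fp] [q gq] g0 fg.
have /eqP : p * q = 0.
  apply: horner_eq0_poly => t; rewrite hornerM -fp -gq.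
  by have [->|/fg ->] := eqVneq (g t) 0; rewrite ?mulr0 ?mul0r.
rewrite mulf_eq0 => /orP[/eqP p0 t|/eqP q0]; first by rewrite fp p0 horner0.
by move: g0; rewrite gq q0 horner0 eqxx.
Qed.

End PolyFun.

(** Uniqueness of base [k] expansions: it makes the Kronecker substitution send distinct monomials
    to distinct powers. *)
Lemma digits_inj k n (a b : 'I_n -> nat) :
  (forall i, a i < k)%N -> (forall i, b i < k)%N ->
  (\sum_(i < n) a i * k ^ i = \sum_(i < n) b i * k ^ i)%N -> a =1 b.
Proof.
elim: n => [|n IH] in a b *; first by move=> _ _ _ [].
move=> ak bk; rewrite !big_ord_recl !expn0 !muln1.
have shift (c : 'I_n.+1 -> nat) : (\sum_(i < n) c (lift ord0 i) * k ^ lift ord0 i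
    = (\sum_(i < n) c (lift ord0 i) * k ^ i) * k)%N.
  rewrite big_distrl; apply: eq_bigr => i _ /=.
  by rewrite /bump add1n expnSr mulnA.
rewrite !shift => E.
have E0 : a ord0 = b ord0.
  have := congr1 (modn^~ k) E.
  by rewrite ![(_ + _ * k)%N]addnC !modnMDl !modn_small.
have k0 : (0 < k)%N by apply: leq_ltn_trans (ak ord0).
move: E; rewrite E0 => /addnI /eqP; rewrite eqn_pmul2r // => /eqP /IH-/(_ _ _) E.
by move=> i; case: (unliftP ord0 i) => [j|] -> //; apply: E.
Qed.

Section MPolyTools.
Variable C : numFieldType.

(* Kronecker substitution X_i := t ^ (k ^ i). *)
Lemma meval_eq0_mpoly n (p : mpoly n C) : (forall v, meval v p = 0) -> p = 0.
Proof.
move=> p0; pose k := msize p; pose e (m : multinom n) := (\sum_(i < n) m i * k ^ i)%N.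
have mk m : m \in msupp p -> forall i, (m i < k)%N.
  move=> /msize_mdeg_lt mp i; apply: leq_ltn_trans mp.
  by rewrite mdegE (bigD1 i) //= leq_addr.
have q0 : \sum_(m <- msupp p) mcoeff m p *: 'X^(e m) = 0 :> {poly C}.
  apply: horner_eq0_poly => t; rewrite -(p0 (fun i => t ^+ (k ^ i))) mevalE.
  rewrite horner_sum; apply: eq_bigr => m _; rewrite hornerZ hornerXn; congr (_ * _).
  rewrite /e -prodrXr; apply: eq_bigr => i _; by rewrite -exprM mulnC.
apply/mpolyP => m; rewrite mcoeff0; apply/eqP; rewrite mcoeff_eq0; apply/negP => mp.
have := congr1 (fun q : {poly C} => q`_(e m)) q0; rewrite coef0 coef_sum.
rewrite (big_rem m) //= coefZ coefXn eqxx mulr1 big_seq big1 ?addr0.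
  by move/eqP; rewrite mcoeff_eq0 mp.
move=> m'; rewrite mem_rem_uniq ?msupp_uniq // => /andP[m'm m'p].
rewrite coefZ coefXn; case: eqP => [E|]; last by rewrite mulr0.
case/eqP: m'm; apply/mnmP/(@digits_inj k) => //; by apply: mk.
Qed.

Lemma mpoly_eval_ext n (p q : mpoly n C) :
  (forall v, meval v p = meval v q) -> p = q.
Proof.
move=> pq; apply/eqP; rewrite -subr_eq0; apply/eqP/meval_eq0_mpoly => v.
by rewrite mevalB pq subrr.
Qed.

(** Induction on the ring structure instead of on monomials, suited to statements about
    substitutions and derivations. *)
Lemma mpoly_alg_ind n (P : mpoly n C -> Prop) :
  (forall c, P (mpolyC n c)) -> (forall i, P (mpolyX C (mnm1 i))) ->
  (forall p q, P p -> P q -> P (p + q)) -> (forall p q, P p -> P q -> P (p * q)) ->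
  forall p, P p.
Proof.
move=> Pc PX PD PM; apply: mpolyind => [|c m p _ _ Pp].
  by have := Pc 0; rewrite mpolyC0.
apply: (PD) => //; rewrite -mul_mpolyC; apply: (PM) => //.
rewrite mpolyXE_id; apply: big_ind => [|p1 p2|i _]; first by rewrite -mpolyC1.
  exact: (PM).
elim: (m i) => [|j IH]; first by rewrite expr0 -mpolyC1.
by rewrite exprS; apply: PM.
Qed.

Lemma comp_mpolyXU' n k (lq : n.-tuple (mpoly k C)) i :
  comp_mpoly lq (mpolyX C (mnm1 i)) = tnth lq i.
Proof. by rewrite comp_mpolyXU (tnth_nth 0). Qed.

Lemma mderiv_comp n k (lq : n.-tuple (mpoly k C)) (p : mpoly n C) j :
  mderiv j (comp_mpoly lq p) =
  \sum_(i < n) comp_mpoly lq (mderiv i p) * mderiv j (tnth lq i).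
Proof.
elim/mpoly_alg_ind: p => [c|i0|p q IHp IHq|p q IHp IHq].
- rewrite comp_mpolyC mderivC big1 // => i _.
  by rewrite mderivC comp_mpoly0 mul0r.
- rewrite comp_mpolyXU' (bigD1 i0) //= big1 ?addr0 => [|i ii0].
    rewrite mderivX mnm1E eqxx scale1r.
    have -> : mnm_sub (mnm1 i0) (mnm1 i0) = mnm0.
      by apply/mnmP => l; rewrite mnmBE subnn mnm0E.
    by rewrite mpolyX0 comp_mpoly1 mul1r.
  rewrite mderivX mnm1E. rewrite eq_sym (negPf ii0) mulr0n scale0r. by rewrite comp_mpoly0 mul0r.
- rewrite comp_mpolyD mderivD IHp IHq -big_split; apply: eq_bigr => i _ /=.
  by rewrite mderivD comp_mpolyD mulrDl.
- rewrite rmorphM mderivM IHp IHq mulr_suml mulr_sumr -big_split.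
  apply: eq_bigr => i _ /=; rewrite mderivM comp_mpolyD !rmorphM /=; ring.
Qed.

Lemma comp_mpolyA n k l (lp : k.-tuple (mpoly l C)) (lq : n.-tuple (mpoly k C)) p :
  comp_mpoly lp (comp_mpoly lq p) =
  comp_mpoly [tuple comp_mpoly lp (tnth lq i) | i < n] p.
Proof.
apply: mpoly_eval_ext => v; rewrite !comp_mpoly_meval; apply: meval_eq => i.
by rewrite tnth_mktuple comp_mpoly_meval.
Qed.

Lemma meval_homogZ n d (p : mpoly n C) c v : homog d p ->
  meval (fun i => c * v i) p = c ^+ d * meval v p.
Proof.
move=> /dhomogP hp; rewrite !mevalE mulr_sumr !big_seq; apply: eq_bigr => m /hp md.
have {}md : mdeg m = d by [].
rewrite mulrCA; congr (_ * _); rewrite -md mdegE -prodrXr -big_split.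
by apply: eq_bigr => i _; rewrite exprMn.
Qed.

Lemma comp_mpoly_homog n k d e (lq : n.-tuple (mpoly k C)) (p : mpoly n C) :
  homog d p -> (forall i, homog e (tnth lq i)) -> homog (d * e) (comp_mpoly lq p).
Proof.
move=> /dhomogP hp hl; rewrite comp_mpolyEX big_seq; apply: rpred_sum => m mp.
have md : mdeg m = d by exact: hp.
apply: rpredZ; rewrite comp_mpolyX -md mdegE big_distrl /=.
apply: (big_ind2 (fun p d => homog d p)) => [|? ? ? ? ? ?|i _].
- exact: dhomog1.
- exact: dhomogM.
- by rewrite mulnC; exact: (dhomogMn _ (hl i)).
Qed.

Lemma mderiv_homog n d (p : mpoly n C) i : homog d.+1 p -> homog d (mderiv i p).
Proof.
move=> /dhomogP hp; apply/dhomogP => m; rewrite mcoeff_msupp mcoeff_deriv => mp.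
have mS : mnm_add m (mnm1 i) \in msupp p.
  by rewrite mcoeff_msupp; apply: contraNneq mp => ->; rewrite mul0rn.
have : mdeg (mnm_add m (mnm1 i)) = d.+1 by exact: hp.
by rewrite mdegD mdeg1 addn1 => -[].
Qed.

End MPolyTools.

(** * Divisibility by linear forms and by monomials *)

Section LinearDivisors.
Variables (C : numFieldType) (n : nat).
Implicit Types (p q r s : mpoly n C) (a : 'I_n -> C).

Definition mdvd p q := exists r, q = p * r.

Definition lform a : mpoly n C := \sum_(i < n) a i *: mpolyX C (mnm1 i).

Lemma meval_lform a v : meval v (lform a) = \sum_(i < n) a i * v i.
Proof.
by rewrite raddf_sum /=; apply: eq_bigr => i _; rewrite mevalZ mevalXU.
Qed.

Lemma lform_homog a : homog 1 (lform a).
Proof.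
apply: rpred_sum => i _; apply: rpredZ; apply/dhomogP => m.
by rewrite msuppX inE => /eqP ->; exact: mdeg1.
Qed.

(** Restriction to the hyperplane [lform a] = 0: the variable [i0] is replaced by its solution in
    terms of the others. When [a i0] is nonzero, the kernel is the ideal of [lform a], which is
    therefore prime. *)
Definition ltau a i0 : n.-tuple (mpoly n C) :=
  [tuple mpolyX C (mnm1 i) - ((i == i0)%:R / a i0) *: lform a | i < n].

Lemma ltau_congr a i0 p : mdvd (lform a) (p - comp_mpoly (ltau a i0) p).
Proof.
elim/mpoly_alg_ind: p => [c|i|p q [u pu] [v qv]|p q [u pu] [v qv]].
- by exists 0; rewrite comp_mpolyC subrr mulr0.
- exists (mpolyC n ((i == i0)%:R / a i0)).
  by rewrite comp_mpolyXU' tnth_mktuple opprB addrC subrK -mul_mpolyC mulrC.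
- by exists (u + v); rewrite comp_mpolyD mulrDr -pu -qv; ring.
- exists (u * q + comp_mpoly (ltau a i0) p * v).
  by rewrite rmorphM /= mulrDr mulrA -pu mulrCA -qv; ring.
Qed.

Lemma ltau_lform a i0 : a i0 != 0 -> comp_mpoly (ltau a i0) (lform a) = 0.
Proof.
move=> a0; rewrite raddf_sum /=.
under eq_bigr => i _ do rewrite comp_mpolyZ comp_mpolyXU' tnth_mktuple scalerBr.
rewrite sumrB (bigD1 i0) //= [X in _ - X](bigD1 i0) //= [X in _ - (_ + X)]big1.
  by rewrite eqxx addr0 scalerA mulrC divfK // scale1r /lform [X in _ - X](bigD1 i0) //= subrr.
by move=> i /negPf ->; rewrite mul0r scale0r scaler0.
Qed.

Lemma mdvd_lformE a i0 p : a i0 != 0 ->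
  mdvd (lform a) p <-> comp_mpoly (ltau a i0) p = 0.
Proof.
move=> a0; split=> [[r ->]|p0]; first by rewrite rmorphM /= ltau_lform // mul0r.
by have := ltau_congr a i0 p; rewrite p0 subr0.
Qed.

Lemma mdvd_lform_prime a i0 p q : a i0 != 0 ->
  mdvd (lform a) (p * q) -> mdvd (lform a) p \/ mdvd (lform a) q.
Proof.
move=> a0; rewrite !(mdvd_lformE _ a0) rmorphM /= => /eqP.
by rewrite mulf_eq0 => /orP[/eqP|/eqP]; [left|right].
Qed.

(** The Nullstellensatz for a hyperplane: the substitution [ltau] sends every point into it. *)
Lemma mdvd_lform_vanish a i0 p : a i0 != 0 ->
  (forall v, \sum_(i < n) a i * v i = 0 -> meval v p = 0) -> mdvd (lform a) p.
Proof.
move=> a0 pv; apply/(mdvd_lformE _ a0)/meval_eq0_mpoly => v.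
rewrite comp_mpoly_meval; apply: pv.
have := congr1 (meval v) (ltau_lform a0).
by rewrite comp_mpoly_meval meval_lform meval0.
Qed.

Lemma lform_delta i : lform (fun j => (j == i)%:R) = mpolyX C (mnm1 i).
Proof.
rewrite /lform (bigD1 i) //= eqxx scale1r big1 ?addr0 // => j /negPf ->.
by rewrite scale0r.
Qed.

Lemma mdvdX_prime i p q : mdvd (mpolyX C (mnm1 i)) (p * q) ->
  mdvd (mpolyX C (mnm1 i)) p \/ mdvd (mpolyX C (mnm1 i)) q.
Proof.
by rewrite -lform_delta; apply: (@mdvd_lform_prime _ i); rewrite eqxx oner_neq0.
Qed.

Definition monomial_free p := forall i, ~ mdvd (mpolyX C (mnm1 i)) p.

Lemma mpolyX_neq0 m : mpolyX C m != 0 :> mpoly n C.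
Proof. by rewrite -msize_poly_eq0 msizeX. Qed.

Lemma monomial_decomp p : p != 0 ->
  exists m q, p = mpolyX C m * q /\ monomial_free q.
Proof.
have [k] := ubnP (msize p); elim: k p => // k IH p; rewrite ltnS => pk p0.
have [free|] := pselect (monomial_free p).
  by exists mnm0, p; rewrite mpolyX0 mul1r.
move=> /existsNP[i /contrapT[r pr]].
have r0 : r != 0 by apply: contra_neq p0 => r0; rewrite pr r0 mulr0.
have [] := IH r; rewrite //.
  by apply: leq_trans pk; rewrite pr msizeM ?mpolyX_neq0 // msizeX mdeg1.
move=> m [q [rq qfree]]; exists (mnm_add (mnm1 i) m), q.
by rewrite mpolyXD -mulrA -rq.
Qed.

Lemma mnm_split (m : multinom n) i : (0 < m i)%N -> m = mnm_add (mnm1 i) (mnm_sub m (mnm1 i)).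
Proof.
move=> mi; apply/mnmP => j; rewrite mnmDE mnmBE mnm1E.
by case: eqP => [<-|_]; rewrite ?subnKC ?add0n ?subn0.
Qed.

(** Each variable is prime and does not divide [q], so the variables of [m] can be moved into [r]
    one at a time. *)
Lemma monomial_free_cancel q r m s : monomial_free q ->
  q * r = mpolyX C m * s -> mdvd (mpolyX C m) r.
Proof.
move=> qfree; have [k] := ubnP (mdeg m); elim: k => // k IH in m r *.
rewrite ltnS => mk; have [->|m0] := eqVneq m mnm0.
  by exists r; rewrite mpolyX0 mul1r.
have [i mi] : exists i, (0 < m i)%N.
  apply/existsP; apply: contra_neqT m0 => /existsPn mi.
  by apply/mnmP => i; rewrite mnm0E; apply/eqP; rewrite -leqn0 leqNgt mi.
move: mk; rewrite (mnm_split mi) mdegD mdeg1 mpolyXD add1n => mk qr.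
have [/qfree//|[r1 rr1]] : mdvd (mpolyX C (mnm1 i)) q \/ mdvd (mpolyX C (mnm1 i)) r.
  by apply: mdvdX_prime; exists (mpolyX C (mnm_sub m (mnm1 i)) * s); rewrite qr mulrA.
have [|r2 r1r2] := IH _ r1 mk.
  by apply: (mulfI (mpolyX_neq0 (mnm1 i))); rewrite [RHS]mulrA -qr rr1; ring.
by exists r2; rewrite rr1 r1r2 mulrA.
Qed.

(** The coefficient of [p] at [k] is that of the product at [k + m], so [p] has a single nonzero
    coefficient. *)
Lemma mulX_monomial p m m' c : p != 0 -> p * mpolyX C m = c *: mpolyX C m' ->
  exists k, p = c *: mpolyX C k /\ mnm_add k m = m'.
Proof.
move=> p0 pm.
have coef k : mcoeff k p = c * (m' == mnm_add k m)%:R.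
  by rewrite -(mcoeffMX p m) pm addmC mcoeffZ mcoeffX.
have [k kp] : exists k, mcoeff k p != 0.
  apply/not_existsP => pk; case/eqP: p0; apply/mpolyP => k; rewrite mcoeff0.
  by apply/eqP; apply: contrapT => /negP; exact: pk.
have mE : m' = mnm_add k m.
  by apply/eqP; apply: contraNT kp => /negPf km; rewrite coef km mulr0.
exists k; split=> //; apply/mpolyP => l; rewrite coef mcoeffZ mcoeffX mE.
congr (_ * _%:R); apply: congr1; apply/eqP/eqP => [|->//] E.
by apply/mnmP => i; move/mnmP/(_ i): E; rewrite !mnmDE => /addIn.
Qed.

End LinearDivisors.

(** * Pullbacks and the standard quadratic map *)

Section Triples.
Variable C : numFieldType.
Implicit Types (phi psi w : triple C) (A B M : 'M[C]_3) (x : 'rV[C]_3) (D : form3 C).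

Definition ev phi x : 'rV[C]_3 := \row_i eval3 (tnth phi i) x.

Definition comp3 phi psi : triple C := [tuple subst3 (tnth phi i) psi | i < 3].

(** Column [i] of [M] is the [i]-th component, so that [lin M] acts on row vectors by [x *m M];
    composition reverses the order of matrix products. *)
Definition lin M : triple C := [tuple lform (fun j => M j i) | i < 3].

Lemma evE phi x i : ev phi x 0 i = eval3 (tnth phi i) x.
Proof. by rewrite mxE. Qed.

Lemma eval3_ext D D' : (forall x, eval3 D x = eval3 D' x) -> D = D'.
Proof.
move=> E; apply: mpoly_eval_ext => v; have := E (\row_i v i).
by rewrite /eval3 (meval_eq _ (v2 := v)) ?(meval_eq D' (v2 := v)) // => i; rewrite mxE.
Qed.

Lemma triple_ext phi psi : (forall x, ev phi x = ev psi x) -> phi = psi.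
Proof.
move=> E; apply: eq_from_tnth => i; apply: eval3_ext => x.
by rewrite -!evE E.
Qed.

Lemma eval3_subst D psi x : eval3 (subst3 D psi) x = eval3 D (ev psi x).
Proof.
rewrite /eval3 comp_mpoly_meval; apply: meval_eq => i. by rewrite mxE.
Qed.

Lemma ev_comp3 phi psi x : ev (comp3 phi psi) x = ev phi (ev psi x).
Proof. by apply/rowP => i; rewrite !evE tnth_mktuple eval3_subst. Qed.

Lemma ev_lin M x : ev (lin M) x = x *m M.
Proof.
apply/rowP => i; rewrite evE tnth_mktuple /eval3 meval_lform mxE.
by apply: eq_bigr => j _; rewrite mulrC.
Qed.

Lemma eval3_var i x : eval3 (var3 C i) x = x 0 i.
Proof. exact: mevalXU. Qed.

Lemma eval3D D D' x : eval3 (D + D') x = eval3 D x + eval3 D' x.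
Proof. exact: mevalD. Qed.

Lemma eval3M D D' x : eval3 (D * D') x = eval3 D x * eval3 D' x.
Proof. exact: mevalM. Qed.

Lemma eval3_homogZ d D c x : homog d D -> eval3 D (c *: x) = c ^+ d * eval3 D x.
Proof.
move=> hD; rewrite -(meval_homogZ _ _ hD) /eval3; apply: meval_eq => i.
by rewrite mxE.
Qed.

Lemma ev_homogZ d phi c x : homogeneous_triple d phi ->
  ev phi (c *: x) = c ^+ d *: ev phi x.
Proof.
by move=> hp; apply/rowP => i; rewrite [RHS]mxE !evE (eval3_homogZ _ _ (hp i)).
Qed.

Lemma comp3_lin_homog d phi M : homogeneous_triple d phi ->
  homogeneous_triple d (comp3 phi (lin M)).
Proof.
move=> hp i; rewrite tnth_mktuple -[d]muln1; apply: comp_mpoly_homog => // j.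
by rewrite tnth_mktuple; apply: lform_homog.
Qed.

Lemma tnth_comp_lin phi M i :
  tnth (comp3 (lin M) phi) i = \sum_(j < 3) M j i *: tnth phi j.
Proof.
rewrite !tnth_mktuple /lform /subst3 raddf_sum /=; apply: eq_bigr => j _.
by rewrite comp_mpolyZ comp_mpolyXU'.
Qed.

Lemma lin_comp3_homog d phi M : homogeneous_triple d phi ->
  homogeneous_triple d (comp3 (lin M) phi).
Proof.
move=> hp i; rewrite tnth_comp_lin.
by apply: rpred_sum => j _; apply: rpredZ; apply: hp.
Qed.

Lemma lin_compK phi M : M \in unitmx ->
  comp3 (lin (invmx M)) (comp3 (lin M) phi) = phi.
Proof.
by move=> uM; apply: triple_ext => x; rewrite !ev_comp3 !ev_lin mulmxK.
Qed.

Lemma subst_linKV D M : M \in unitmx ->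
  subst3 (subst3 D (lin M)) (lin (invmx M)) = D.
Proof.
by move=> uM; apply: eval3_ext => x; rewrite !eval3_subst !ev_lin mulmxKV.
Qed.

Lemma subst_lin_eq0 D M : M \in unitmx -> subst3 D (lin M) = 0 -> D = 0.
Proof.
by move=> uM D0; rewrite -(subst_linKV D uM) D0; exact: comp_mpoly0.
Qed.

Lemma msize_subst_lin D M : M \in unitmx ->
  (msize (subst3 D (lin M)) <= 1)%N -> (msize D <= 1)%N.
Proof.
move=> uM /msize1_polyC E; rewrite -(subst_linKV D uM) E /subst3 comp_mpolyC.
by rewrite msizeC; case: eqP.
Qed.

Lemma lin_no_common_factor phi M : M \in unitmx -> no_common_factor phi ->
  no_common_factor (comp3 (lin M) phi).
Proof.
move=> uM np D hD; apply: np => i.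
have /choice[E EP] := hD; exists (\sum_(j < 3) (invmx M) j i *: E j).
rewrite -[in LHS](lin_compK phi uM) tnth_comp_lin mulr_sumr.
by apply: eq_bigr => j _; rewrite EP scalerAr.
Qed.

Lemma comp_lin_no_common_factor phi M : M \in unitmx -> no_common_factor phi ->
  no_common_factor (comp3 phi (lin M)).
Proof.
move=> uM np D hD; apply: (@msize_subst_lin D (invmx M)); first by rewrite unitmx_inv.
apply: np => i; have [E EP] := hD i; exists (subst3 E (lin (invmx M))).
by rewrite -[LHS](subst_linKV _ uM) -[_ * _]rmorphM -EP tnth_mktuple.
Qed.

(** Turns the relation between a map and its inverse into one between vectors, where linear changes
    of coordinates cancel as matrices. *)
Lemma subst_scaleP phi psi D :
  (forall i, subst3 (tnth psi i) phi = D * var3 C i) <->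
  (forall x, ev psi (ev phi x) = eval3 D x *: x).
Proof.
split=> E => [x|i].
  by apply/rowP => i; rewrite evE -eval3_subst E eval3M eval3_var mxE.
apply: eval3_ext => x; rewrite eval3_subst -evE E mxE eval3M eval3_var.
by [].
Qed.

Lemma birational_lin k phi A B : A \in unitmx -> B \in unitmx ->
  birational_map k phi -> birational_map k (comp3 (lin A) (comp3 phi (lin B))).
Proof.
move=> uA uB [hp np [l [psi [hq nq [P [P0 /subst_scaleP PE]] [Q [Q0 /subst_scaleP QE]]]]]].
split; first by apply/lin_comp3_homog/comp3_lin_homog.
  by apply/lin_no_common_factor/comp_lin_no_common_factor.
have uA' : invmx A \in unitmx by rewrite unitmx_inv.
have uB' : invmx B \in unitmx by rewrite unitmx_inv.
exists l, (comp3 (lin (invmx B)) (comp3 psi (lin (invmx A)))); split.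
- by apply/lin_comp3_homog/comp3_lin_homog.
- by apply/lin_no_common_factor/comp_lin_no_common_factor.
- exists (subst3 P (lin B)); split.
    by apply: contra_neq P0; apply: subst_lin_eq0.
  apply/subst_scaleP => x; rewrite !ev_comp3 !ev_lin mulmxK // PE.
  by rewrite -scalemxAl mulmxK // eval3_subst ev_lin.
- exists (subst3 Q (lin (invmx A))); split.
    by apply: contra_neq Q0; apply: subst_lin_eq0.
  apply/subst_scaleP => x; rewrite !ev_comp3 !ev_lin mulmxKV // QE.
  by rewrite -scalemxAl mulmxKV // eval3_subst ev_lin.
Qed.

Lemma pullback_comp3 phi psi w :
  pullback_triple (comp3 phi psi) w = pullback_triple psi (pullback_triple phi w).
Proof.
apply: eq_from_tnth => j; rewrite !tnth_mktuple.
under eq_bigr => i _.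
  rewrite [tnth (comp3 _ _) _]tnth_mktuple mderiv_comp mulr_sumr.
  over.
rewrite exchange_big; apply: eq_bigr => k _; rewrite tnth_mktuple /subst3.
rewrite raddf_sum /= mulr_suml; apply: eq_bigr => i _.
by rewrite rmorphM /= -mulrA mulrA comp_mpolyA -mulrA.
Qed.

Definition mulr3 D w : triple C := [tuple D * tnth w i | i < 3].

Lemma pullback_mulr phi D w :
  pullback_triple phi (mulr3 D w) = mulr3 (subst3 D phi) (pullback_triple phi w).
Proof.
apply: eq_from_tnth => j; rewrite !tnth_mktuple mulr_sumr.
by apply: eq_bigr => i _; rewrite tnth_mktuple /subst3 rmorphM mulrA.
Qed.

Lemma mderiv_lform (a : 'I_3 -> C) j : mderiv j (lform a) = mpolyC 3 (a j).
Proof.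
rewrite /lform raddf_sum /= (bigD1 j) //= big1 => [|i ij].
  rewrite linearZ /= mderivX mnm1E eqxx scale1r addr0.
  have -> : mnm_sub (mnm1 j) (mnm1 j) = mnm0.
    by apply/mnmP => l; rewrite mnmBE subnn mnm0E.
  by rewrite mpolyX0 -alg_mpolyC.
by rewrite linearZ /= mderivX mnm1E (negPf ij) mulr0n scale0r scaler0.
Qed.

Lemma tnth_pullback_lin M w j : tnth (pullback_triple (lin M) w) j =
  \sum_(i < 3) M j i *: subst3 (tnth w i) (lin M).
Proof.
rewrite tnth_mktuple; apply: eq_bigr => i _.
by rewrite tnth_mktuple mderiv_lform mulrC mul_mpolyC.
Qed.

Lemma pullback_lin1 w : pullback_triple (lin 1%:M) w = w.
Proof.
apply: eq_from_tnth => j; rewrite tnth_pullback_lin (bigD1 j) //= big1 => [|i ij].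
  rewrite mxE eqxx scale1r addr0; apply: eval3_ext => x.
  by rewrite eval3_subst ev_lin mulmx1.
by rewrite mxE eq_sym (negPf ij) scale0r.
Qed.

Lemma comp_lin_lin A B : comp3 (lin A) (lin B) = lin (B *m A).
Proof. by apply: triple_ext => x; rewrite ev_comp3 !ev_lin mulmxA. Qed.

Lemma pullback_linK M w : M \in unitmx ->
  pullback_triple (lin (invmx M)) (pullback_triple (lin M) w) = w.
Proof.
by move=> uM; rewrite -pullback_comp3 comp_lin_lin mulVmx // pullback_lin1.
Qed.

Lemma pullback_lin_homog d w M : homogeneous_triple d w ->
  homogeneous_triple d (pullback_triple (lin M) w).
Proof.
move=> hw j; rewrite tnth_pullback_lin; apply: rpred_sum => i _; apply: rpredZ.
by have := comp3_lin_homog M hw i; rewrite tnth_mktuple.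
Qed.

Lemma foliation_lin d w M : M \in unitmx -> foliation d w ->
  foliation d (pullback_triple (lin M) w).
Proof.
move=> uM [hw nw ew]; split; first exact: pullback_lin_homog.
  move=> D hD; apply: (@msize_subst_lin D (invmx M)); first by rewrite unitmx_inv.
  have /choice[E EP] := hD.
  apply: nw => j; rewrite -(pullback_linK w uM) tnth_pullback_lin.
  exists (\sum_(i < 3) invmx M j i *: subst3 (E i) (lin (invmx M))).
  rewrite mulr_sumr; apply: eq_bigr => i _; rewrite EP.
  by rewrite /subst3 rmorphM scalerAr.
have := congr1 (fun D => subst3 D (lin M)) ew.
rewrite /subst3 raddf_sum comp_mpoly0 /= => E; rewrite -[RHS]E.
under eq_bigr => j _ do rewrite tnth_pullback_lin mulr_sumr.
rewrite exchange_big; apply: eq_bigr => i _ /=.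
rewrite rmorphM /= comp_mpolyXU' tnth_mktuple mulr_suml; apply: eq_bigr => j _.
by rewrite -scalerAr scalerAl.
Qed.

End Triples.

Local Notation i0 := (@Ordinal 3 0 isT).
Local Notation i1 := (@Ordinal 3 1 isT).
Local Notation i2 := (@Ordinal 3 2 isT).

Lemma big3 T idx (op : Monoid.law idx) (F : 'I_3 -> T) :
  \big[op/idx]_(i < 3) F i = op (F i0) (op (F i1) (F i2)).
Proof.
rewrite !big_ord_recl big_ord0 Monoid.mulm1.
by congr (op (F _) (op (F _) (F _))); apply: val_inj.
Qed.

Lemma ord3_ind (P : 'I_3 -> Prop) : P i0 -> P i1 -> P i2 -> forall i, P i.
Proof.
move=> P0 P1 P2 [[|[|[|//]]] Hi].
- by rewrite (_ : Ordinal Hi = i0) //; apply: val_inj.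
- by rewrite (_ : Ordinal Hi = i1) //; apply: val_inj.
- by rewrite (_ : Ordinal Hi = i2) //; apply: val_inj.
Qed.

(** * The standard quadratic involution *)

Section StandardQuadraticMap.
Variable C : numFieldType.
Implicit Types (phi psi w : triple C) (x : 'rV[C]_3) (D p q : form3 C).

Local Notation X i := (var3 C i).

(** Lets the possibly inhomogeneous factor D of a pullback be replaced by one of its homogeneous
    components. *)
Lemma pihomogM_homog d e p q : homog e q ->
  pihomog mdeg (d + e)%N (p * q) = pihomog mdeg d p * q.
Proof.
move=> hq; elim/mpolyind: p => [|c m p _ _ IH]; first by rewrite mul0r !pihomog0 mul0r.
rewrite mulrDl !pihomogD IH mulrDl; congr (_ + _).
rewrite -scalerAl !linearZ /= pihomogX -scalerAl; congr (_ *: _).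
have hm : homog (mdeg m + e)%N (mpolyX C m * q).
  by apply: dhomogM => //; apply/dhomogP => l; rewrite msuppX inE => /eqP ->.
case: eqP => [<-|/eqP md]; first by rewrite pihomog_dE.
by rewrite mul0r (pihomog_ne0 _ hm) // eqn_add2r.
Qed.

Lemma subst_scale_homog d p D : homog d p ->
  subst3 p [tuple D * X i | i < 3] = D ^+ d * p.
Proof.
move=> hp; apply: mpoly_eval_ext => v.
rewrite /subst3 comp_mpoly_meval mevalM rmorphXn /= -(meval_homogZ _ _ hp).
by apply: meval_eq => i; rewrite tnth_mktuple mevalM mevalXU.
Qed.

Lemma mderivXU i j : mderiv j (X i) = (i == j)%:R.
Proof.
have -> : X i = lform (fun k => (k == i)%:R) by rewrite lform_delta.
by rewrite mderiv_lform eq_sym; case: eqP; rewrite ?mpolyC0 ?mpolyC1.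
Qed.

(** d(D x_i) = D dx_i + x_i dD, and the terms in dD add up to a multiple of the Euler relation. For
    a foliation of degree 2 the coefficients are cubic, which gives the exponent 4 in (xyz)^4. *)
Lemma pullback_scale d w D : homogeneous_triple d w ->
  \sum_(i < 3) X i * tnth w i = 0 ->
  pullback_triple [tuple D * X i | i < 3] w = mulr3 (D ^+ d.+1) w.
Proof.
move=> hw ew; apply: eq_from_tnth => j; rewrite !tnth_mktuple.
under eq_bigr => i _.
  rewrite (subst_scale_homog _ (hw i)) tnth_mktuple mderivM mulrDr mderivXU; over.
rewrite big_split /= (_ : \sum_(i < 3) _ = D ^+ d * mderiv j D * \sum_(i < 3) X i * tnth w i).
  rewrite ew mulr0 add0r (bigD1 j) //= big1 => [|i /negPf ij].
    by rewrite eqxx mulr1 addr0 exprS; ring.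
  by rewrite ij mulr0 mulr0.
by rewrite mulr_sumr; apply: eq_bigr => i _; ring.
Qed.

(** Written as products over complements, so that its symmetry under permutations of the coordinates
    is a reindexing. *)
Definition std_quad : triple C := [tuple \prod_(j < 3 | j != i) X j | i < 3].

Lemma tnth_std_quad : [/\ tnth std_quad i0 = X i1 * X i2,
  tnth std_quad i1 = X i0 * X i2 & tnth std_quad i2 = X i0 * X i1].
Proof.
by split; rewrite tnth_mktuple big_mkcond big3 /= ?mul1r ?mulr1.
Qed.

Lemma ev_std_quad x : [/\ ev std_quad x 0 i0 = x 0 i1 * x 0 i2,
  ev std_quad x 0 i1 = x 0 i0 * x 0 i2 & ev std_quad x 0 i2 = x 0 i0 * x 0 i1].
Proof. by case: tnth_std_quad => e0 e1 e2; rewrite !evE e0 e1 e2 !eval3M !eval3_var. Qed.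

Definition xyz : multinom 3 := mnm_add (mnm1 i0) (mnm_add (mnm1 i1) (mnm1 i2)).

Lemma std_quad_involutive : comp3 std_quad std_quad = [tuple mpolyX C xyz * X i | i < 3].
Proof.
apply: triple_ext => x; apply/rowP; rewrite ev_comp3.
have [e0 e1 e2] := ev_std_quad x; have [f0 f1 f2] := ev_std_quad (ev std_quad x).
apply: ord3_ind; rewrite ?f0 ?f1 ?f2 ?e0 ?e1 ?e2 evE tnth_mktuple /xyz !mpolyXD.
all: rewrite !eval3M !eval3_var; ring.
Qed.

Lemma std_quad_homog : homogeneous_triple 2 std_quad.
Proof.
have hX i : homog 1 (X i) by rewrite -[X i]lform_delta; apply: lform_homog.
by case: tnth_std_quad => e0 e1 e2; apply: ord3_ind; rewrite ?e0 ?e1 ?e2;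
  apply: (@dhomogM _ _ _ 1 _ 1); apply: hX.
Qed.

(** No variable divides [D]: component [i] takes the value 1 where coordinate [i] is 0 and the
    others are 1. As [D] divides yz, the whole monomial goes into the cofactor and [D] is a unit. *)
Lemma std_quad_no_common_factor : no_common_factor std_quad.
Proof.
move=> D hD; have [E] := hD i0; have [-> e1 e2] := tnth_std_quad => DE.
have : monomial_free D.
  move=> i [r Dr]; have [F] := hD i; rewrite Dr.
  move=> /(congr1 (meval (fun j => (j != i)%:R))).
  rewrite !mevalM mevalXU eqxx !mul0r tnth_mktuple rmorph_prod big1.
    by move/eqP; rewrite oner_eq0.
  by move=> j ji; rewrite /= mevalXU ji.
move=> Dfree.
have [|r Er] := @monomial_free_cancel _ _ D E (mnm_add (mnm1 i1) (mnm1 i2)) 1 Dfree.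
  by rewrite mulr1 mpolyXD.
have : D * r = 1.
  apply: (mulfI (mpolyX_neq0 C (mnm_add (mnm1 i1) (mnm1 i2)))).
  by rewrite mulrCA -Er -DE mulr1 mpolyXD.
move=> Dr1; have := @msizeM 3 C D r; rewrite Dr1 msize1.
have [->|D0] := eqVneq D 0; first by rewrite msize0.
have [r0|r0] := eqVneq r 0.
  by move/eqP: Dr1; rewrite r0 mulr0 eq_sym oner_eq0.
have {}D0 : (0 < msize D)%N by rewrite lt0n msize_poly_eq0.
have {}r0 : (0 < msize r)%N by rewrite lt0n msize_poly_eq0.
by move=> /(_ isT isT); move: (msize D) (msize r) D0 r0 => a b; lia.
Qed.

Lemma std_quad_birational : birational_map 2 std_quad.
Proof.
have E : exists P : form3 C, P != 0 /\ forall i, subst3 (tnth std_quad i) std_quad = P * X i.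
  exists (mpolyX C xyz); split=> [|i]; first exact: mpolyX_neq0.
  have := congr1 (fun t : triple C => tnth t i) std_quad_involutive.
  by rewrite /= !tnth_mktuple.
split; [exact: std_quad_homog | exact: std_quad_no_common_factor |].
by exists 2%N, std_quad; split => //;
  [exact: std_quad_homog | exact: std_quad_no_common_factor].
Qed.

Lemma pullback_std_quadK w : foliation 2 w ->
  pullback_triple std_quad (pullback_triple std_quad w) =
  mulr3 (mpolyX C (mnm_muln xyz 4)) w.
Proof.
move=> [hw _ ew]; rewrite -pullback_comp3 std_quad_involutive.
by rewrite (pullback_scale _ hw ew) mpolyXn.
Qed.

Lemma pullback_std_quad_homog w : homogeneous_triple 3 w ->
  homogeneous_triple 7 (pullback_triple std_quad w).
Proof.
move=> hw j; rewrite tnth_mktuple; apply: rpred_sum => i _.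
apply: (@dhomogM _ _ _ 6 _ 1).
  by apply: (@comp_mpoly_homog _ _ _ 3 2) => // k; apply: std_quad_homog.
by apply: mderiv_homog; apply: std_quad_homog.
Qed.

Lemma foliation_neq0 d w : foliation d w -> exists i, tnth w i != 0.
Proof.
move=> [_ nw _]; apply/not_existsP => w0.
have : (msize (X i0) <= 1)%N.
  apply: nw => i; exists 0; rewrite mulr0; apply/eqP.
  by apply: contrapT => /negP; exact: w0.
by rewrite /var3 msizeX mdeg1.
Qed.

Lemma subst_monomial_std_quad m :
  exists m', subst3 (mpolyX C m) std_quad = mpolyX C m'.
Proof.
pose P (p : form3 C) := exists a, p = mpolyX C a.
rewrite /subst3 comp_mpolyX; apply: (big_ind P) => [|p q [a ->] [b ->]|i _].
- by exists mnm0; rewrite mpolyX0.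
- by exists (mnm_add a b); rewrite mpolyXD.
- have [a ->] : exists a, tnth std_quad i = mpolyX C a.
    rewrite tnth_mktuple; apply: (big_ind P) => [|p q [a ->] [b ->]|j _].
    + by exists mnm0; rewrite mpolyX0.
    + by exists (mnm_add a b); rewrite mpolyXD.
    + by exists (mnm1 j).
  by exists (mnm_muln a (m i)); rewrite mpolyXn.
Qed.

(* As sigma^* sigma^* w = (xyz)^4 w, the form D o sigma is a monomial times a
   common factor of w; apply sigma again. *)
Lemma std_quad_pullback_gcd w w' D : foliation 2 w -> homogeneous_triple 3 w' ->
  (forall j, tnth (pullback_triple std_quad w) j = D * tnth w' j) ->
  exists i, forall j, mdvd (X i ^+ 2) (tnth (pullback_triple std_quad w) j).
Proof.
move=> Fw hw' DE; have [i wi0] := foliation_neq0 Fw; have [hw nw ew] := Fw.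
(* The pullback has coefficients of degree 7 and those of [w'] have degree 3, so only the component
   of degree 4 of [D] contributes. *)
pose D4 := pihomog mdeg 4 D; have hD4 : homog 4 D4 by exact: pihomogP.
have {}DE j : tnth (pullback_triple std_quad w) j = D4 * tnth w' j.
  rewrite -(pihomogM_homog 4 _ (hw' j)) -DE pihomog_dE //.
  exact: pullback_std_quad_homog.
pose p := subst3 D4 std_quad.
have pE j : p * tnth (pullback_triple std_quad w') j =
    mpolyX C (mnm_muln xyz 4) * tnth w j.
  have := congr1 (fun t : triple C => tnth t j) (pullback_std_quadK Fw).
  rewrite (_ : pullback_triple std_quad w = mulr3 D4 w'); last first.
    by apply: eq_from_tnth => k; rewrite DE tnth_mktuple.
  by rewrite pullback_mulr !tnth_mktuple.
have p0 : p != 0.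
  apply: contraNneq wi0 => p0; have := pE i; rewrite p0 mul0r => /esym/eqP.
  by rewrite mulf_eq0 (negPf (mpolyX_neq0 _ _)).
have D40 : D4 != 0.
  by apply: contra_neq p0 => D40; rewrite /p D40; exact: comp_mpoly0.
have [m [q [pq qfree]]] := monomial_decomp p0.
(* The monomial-free part [q] of [p] cannot absorb any variable of (xyz)^4, so it divides every
   coefficient of [w] and must be constant. *)
have /msize1_polyC qc : (msize q <= 1)%N.
  apply: nw => j; have := pE j; rewrite pq -mulrA mulrCA => E.
  have [r rE] := monomial_free_cancel qfree E; exists r.
  have /mulfI : mpolyX C (mnm_muln xyz 4) != 0 by exact: mpolyX_neq0.
  by apply; rewrite -E rE mulrCA.
set c := mcoeff _ _ in qc.
have [m' m'E] := subst_monomial_std_quad m.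
(* Since sigma o sigma is multiplication by xyz and [D4] is homogeneous of degree 4, substituting
   sigma into [p] gives (xyz)^4 [D4]. *)
have : D4 * mpolyX C (mnm_muln xyz 4) =
    c *: mpolyX C m'.
  have := subst_scale_homog (mpolyX C xyz) hD4.
  rewrite -std_quad_involutive mpolyXn mulrC => <-; rewrite -m'E.
  have -> : subst3 D4 (comp3 std_quad std_quad) = subst3 p std_quad.
    by rewrite /subst3 /p /subst3 comp_mpolyA.
  by rewrite pq qc mulrC mul_mpolyC /subst3 comp_mpolyZ.
move=> /(mulX_monomial D40)[k [D4k _]].
have kd : mdeg k = 4%N.
  apply/esym/(dhomog_uniq D40 hD4).
  by rewrite D4k; apply: rpredZ; apply/dhomogP => l; rewrite msuppX inE => /eqP ->.
(* Four factors among three variables: one variable occurs at least twice. *)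
have [l kl] : exists l, (1 < k l)%N.
  apply/existsP; apply: contraT => /existsPn kl; move: kd; rewrite mdegE big3 /=.
  by move: (kl i0) (kl i1) (kl i2); rewrite -!leqNgt; lia.
exists l => j; rewrite DE D4k.
have kE : k = mnm_add (mnm1 l) (mnm_add (mnm1 l) (mnm_sub k (mnm_add (mnm1 l) (mnm1 l)))).
  apply/mnmP => h; rewrite !mnmDE mnmBE !mnmDE mnm1E.
  by case: eqP kl => [->|_]; lia.
exists (c *: mpolyX C (mnm_sub k (mnm_add (mnm1 l) (mnm1 l))) * tnth w' j).
by rewrite [in LHS]kE !mpolyXD -/(var3 C l) -!mul_mpolyC; ring.
Qed.

End StandardQuadraticMap.

(** * Coefficients of quadratic and cubic forms *)

Section Expansion.
Variable C : numFieldType.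
Implicit Types (w : triple C) (x : 'rV[C]_3) (p q : form3 C).

Definition mon3 i j k : multinom 3 := Multinom [tuple i; j; k].

Lemma mon3E i j k : (mon3 i j k i0 = i) * (mon3 i j k i1 = j) * (mon3 i j k i2 = k).
Proof. by rewrite !mnm_tnth /mon3 /= !(tnth_nth 0%N). Qed.

Lemma mon3_eta (m : multinom 3) : m = mon3 (m i0) (m i1) (m i2).
Proof. by apply/mnmP; apply: ord3_ind; rewrite mon3E. Qed.

Lemma eval3_mon3 i j k x :
  eval3 (mpolyX C (mon3 i j k)) x = x 0 i0 ^+ i * (x 0 i1 ^+ j * x 0 i2 ^+ k).
Proof. by rewrite /eval3 mevalX big3 /= !mon3E. Qed.

Lemma eval3_homogE d p x (S : seq (multinom 3)) : homog d p -> uniq S ->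
  (forall m, mdeg m = d -> m \in S) ->
  eval3 p x = \sum_(m <- S) mcoeff m p * eval3 (mpolyX C m) x.
Proof.
move=> /dhomogP hp uS SP; rewrite /eval3 mevalE.
rewrite [RHS](bigID (fun m => m \in msupp p)) /= [X in _ + X]big1 ?addr0; last first.
  by move=> m; rewrite -mcoeff_eq0 => /eqP ->; rewrite mul0r.
rewrite -[RHS]big_filter; under [RHS]eq_bigr => m _ do rewrite mevalX.
apply: perm_big; apply: uniq_perm; rewrite ?msupp_uniq ?filter_uniq // => m.
rewrite mem_filter; have [mp|//] := boolP (m \in msupp p).
by rewrite SP //; exact: hp.
Qed.

Definition cubic_monomials := [:: mon3 3 0 0; mon3 2 1 0; mon3 2 0 1; mon3 1 2 0;
  mon3 1 1 1; mon3 1 0 2; mon3 0 3 0; mon3 0 2 1; mon3 0 1 2; mon3 0 0 3].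

Lemma mem_cubic_monomials m : mdeg m = 3%N -> m \in cubic_monomials.
Proof.
rewrite mdegE big3 /= => md; rewrite [m]mon3_eta.
by move: (m i0) (m i1) (m i2) md => [|[|[|[|i]]]] [|[|[|[|j]]]] [|[|[|[|k]]]].
Qed.

Definition cubic_coef p i j k := mcoeff (mon3 i j k) p.

Lemma cubicE p x (c := cubic_coef p) : homog 3 p -> eval3 p x =
    c 3%N 0%N 0%N * x 0 i0 ^+ 3
    + x 0 i0 ^+ 2 * (c 2%N 1%N 0%N * x 0 i1 + c 2%N 0%N 1%N * x 0 i2)
    + x 0 i0 * (c 1%N 2%N 0%N * x 0 i1 ^+ 2 + c 1%N 1%N 1%N * (x 0 i1 * x 0 i2)
       + c 1%N 0%N 2%N * x 0 i2 ^+ 2)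
    + (c 0%N 3%N 0%N * x 0 i1 ^+ 3 + c 0%N 2%N 1%N * (x 0 i1 ^+ 2 * x 0 i2)
       + c 0%N 1%N 2%N * (x 0 i1 * x 0 i2 ^+ 2) + c 0%N 0%N 3%N * x 0 i2 ^+ 3).
Proof.
move=> hp; rewrite (eval3_homogE _ hp (S := cubic_monomials)) //; last first.
  exact: mem_cubic_monomials.
rewrite !big_cons big_nil !eval3_mon3 {}/c /cubic_coef.
move: (mcoeff (mon3 3 0 0) p) (mcoeff (mon3 2 1 0) p) (mcoeff (mon3 2 0 1) p)
  (mcoeff (mon3 1 2 0) p) (mcoeff (mon3 1 1 1) p) (mcoeff (mon3 1 0 2) p)
  (mcoeff (mon3 0 3 0) p) (mcoeff (mon3 0 2 1) p) (mcoeff (mon3 0 1 2) p)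
  (mcoeff (mon3 0 0 3) p) => *; ring.
Qed.

Lemma quadratic_monomialsE : quadratic_monomials =
  [:: mon3 2 0 0; mon3 0 2 0; mon3 0 0 2; mon3 1 1 0; mon3 1 0 1; mon3 0 1 1].
Proof.
have e0 : inord 0 = i0 by apply: val_inj; rewrite /= inordK.
have e1 : inord 1 = i1 by apply: val_inj; rewrite /= inordK.
have e2 : inord 2 = i2 by apply: val_inj; rewrite /= inordK.
rewrite /quadratic_monomials /= e0 e1 e2.
by congr [:: _; _; _; _; _; _]; apply/mnmP; apply: ord3_ind; rewrite mnmDE !mnm1E mon3E.
Qed.

Lemma mem_quadratic_monomials m : mdeg m = 2%N -> m \in quadratic_monomials.
Proof.
rewrite quadratic_monomialsE mdegE big3 /= => md; rewrite [m]mon3_eta.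
by move: (m i0) (m i1) (m i2) md => [|[|[|i]]] [|[|[|j]]] [|[|[|k]]].
Qed.

Definition quadratic_coef p k := mcoeff (nth mnm0 quadratic_monomials k) p.

Lemma quadraticE p x (c := quadratic_coef p) : homog 2 p -> eval3 p x =
    c 0%N * x 0 i0 ^+ 2 + c 1%N * x 0 i1 ^+ 2 + c 2%N * x 0 i2 ^+ 2
    + c 3%N * (x 0 i0 * x 0 i1) + c 4%N * (x 0 i0 * x 0 i2) + c 5%N * (x 0 i1 * x 0 i2).
Proof.
move=> hp; rewrite {}/c /quadratic_coef (eval3_homogE _ hp (S := quadratic_monomials)); last 2 first.
- by rewrite quadratic_monomialsE.
- exact: mem_quadratic_monomials.
rewrite quadratic_monomialsE /= !big_cons big_nil !eval3_mon3.
move: (mcoeff (mon3 2 0 0) p) (mcoeff (mon3 0 2 0) p) (mcoeff (mon3 0 0 2) p)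
  (mcoeff (mon3 1 1 0) p) (mcoeff (mon3 1 0 1) p) (mcoeff (mon3 0 1 1) p) => *; ring.
Qed.

Lemma quadratic_coord_coefE (phi : triple C) (k : 'I_18) :
  quadratic_coord phi k = quadratic_coef (nth 0 phi (k %/ 6)%N) (k %% 6)%N.
Proof. by []. Qed.

Lemma order2_coef (c0 c1 : C) (f g : C -> C) : polyfun f -> polyfun g ->
  (forall t, c0 + c1 * t + t ^+ 2 * f t = t ^+ 2 * g t) -> c0 = 0 /\ c1 = 0.
Proof.
move=> [p fp] [q gq] E.
have /(congr1 (fun r : {poly C} => (r`_0, r`_1))) :
    c0%:P + c1%:P * 'X + 'X^2 * p - 'X^2 * q = 0.
  apply: horner_eq0_poly => t; rewrite !hornerE -fp -gq E; ring.
by rewrite /= !coefB !coefD !coefXnM !coefMX !coefC /= !addr0 !add0r !subr0 => -[].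
Qed.

(** Interpolation at 1, -1 and 2. The point 0 is avoided because a power of t is often cancelled
    before the lemma is applied. *)
Lemma quadratic_coef0 (a b c : C) : (forall t, t != 0 -> a + b * t + c * t ^+ 2 = 0) ->
  [/\ a = 0, b = 0 & c = 0].
Proof.
move=> E.
have e1 := E 1 (oner_neq0 _).
have e2 : a + b * -1 + c * (-1) ^+ 2 = 0 by apply: E; rewrite oppr_eq0 oner_neq0.
have e3 : a + b * 2%:R + c * 2%:R ^+ 2 = 0 by apply: E; rewrite pnatr_eq0.
have n2 : 2%:R != 0 :> C by rewrite pnatr_eq0.
have n3 : 3%:R != 0 :> C by rewrite pnatr_eq0.
split.
- transitivity ((a + b * 1 + c * 1 ^+ 2) + (a + b * -1 + c * (-1) ^+ 2) / 3%:R
    - (a + b * 2%:R + c * 2%:R ^+ 2) / 3%:R); last by rewrite e1 e2 e3; ring.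
  by field.
- transitivity (((a + b * 1 + c * 1 ^+ 2) - (a + b * -1 + c * (-1) ^+ 2)) / 2%:R).
    by field.
  by rewrite e1 e2; ring.
- transitivity ((a + b * 2%:R + c * 2%:R ^+ 2) / 3%:R - (a + b * 1 + c * 1 ^+ 2) / 2%:R
     + (a + b * -1 + c * (-1) ^+ 2) / 6%:R); last by rewrite e1 e2 e3; ring.
  by field.
Qed.

End Expansion.

(** * Foliations whose pullback by sigma is divisible by x^2 *)

Section RiccatiForm.
Variable C : numFieldType.
Implicit Types (w : triple C) (x : 'rV[C]_3) (p q : form3 C).

Local Notation c3 := cubic_coef.

Lemma foliation_eval d w x : foliation d w ->
  x 0 i0 * eval3 (tnth w i0) x + x 0 i1 * eval3 (tnth w i1) x
    + x 0 i2 * eval3 (tnth w i2) x = 0.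
Proof.
move=> [_ _ /(congr1 (fun p => eval3 p x))]; rewrite big3 /= !eval3D !eval3M !eval3_var.
by rewrite addrA => ->; exact: meval0.
Qed.

Definition pt (a b c : C) : 'rV[C]_3 := \row_i nth 0 [:: a; b; c] i.

Lemma ptE a b c : (pt a b c 0 i0 = a) * (pt a b c 0 i1 = b) * (pt a b c 0 i2 = c).
Proof. by rewrite !mxE. Qed.

Lemma pt_eta x : x = pt (x 0 i0) (x 0 i1) (x 0 i2).
Proof. by apply/rowP; apply: ord3_ind; rewrite ptE. Qed.

Lemma polyfun_eval3 p (a b c : C -> C) : polyfun a -> polyfun b -> polyfun c ->
  polyfun (fun t => eval3 p (pt (a t) (b t) (c t))).
Proof.
move=> pa pb pc.
have [q qE] : polyfun (fun t => meval (fun i : 'I_3 => nth 0 [:: a t; b t; c t] i) p).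
  by apply: polyfun_meval; apply: ord3_ind.
by exists q => t; rewrite -qE /eval3; apply: meval_eq => i; rewrite mxE.
Qed.

Lemma eval3_pullback_std_quad w x (s := ev (std_quad C) x) :
  [/\ eval3 (tnth (pullback_triple (std_quad C) w) i0) x =
        eval3 (tnth w i1) s * x 0 i2 + eval3 (tnth w i2) s * x 0 i1,
      eval3 (tnth (pullback_triple (std_quad C) w) i1) x =
        eval3 (tnth w i0) s * x 0 i2 + eval3 (tnth w i2) s * x 0 i0
    & eval3 (tnth (pullback_triple (std_quad C) w) i2) x =
        eval3 (tnth w i0) s * x 0 i1 + eval3 (tnth w i1) s * x 0 i0].
Proof.
have [e0 e1 e2] := tnth_std_quad C.
have dX i j : eval3 (mderiv j (var3 C i)) x = (i == j)%:R.
  by rewrite mderivXU /eval3; case: eqP; rewrite ?meval1 ?meval0.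
by split; rewrite tnth_mktuple big3 /= e0 e1 e2 !mderivM !eval3D !eval3M !eval3D
  !eval3M !dX !eval3_var !eval3_subst -/s /=; ring.
Qed.

Lemma std_quad_pt a b c : ev (std_quad C) (pt a b c) = pt (b * c) (a * c) (a * b).
Proof.
have [e0 e1 e2] := ev_std_quad (pt a b c).
by apply/rowP; apply: ord3_ind; rewrite ?e0 ?e1 ?e2 !ptE.
Qed.

(** The point is sigma(t, y, z), so this is the expansion modulo t^2 of a coefficient of w along
    sigma. *)
Lemma cubic_order2 p y z : homog 3 p -> exists2 r, polyfun r & forall t,
  eval3 p (pt (y * z) (t * z) (t * y)) = c3 p 3 0 0 * (y * z) ^+ 3
    + t * ((y * z) ^+ 2 * (c3 p 2 1 0 * z + c3 p 2 0 1 * y)) + t ^+ 2 * r t.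
Proof.
move=> hp; pose r0 := y * z * (c3 p 1 2 0 * z ^+ 2 + c3 p 1 1 1 * (z * y) + c3 p 1 0 2 * y ^+ 2).
pose r1 := c3 p 0 3 0 * z ^+ 3 + c3 p 0 2 1 * (z ^+ 2 * y) + c3 p 0 1 2 * (z * y ^+ 2)
   + c3 p 0 0 3 * y ^+ 3.
exists (fun t => r0 + r1 * t).
  by exists (r0%:P + r1 *: 'X) => t; rewrite !hornerE.
by move=> t; rewrite (cubicE _ hp) !ptE /r0 /r1; move: (c3 p) => c; ring.
Qed.

Lemma mul_sqr_coef0 (p : C -> C) (k : nat) : (forall z, z ^+ k * p z = 0) ->
  forall z, z != 0 -> p z = 0.
Proof.
by move=> E z z0; apply/eqP; move/eqP: (E z); rewrite mulf_eq0 expf_eq0 (negPf z0) andbF.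
Qed.

(* The coefficients of x^0 and x^1 in the first two components of sigma^*w,
   together with the Euler relation for w. *)
Lemma riccati_coef0 w : foliation 2 w ->
  (forall j, mdvd (var3 C i0 ^+ 2) (tnth (pullback_triple (std_quad C) w) j)) ->
  [/\ c3 (tnth w i0) 3 0 0 = 0, c3 (tnth w i0) 2 1 0 = 0 & c3 (tnth w i0) 2 0 1 = 0] /\
  [/\ c3 (tnth w i0) 1 2 0 = 0, c3 (tnth w i0) 1 1 1 = 0 & c3 (tnth w i0) 1 0 2 = 0] /\
  [/\ c3 (tnth w i1) 3 0 0 = 0, c3 (tnth w i1) 2 1 0 = 0 & c3 (tnth w i1) 0 3 0 = 0].
Proof.
move=> Fw dvd; have [hw _ _] := Fw.
have wE i x := cubicE x (hw i).
have [eX dX] := dvd i0; have [eY dY] := dvd i1.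
have eval_sqr e x : eval3 (var3 C i0 ^+ 2 * e) x = x 0 i0 ^+ 2 * eval3 e x.
  by rewrite expr2 !eval3M !eval3_var.
have coefX y z :
    c3 (tnth w i1) 3 0 0 * (y * z) ^+ 3 * z + c3 (tnth w i2) 3 0 0 * (y * z) ^+ 3 * y = 0 /\
    (y * z) ^+ 2 * (c3 (tnth w i1) 2 1 0 * z + c3 (tnth w i1) 2 0 1 * y) * z
      + (y * z) ^+ 2 * (c3 (tnth w i2) 2 1 0 * z + c3 (tnth w i2) 2 0 1 * y) * y = 0.
  have [r1 pr1 E1] := cubic_order2 y z (hw i1).
  have [r2 pr2 E2] := cubic_order2 y z (hw i2).
  apply: (@order2_coef _ _ _ (fun t => r1 t * z + r2 t * y) (fun t => eval3 eX (pt t y z))).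
  - apply: polyfunD; apply: polyfunM => //; exact: polyfun_cst.
  - apply: polyfun_eval3; [exact: polyfun_id | exact: polyfun_cst | exact: polyfun_cst].
  move=> t; have [+ _ _] := eval3_pullback_std_quad w (pt t y z).
  by rewrite dX eval_sqr std_quad_pt !ptE => ->; rewrite E1 E2; ring.
have coefY y z :
    c3 (tnth w i0) 3 0 0 * (y * z) ^+ 3 * z = 0 /\
    (y * z) ^+ 2 * (c3 (tnth w i0) 2 1 0 * z + c3 (tnth w i0) 2 0 1 * y) * z
      + c3 (tnth w i2) 3 0 0 * (y * z) ^+ 3 = 0.
  have [r1 pr1 E1] := cubic_order2 y z (hw i0).
  have [r2 pr2 E2] := cubic_order2 y z (hw i2).
  apply: (@order2_coef _ _ _
    (fun t => r1 t * z + (y * z) ^+ 2 * (c3 (tnth w i2) 2 1 0 * z + c3 (tnth w i2) 2 0 1 * y)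
       + t * r2 t) (fun t => eval3 eY (pt t y z))).
  - apply: polyfunD; last by apply: polyfunM => //; exact: polyfun_id.
    by apply: polyfunD; [apply: polyfunM => // |]; exact: polyfun_cst.
  - apply: polyfun_eval3; [exact: polyfun_id | exact: polyfun_cst | exact: polyfun_cst].
  move=> t; have [_ + _] := eval3_pullback_std_quad w (pt t y z).
  by rewrite dY eval_sqr std_quad_pt !ptE => ->; rewrite E1 E2; ring.
(* At y = 1 the first relation of [coefX] is z^3 times a polynomial of degree 1 in z; the trivial
   third equation pads it to a quadratic one. *)
have [c300 b300 _] : [/\ c3 (tnth w i2) 3 0 0 = 0, c3 (tnth w i1) 3 0 0 = 0 & 0 = 0 :> C].
  apply: quadratic_coef0; apply: (@mul_sqr_coef0 _ 3) => z.
  have [H _] := coefX 1 z; rewrite -[RHS]H; ring.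
have [c201 bc b210] : [/\ c3 (tnth w i2) 2 0 1 = 0,
    c3 (tnth w i1) 2 0 1 + c3 (tnth w i2) 2 1 0 = 0 & c3 (tnth w i1) 2 1 0 = 0].
  apply: quadratic_coef0; apply: (@mul_sqr_coef0 _ 2) => z.
  by have [_ H] := coefX 1 z; rewrite -[RHS]H; ring.
have a300 : c3 (tnth w i0) 3 0 0 = 0.
  by have [H _] := coefY 1 1; rewrite -[RHS]H; ring.
have [a201 a210 _] : [/\ c3 (tnth w i0) 2 0 1 = 0, c3 (tnth w i0) 2 1 0 = 0 & 0 = 0 :> C].
  apply: quadratic_coef0; apply: (@mul_sqr_coef0 _ 3) => z.
  by have [_ H] := coefY 1 z; rewrite -[RHS]H c300; ring.
have E x := foliation_eval x Fw.
have b030 : c3 (tnth w i1) 0 3 0 = 0.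
  have H := E (pt 0 1 0); rewrite -[RHS]H !wE !ptE.
  by move: (c3 (tnth w i0)) (c3 (tnth w i1)) (c3 (tnth w i2)) => *; ring.
suff H : [/\ c3 (tnth w i0) 1 2 0 = 0, c3 (tnth w i0) 1 1 1 = 0 & c3 (tnth w i0) 1 0 2 = 0].
  by [].
apply: quadratic_coef0 => z _.
(* The coefficients of 1, t and t^2 in the Euler relation at (t, 1, z). Only the last is wanted:
   there the contributions of B and C cancel by [bc], which leaves those of A. *)
have [] : [/\ eval3 (tnth w i1) (pt 0 1 z) + z * eval3 (tnth w i2) (pt 0 1 z) = 0,
    eval3 (tnth w i0) (pt 0 1 z) + c3 (tnth w i1) 1 2 0 + c3 (tnth w i1) 1 1 1 * z
    + c3 (tnth w i1) 1 0 2 * z ^+ 2 + c3 (tnth w i2) 1 2 0 * z + c3 (tnth w i2) 1 1 1 * z ^+ 2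
    + c3 (tnth w i2) 1 0 2 * z ^+ 3 = 0 &
    c3 (tnth w i0) 1 2 0 + c3 (tnth w i0) 1 1 1 * z + c3 (tnth w i0) 1 0 2 * z ^+ 2 = 0] => //.
have c210 : c3 (tnth w i2) 2 1 0 = - c3 (tnth w i1) 2 0 1.
  by apply/eqP; rewrite -addr_eq0 addrC bc.
apply: quadratic_coef0 => t _; rewrite -[RHS](E (pt t 1 z)) !wE !ptE.
rewrite a300 a210 a201 b300 b210 c300 c201 c210.
by move: (c3 (tnth w i0)) (c3 (tnth w i1)) (c3 (tnth w i2)) => *; ring.
Qed.

End RiccatiForm.

(** * Riccati foliations on the trivial bundle *)

Section Differentials.
Variables (C : numFieldType) (V : normedModType C).
Implicit Types (f g : V -> C) (x v : V).

Definition linear_functional f :=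
  (forall c u v, f (c *: u + v) = c * f u + f v) /\ continuous (f : V -> C^o).

(** Differentiability is kept together with an explicit differential, so that polynomial expressions
    are differentiated syntactically and the result is normalised by [ring]. *)
Definition has_diff f x (df : V -> C) :=
  differentiable (f : V -> C^o) x /\ forall v, 'D_v (f : V -> C^o) x = df v.

Lemma derive_affine (W : normedModType C) (f : V -> W) x v w :
  (forall h : C, f (h *: v + x) = h *: w + f x) -> 'D_v f x = w.
Proof.
move=> E; rewrite /derive; apply: lim_near_cst => //.
near=> h; rewrite /= E addrK scalerA mulVf ?scale1r //.
by near: h; exact: nbhs_dnbhs_neq.
Unshelve. all: by end_near. Qed.

Lemma has_diff_cst c x : has_diff (fun=> c) x (fun=> 0).
Proof.
split; first exact: differentiable_cst.
by move=> v; apply: derive_affine => h; rewrite scaler0 add0r.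
Qed.

Lemma has_diff_linear f x : linear_functional f -> has_diff f x f.
Proof.
move=> [fl fc]; split; last by move=> v; apply: derive_affine => h; rewrite fl.
pose F := GRing.isLinear.Build C V C^o _ f fl.
pose fL : {linear V -> C^o} := HB.pack f F.
exact: (@linear_differentiable _ _ _ fL).
Qed.

Lemma has_diffD f g x df dg : has_diff f x df -> has_diff g x dg ->
  has_diff (fun y => f y + g y) x (fun v => df v + dg v).
Proof.
move=> [df1 dfE] [dg1 dgE]; split; first exact: differentiableD.
by move=> v; rewrite deriveD ?dfE ?dgE //; exact: diff_derivable.
Qed.

Lemma has_diffM f g x df dg : has_diff f x df -> has_diff g x dg ->
  has_diff (fun y => f y * g y) x (fun v => f x * dg v + g x * df v).
Proof.
move=> [df1 dfE] [dg1 dgE]; split; first exact: differentiableM.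
by move=> v; rewrite deriveM ?dfE ?dgE //; exact: diff_derivable.
Qed.

Lemma has_diffN f x df : has_diff f x df -> has_diff (fun y => - f y) x (fun v => - df v).
Proof.
move=> [df1 dfE]; split; first exact: differentiableN.
by move=> v; rewrite deriveN ?dfE //; exact: diff_derivable.
Qed.

Lemma has_diffB f g x df dg : has_diff f x df -> has_diff g x dg ->
  has_diff (fun y => f y - g y) x (fun v => df v - dg v).
Proof. by move=> hf hg; apply: has_diffD => //; apply: has_diffN. Qed.

Lemma has_diffX f x df k : has_diff f x df ->
  has_diff (fun y => f y ^+ k) x (fun v => k%:R * f x ^+ k.-1 * df v).
Proof.
elim: k => [|k IH] hf.
  have [d E] := has_diff_cst 1 x; split=> // v.
  by rewrite [LHS]E !mul0r.
have [d E] := has_diffM hf (IH hf); split.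
  by move: d; congr (differentiable _ _); apply/funext => y; rewrite exprS.
move=> v; transitivity ('D_v (fun y => f y * f y ^+ k : C^o) x).
  by congr ('D_v _ _); apply/funext => y; rewrite exprS.
rewrite E; case: k {IH E d} => [|k] /=; first by rewrite !expr0; ring.
by rewrite !exprS -!natr1; ring.
Qed.

End Differentials.

Section LineDensity.
Variables (C : numFieldType) (V : normedModType C).

(** Along the line from a point p of [O] to [p1], f is a polynomial that is nonzero at t = 1. It
    cannot vanish at all the points e / (n + 2), which are infinitely many and all lie within e of
    0. *)
Lemma open_neq0 (f : V -> C) (p1 : V) (O : set V) :
  (forall p v, polyfun (fun t => f (t *: v + p))) -> f p1 != 0 ->
  open O -> O !=set0 -> exists2 p, O p & f p != 0.
Proof.
move=> pf f1 oO [p Op]; have [q qE] := pf p (p1 - p).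
have q0 : q != 0.
  by apply: contraNneq f1 => q0; rewrite -[p1](subrK p) -[p1 - p]scale1r qE q0 horner0.
have : nbhs (0 : C) [set t : C | O (t *: (p1 - p) + p)].
  have cf : {for (0 : C), continuous (fun t : C => t *: (p1 - p) + p)}.
    by move: (@scalel_continuous C V (p1 - p) 0) => c1; exact: (cvgD c1 (cvg_cst _)).
  by apply: cf; apply: open_nbhs_nbhs; split=> //; rewrite scale0r add0r.
move=> /nbhs_ballP[e /= e0 eO].
pose t n : C := e / n.+2%:R.
have [[n nq]|nq] := pselect (exists n, q.[t n] != 0).
  exists (t n *: (p1 - p) + p); last by rewrite qE.
  apply: eO; rewrite /ball /= sub0r normrN gtr0_norm ?divr_gt0 ?ltr0n //.
  by rewrite ltr_pdivrMr ?ltr0n // ltr_pMr // ltr1n.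
have := @max_poly_roots _ q [seq t n | n <- iota 0 (size q)] q0.
rewrite size_map size_iota ltnn => H; exfalso; apply: notF; apply: H.
  apply/allP => _ /mapP[n _ ->]; rewrite rootE; apply/contraT => qn.
  by case: nq; exists n.
rewrite map_inj_uniq ?iota_uniq // => m n /(mulfI (lt0r_neq0 e0)) /invr_inj /eqP.
by rewrite eqr_nat => /eqP[].
Qed.

End LineDensity.

Local Notation j0 := (@Ordinal 2 0 isT).
Local Notation j1 := (@Ordinal 2 1 isT).

Section RiccatiFoliation.
Variable C : numFieldType.
Local Notation V3 := ('rV[C]_3).
Local Notation V5 := ('rV[C]_3 * 'rV[C]_2)%type.
Variables (N : 'M[C]_3) (c b0 b1 b2 h0 h1 h2 a0 a1 a2 a3 : C).

Definition ry (p : V5) : C := (p.1 *m N) 0 i1.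
Definition rz (p : V5) : C := (p.1 *m N) 0 i2.
Definition rs (p : V5) : C := p.2 0 j0.
Definition rt (p : V5) : C := p.2 0 j1.

(* ric_form is the pullback of A dx + B dy + C dz by (z q_0, y q_1, z q_1), divided
   by q_1^2, with A = a0 y^3 + a1 y^2 z + a2 y z^2 + a3 z^3 and
   B = c x^2 z + x (b0 y^2 + b1 yz + b2 z^2) + z (h0 y^2 + h1 yz + h2 z^2). *)
Definition ricE (p : V5) : C := c * rz p ^+ 2 * rs p ^+ 2
  + rs p * rt p * (b0 * ry p ^+ 2 + b1 * (ry p * rz p) + b2 * rz p ^+ 2)
  + rt p ^+ 2 * (h0 * ry p ^+ 2 + h1 * (ry p * rz p) + h2 * rz p ^+ 2).

Definition ricG (p : V5) : C := rz p *
  (a0 * ry p ^+ 3 + a1 * (ry p ^+ 2 * rz p) + a2 * (ry p * rz p ^+ 2) + a3 * rz p ^+ 3).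

Definition ric_form : form1 V5 := fun p v =>
  ricE p * (rz p * ry v - ry p * rz v) + ricG p * (rt p * rs v - rs p * rt v).

Lemma row_mul_coord_linear (i : 'I_3) (k : C) (u v : V3) :
  ((k *: u + v) *m N) 0 i = k * (u *m N) 0 i + (v *m N) 0 i.
Proof. by rewrite mulmxDl -scalemxAl !mxE. Qed.

Lemma row_mul_coord_continuous (i : 'I_3) : continuous (fun x : V3 => (x *m N) 0 i : C^o).
Proof.
move=> x; rewrite /continuous_at.
have E (y : V3) : (y *m N) 0 i = y 0 i0 * N i0 i + (y 0 i1 * N i1 i + y 0 i2 * N i2 i).
  by rewrite mxE big3.
rewrite (_ : (fun y : V3 => _) = fun y : V3 => y 0 i0 * N i0 i +
   (y 0 i1 * N i1 i + y 0 i2 * N i2 i)); last by apply/funext.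
rewrite E.
have cc j : (fun y : V3 => y 0 j * N j i : C^o) y @[y --> x] --> (x 0 j * N j i : C^o).
  exact: (cvgM (@coord_continuous _ _ _ 0 j x) (cvg_cst (N j i))).
exact: (cvgD (cc i0) (cvgD (cc i1) (cc i2))).
Qed.

Lemma row_mul_linear_functional i : linear_functional (fun x : V3 => (x *m N) 0 i).
Proof. by split; [exact: row_mul_coord_linear | exact: row_mul_coord_continuous]. Qed.

Lemma ry_linear : linear_functional ry.
Proof.
split=> [k u v|p]; first exact: row_mul_coord_linear.
apply: (@continuous_comp _ _ _ fst (fun x : V3 => (x *m N) 0 i1 : C^o)).
  exact: cvg_fst.
exact: row_mul_coord_continuous.
Qed.

Lemma rz_linear : linear_functional rz.
Proof.
split=> [k u v|p]; first exact: row_mul_coord_linear.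
apply: (@continuous_comp _ _ _ fst (fun x : V3 => (x *m N) 0 i2 : C^o)).
  exact: cvg_fst.
exact: row_mul_coord_continuous.
Qed.

Lemma rs_linear : linear_functional rs.
Proof.
split=> [k u v|p]; first by rewrite /rs !mxE.
apply: (@continuous_comp _ _ _ snd (fun q : 'rV[C]_2 => q 0 j0 : C^o)).
  exact: cvg_snd.
exact: coord_continuous.
Qed.

Lemma rt_linear : linear_functional rt.
Proof.
split=> [k u v|p]; first by rewrite /rt !mxE.
apply: (@continuous_comp _ _ _ snd (fun q : 'rV[C]_2 => q 0 j1 : C^o)).
  exact: cvg_snd.
exact: coord_continuous.
Qed.

Lemma has_diff_eq (V : normedModType C) (f : V -> C) x df df' :
  has_diff f x df -> df =1 df' -> has_diff f x df'.
Proof. by move=> [d E] e; split=> // v; rewrite E e. Qed.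

Local Ltac has_diff_tac := repeat first
  [ apply: has_diffB | apply: has_diffD | apply: has_diffM | apply: has_diffX
  | apply: has_diff_cst | apply: has_diff_linear; exact: ry_linear
  | apply: has_diff_linear; exact: rz_linear | apply: has_diff_linear; exact: rs_linear
  | apply: has_diff_linear; exact: rt_linear ].

Definition dricE (p v : V5) : C :=
  ry v * (rs p * rt p * (2%:R * b0 * ry p + b1 * rz p) + rt p ^+ 2 * (2%:R * h0 * ry p + h1 * rz p))
  + rz v * (2%:R * c * rz p * rs p ^+ 2 + rs p * rt p * (b1 * ry p + 2%:R * b2 * rz p)
     + rt p ^+ 2 * (h1 * ry p + 2%:R * h2 * rz p))
  + rs v * (2%:R * c * rz p ^+ 2 * rs p
     + rt p * (b0 * ry p ^+ 2 + b1 * (ry p * rz p) + b2 * rz p ^+ 2))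
  + rt v * (rs p * (b0 * ry p ^+ 2 + b1 * (ry p * rz p) + b2 * rz p ^+ 2)
     + 2%:R * rt p * (h0 * ry p ^+ 2 + h1 * (ry p * rz p) + h2 * rz p ^+ 2)).

Definition dricG (p v : V5) : C :=
  ry v * (rz p * (3%:R * a0 * ry p ^+ 2 + 2%:R * a1 * (ry p * rz p) + a2 * rz p ^+ 2))
  + rz v * (a0 * ry p ^+ 3 + 2%:R * a1 * (ry p ^+ 2 * rz p) + 3%:R * a2 * (ry p * rz p ^+ 2)
     + 4%:R * a3 * rz p ^+ 3).

Lemma ricE_diff p : has_diff ricE p (dricE p).
Proof.
apply: has_diff_eq; first by rewrite /ricE; has_diff_tac.
by move=> v /=; rewrite /dricE; ring.
Qed.

Lemma ricG_diff p : has_diff ricG p (dricG p).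
Proof.
apply: has_diff_eq; first by rewrite /ricG; has_diff_tac.
by move=> v /=; rewrite /dricG; ring.
Qed.

Lemma ric_form_diff w p : has_diff (ric_form^~ w) p (fun v =>
  dricE p v * (rz p * ry w - ry p * rz w) + ricE p * (rz v * ry w - ry v * rz w)
  + (dricG p v * (rt p * rs w - rs p * rt w) + ricG p * (rt v * rs w - rs v * rt w))).
Proof.
apply: has_diff_eq.
  rewrite /ric_form; apply: has_diffD; apply: has_diffM; try exact: ricE_diff;
    try exact: ricG_diff; has_diff_tac.
by move=> v /=; ring.
Qed.

Lemma ric_form_holomorphic (U : set V5) : holomorphic_form1 U ric_form.
Proof.
split=> [p _ k v w|w p _]; last by case: (ric_form_diff w p).
rewrite /ric_form !(proj1 ry_linear) !(proj1 rz_linear) !(proj1 rs_linear) !(proj1 rt_linear).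
ring.
Qed.

(** Up to a factor the form comes from the surface P^1 x P^1 with coordinates (y : z) and (s : t),
    where every 1-form is integrable; in homogeneous coordinates this is a polynomial identity. *)
Lemma ric_form_integrable (U : set V5) : integrable_on U ric_form.
Proof.
move=> p _ u v w; rewrite /ext_deriv.
have D a b : 'D_a (ric_form^~ b : V5 -> C^o) p = _ := proj2 (ric_form_diff b p) a.
rewrite !D /ric_form /dricE /dricG /ricE /ricG.
move: (ry p) (rz p) (rs p) (rt p) (ry u) (rz u) (rs u) (rt u) (ry v) (rz v) (rs v) (rt v)
  (ry w) (rz w) (rs w) (rt w) => *.
ring.
Qed.

Lemma open_ne0 (V : normedModType C) : open [set x : V | x != 0].
Proof.
rewrite (_ : [set x : V | x != 0] = ~` [set 0]).
  by apply: closed_openC; apply: accessible_closed_set1; apply: hausdorff_accessible.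
by apply/seteqP; split=> x /= /eqP.
Qed.

Definition trivial_bundle : p1_bundle C.
Proof.
refine (@P1Bundle C unit (fun=> [set x : V3 | x != 0]) (fun _ _ _ => 1%:M) _ _ _ _ _ _ _ _).
- by move=> _; exact: open_ne0.
- by [].
- by move=> _ x k k0 x0; rewrite /= scaler_eq0 negb_or k0.
- by move=> x x0; exists tt.
- by move=> _ _ x _; exact: differentiable_cst.
- by move=> _ _ x _; exact: unitmx1.
- by [].
- by move=> _ _ _ x _; exists 1; rewrite ?oner_eq0 // mulmx1 scale1r.
Defined.

Lemma open_total_chart : open [set p : V5 | p.1 != 0 /\ p.2 != 0].
Proof.
rewrite (_ : [set p | _] = (fst @^-1` [set x : V3 | x != 0]) `&` (snd @^-1` [set q : 'rV[C]_2 | q != 0])) //.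
apply: openI; apply: open_comp (@open_ne0 _) => p _; [exact: cvg_fst | exact: cvg_snd].
Qed.

Lemma polyfun_linear (V : normedModType C) (f : V -> C) p v : linear_functional f ->
  polyfun (fun t => f (t *: v + p)).
Proof.
move=> [fl _]; exists (f v *: 'X + (f p)%:P) => t; rewrite fl !hornerE mulrC.
by [].
Qed.

Hypothesis N_unit : N \in unitmx.
(** A point where z A(y, z) is nonzero. As z A is the coefficient [ricG] of the vertical part, this
    single point yields all the genericity statements below. *)
Variables (y1 z1 : C).
Hypothesis G_neq0 : z1 * (a0 * y1 ^+ 3 + a1 * (y1 ^+ 2 * z1) + a2 * (y1 * z1 ^+ 2) + a3 * z1 ^+ 3) != 0.

Local Ltac polyfun_tac := repeat first [ apply: polyfunB | apply: polyfunD | apply: polyfunM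
  | apply: polyfunX | exact: polyfun_cst | apply: polyfun_linear; exact: ry_linear
  | apply: polyfun_linear; exact: rz_linear | apply: polyfun_linear; exact: rs_linear
  | apply: polyfun_linear; exact: rt_linear ].

Definition row2 (u v : C) : 'rV[C]_2 := \row_i (if i == j0 then u else v).

Lemma row2E u v : (row2 u v 0 j0 = u) * (row2 u v 0 j1 = v).
Proof. by rewrite !mxE. Qed.

Lemma ric_form_neq0 (U : set V5) : generically_nonzero U ric_form.
Proof.
move=> O oO O0 _.
pose e : V5 := (0, row2 1 0).
have [||p Op fp] := @open_neq0 _ _ (ric_form^~ e) (pt 0 y1 z1 *m invmx N, row2 0 1) O _ _ oO O0.
- by move=> p v; rewrite /ric_form /ricE /ricG; polyfun_tac.
- rewrite /ric_form /ricG /ry /rz /rs /rt /= !mulmxKV // !ptE !mul0mx !row2E !mxE.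
  by rewrite !mulr0 !mul1r subrr mulr0 add0r subr0 mulr1.
by exists p, e.
Qed.

Lemma ry_scale k k' p : ry (k *: p.1, k' *: p.2) = k * ry p.
Proof. by rewrite /ry /= -scalemxAl mxE. Qed.

Lemma rz_scale k k' p : rz (k *: p.1, k' *: p.2) = k * rz p.
Proof. by rewrite /rz /= -scalemxAl mxE. Qed.

Lemma rs_scale k k' p : rs (k *: p.1, k' *: p.2) = k' * rs p.
Proof. by rewrite /rs /= mxE. Qed.

Lemma rt_scale k k' p : rt (k *: p.1, k' *: p.2) = k' * rt p.
Proof. by rewrite /rt /= mxE. Qed.

(** Bihomogeneity of bidegree (4, 2). On the trivial bundle the chart changes are just rescalings,
    so this is the gluing condition. *)
Lemma ric_form_scale k k' p v : ric_form (k *: p.1, k' *: p.2) (k *: v.1, k' *: v.2) =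
  k ^+ 4 * k' ^+ 2 * ric_form p v.
Proof.
by rewrite /ric_form /ricE /ricG !ry_scale !rz_scale !rs_scale !rt_scale; ring.
Qed.

Definition ric_foliation : bundle_foliation trivial_bundle.
Proof.
refine (@BundleFoliation C trivial_bundle unit (fun=> tt)
  (fun=> [set p : V5 | p.1 != 0 /\ p.2 != 0]) (fun=> ric_form) _ _ _ _ _ _ _ _ _).
- by move=> _; exact: open_total_chart.
- by move=> _ p.
- by move=> [] p pt; exists tt.
- by move=> _; exact: ric_form_holomorphic.
- by move=> _; exact: ric_form_neq0.
- by move=> _; exact: ric_form_integrable.
- move=> _ p _; rewrite /ric_form /ry /rz /rs /rt /= !mxE; ring.
- move=> _ p _; rewrite /ric_form /ry /rz /rs /rt /= !mul0mx !mxE; ring.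
- move=> [] [] k k' p k0 k'0 f _ _ _ u v.
  have fE q : f q = (k *: q.1, k' *: q.2) by rewrite /f /chart_change /= mulmx1.
  have D a : 'D_a f p = (k *: a.1, k' *: a.2).
    apply: derive_affine => h; rewrite !fE /=.
    by congr pair; rewrite [RHS]/= scalerDr !scalerA (mulrC h).
  by rewrite /pullback_form1 !D fE !ric_form_scale; ring.
Defined.

Variables (w F : triple C).
Hypothesis wA : forall x : V3, eval3 (tnth w i0) x = a0 * x 0 i1 ^+ 3 + a1 * (x 0 i1 ^+ 2 * x 0 i2)
  + a2 * (x 0 i1 * x 0 i2 ^+ 2) + a3 * x 0 i2 ^+ 3.
Hypothesis wB : forall x : V3, eval3 (tnth w i1) x = c * (x 0 i0 ^+ 2 * x 0 i2)
  + x 0 i0 * (b0 * x 0 i1 ^+ 2 + b1 * (x 0 i1 * x 0 i2) + b2 * x 0 i2 ^+ 2)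
  + x 0 i2 * (h0 * x 0 i1 ^+ 2 + h1 * (x 0 i1 * x 0 i2) + h2 * x 0 i2 ^+ 2).
Hypothesis w_euler : forall x : V3, x 0 i0 * eval3 (tnth w i0) x + x 0 i1 * eval3 (tnth w i1) x
    + x 0 i2 * eval3 (tnth w i2) x = 0.
Hypothesis wF : forall x v, form1_of_triple F x v = form1_of_triple w (x *m N) (v *m N).
Hypothesis w_homog : homogeneous_triple 3 w.

(** The linear section (x : z) in the coordinates given by [N], undefined only at (0 : 1 : 0). *)
Definition sec_mx : 'M[C]_(3, 2) := \matrix_(i, j) N i (if j == j0 then i0 else i2).

Lemma sec_mxE (x : V3) : (x *m sec_mx) 0 j0 = (x *m N) 0 i0 /\ (x *m sec_mx) 0 j1 = (x *m N) 0 i2.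
Proof. by split; rewrite !mxE; apply: eq_bigr => i _; rewrite mxE. Qed.

Definition ric_section : meromorphic_section trivial_bundle.
Proof.
refine (@MeromorphicSection C trivial_bundle unit (fun=> tt) (fun=> [set x : V3 | x != 0])
  (fun _ x => x *m sec_mx) _ _ _ _ _ _).
- by move=> _; exact: open_ne0.
- by move=> _ x.
- by move=> x x0; exists tt.
- move=> _ x _.
  rewrite (_ : (fun y : V3 => y *m sec_mx) = fun y : V3 => y 0 i0 *: row i0 sec_mx
      + (y 0 i1 *: row i1 sec_mx + y 0 i2 *: row i2 sec_mx)).
    by do 2?apply: differentiableD; apply: differentiableZl; exact: differentiable_coord.
  by apply/funext => y; rewrite mulmx_sum_row big3.
- move=> _ O oO O0 _.
  have [||x Ox fx] := @open_neq0 _ _ (fun x : V3 => (x *m N) 0 i2) (pt 0 y1 z1 *m invmx N) O _ _ oO O0.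
  + by move=> p v; exact: (polyfun_linear p v (row_mul_linear_functional i2)).
  + by rewrite mulmxKV // ptE; apply: contraNneq G_neq0 => ->; rewrite mul0r.
  exists x => //; apply: contraNneq fx => sx0.
  by rewrite -(proj2 (sec_mxE x)) sx0 mxE.
- move=> _ _ k x k0 _ _; rewrite mulmx1 -scalemxAl.
  (* The first row is [k] times the second, so (1, -k) is in the left kernel. *)
  apply/eqP/det0P; exists (row_mx 1%:M (- k)%:M).
    apply/negP => /eqP/(congr1 (fun M : 'M[C]_(1, 1 + 1) => lsubmx M 0 0)).
    by rewrite row_mxKl !mxE => /eqP; rewrite oner_eq0.
  rewrite -[LHS]/(@mulmx C 1 (1 + 1) 2 _ _) (@mul_row_col _ 1 1 1 2).
  by rewrite mul1mx scalemxAl mul_scalar_mx scaleNr scalemxAl subrr.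
Defined.

(** On vertical vectors the form is [ricG] times t ds - s dt, which has no zero for (s, t) nonzero.
    Hence only the fibres over the curve z A(y, z) = 0 are excluded. *)
Lemma transversal_ric_foliation : transversal_to_generic_fibres ric_foliation.
Proof.
pose D := subst3 (var3 C i2 * tnth w i0) (lin N).
have DE x : eval3 D x = (x *m N) 0 i2 * eval3 (tnth w i0) (x *m N).
  by rewrite eval3_subst ev_lin eval3M eval3_var.
exists 4%N, D; split.
- have := @comp3_lin_homog _ 4 [tuple var3 C i2 * tnth w i0 | i < 3] N _ i0.
  rewrite !tnth_mktuple; apply => i; rewrite tnth_mktuple.
  apply: (@dhomogM _ _ _ 1 _ 3); last exact: w_homog.
  by rewrite -[var3 C i2]lform_delta; apply: lform_homog.
- apply/eqP => D0; have := DE (pt 0 y1 z1 *m invmx N).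
  rewrite D0 /eval3 meval0 -/(eval3 _ _) mulmxKV // wA !ptE => /esym/eqP.
  by rewrite (negPf G_neq0).
- move=> [] p [p1 p2]; rewrite DE wA => Dp; exists tt; split=> //.
  have vert q : ric_form p (0, q) = ricG p * (rt p * q 0 j0 - rs p * q 0 j1).
    have ry0 : ry (0, q) = 0 by rewrite /ry /= mul0mx mxE.
    have rz0 : rz (0, q) = 0 by rewrite /rz /= mul0mx mxE.
    by rewrite /ric_form ry0 rz0 -/(rs (0, q)) -/(rt (0, q)); ring.
  have [t0|t0] := eqVneq (rt p) 0; last first.
    by exists (row2 1 0); rewrite /= vert !row2E mulr1 mulr0 subr0 mulf_neq0.
  exists (row2 0 1); rewrite /= vert !row2E t0 mul0r sub0r mulr1 mulf_neq0 ?oppr_eq0 //.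
  apply: contra_neq p2 => s0; apply/rowP => -[[|[|//]] Hi].
    by rewrite mxE -[RHS]s0; congr (p.2 0 _); apply: val_inj.
  by rewrite mxE -[RHS]t0; congr (p.2 0 _); apply: val_inj.
Qed.

(** For q = (x, z) the map (z q_0, y q_1, z q_1) is z (x, y, z), which multiplies w by z^4; division
    by q_1^2 leaves z^2 w. *)
Lemma ric_section_pullback : is_section_pullback ric_foliation ric_section F.
Proof.
have pbE x v : pullback_form1 (fun x : V3 => (x, x *m sec_mx) : V5) ric_form x v =
    (x *m N) 0 i2 ^+ 2 * form1_of_triple F x v.
  rewrite /pullback_form1 (@derive_affine _ _ _ _ _ _ (v, v *m sec_mx)); last first.
    by move=> k; congr pair; rewrite mulmxDl -scalemxAl.
  rewrite wF /form1_of_triple big3 /= /ric_form /ricG /ricE /ry /rz /rs /rt /=.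
  rewrite !(proj1 (sec_mxE _)) !(proj2 (sec_mxE _)).
  set X := x *m N; set X' := v *m N.
  (* The Euler relation is inserted with the factor z dz: it trades z C for - x A - y B, as C does
     not occur in [ric_form]. *)
  transitivity (X 0 i2 ^+ 2 * (eval3 (tnth w i0) X * X' 0 i0 + eval3 (tnth w i1) X * X' 0 i1)
    + X 0 i2 * X' 0 i2 * (X 0 i0 * eval3 (tnth w i0) X + X 0 i1 * eval3 (tnth w i1) X
      + X 0 i2 * eval3 (tnth w i2) X)
    - X 0 i2 * X' 0 i2 * (X 0 i0 * eval3 (tnth w i0) X + X 0 i1 * eval3 (tnth w i1) X)).
    by rewrite w_euler wA wB; ring.
  by ring.
move=> [] [] _ /=; split; last by move=> x _ v v'; rewrite !pbE; ring.
move=> O oO O0 _.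
pose e := pt 1 0 0 *m invmx N.
have [||x Ox fx] := @open_neq0 _ _ (fun x : V3 => (x *m N) 0 i2 ^+ 2 *
  (a0 * (x *m N) 0 i1 ^+ 3 + a1 * ((x *m N) 0 i1 ^+ 2 * (x *m N) 0 i2)
  + a2 * ((x *m N) 0 i1 * (x *m N) 0 i2 ^+ 2) + a3 * (x *m N) 0 i2 ^+ 3))
  (pt 0 y1 z1 *m invmx N) O _ _ oO O0.
- have pl i (p v : V3) : polyfun (fun t : C => ((t *: v + p) *m N) 0 i).
    exact: (polyfun_linear p v (row_mul_linear_functional i)).
  by move=> p v; polyfun_tac; exact: pl.
- rewrite mulmxKV // !ptE expr2 -mulrA mulf_neq0 //.
  by apply: contraNneq G_neq0 => ->; rewrite mul0r.
exists x, e; split=> //; rewrite pbE wF /form1_of_triple big3 /= /e mulmxKV // !ptE wA.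
by rewrite mulr1 !mulr0 !addr0.
Qed.

Lemma riccati_transversely_projective : transversely_projective F.
Proof.
exists trivial_bundle, ric_foliation, ric_section; split.
- exact: transversal_ric_foliation.
- exact: ric_section_pullback.
Qed.

End RiccatiFoliation.

(** * From numerical invariance to the Riccati form *)

Section NumericalInvariance.
Variable C : numFieldType.
Implicit Types (phi psi w F : triple C) (A B M : 'M[C]_3) (x v : 'rV[C]_3) (D p : form3 C).

Lemma msize_dhomog d p : p != 0 -> homog d p -> msize p = d.+1.
Proof.
move=> p0 hp; rewrite -(dhomog_uniq p0 (dhomog_msize hp) hp) prednK //.
by rewrite lt0n msize_poly_eq0.
Qed.

(** If A = 0, then y B + z C = 0 makes (B, C) a multiple r (z, -y) with r of degree 2, and r is a
    common factor. *)
Lemma foliation_first_neq0 w : foliation 2 w -> tnth w i0 != 0.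
Proof.
move=> Fw; have [hw nw ew] := Fw; apply/eqP => w0.
move: ew; rewrite big3 /= w0 mulr0 add0r => E.
have [|[r r0]] : mdvd (var3 C i2) (var3 C i1) \/ mdvd (var3 C i2) (tnth w i1).
- apply: mdvdX_prime; exists (- tnth w i2).
  by apply/eqP; rewrite mulrN -addr_eq0 E.
- move=> [r /(congr1 (fun p => eval3 p (pt 0 1 0)))].
  by rewrite eval3M !eval3_var !ptE mul0r => /eqP; rewrite oner_eq0.
have X2 : var3 C i2 != 0 by exact: mpolyX_neq0.
have w2 : tnth w i2 = - var3 C i1 * r.
  by apply: (mulfI X2); apply/eqP; rewrite -subr_eq0 -[X in _ == X]E r0; apply/eqP; ring.
have rn0 : r != 0.
  apply: contraTneq isT => rz; have [k] := foliation_neq0 Fw.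
  by elim/ord3_ind: k; rewrite ?w0 ?r0 ?w2 ?rz ?mulr0 eqxx.
have : (msize r <= 1)%N.
  apply: nw; apply: ord3_ind.
  - by exists 0; rewrite mulr0.
  - by exists (var3 C i2); rewrite mulrC.
  - by exists (- var3 C i1); rewrite mulrC.
have := msizeM X2 rn0; rewrite -r0 (msize_dhomog _ (hw i1)) ?r0 ?mulf_neq0 //.
by rewrite /var3 msizeX mdeg1 add2n /= => -[<-].
Qed.

Lemma form1_pullback_lin M w x v :
  form1_of_triple (pullback_triple (lin M) w) x v = form1_of_triple w (x *m M) (v *m M).
Proof.
rewrite /form1_of_triple.
under eq_bigr => j _ do rewrite tnth_pullback_lin /eval3 raddf_sum /= mulr_suml.
rewrite exchange_big; apply: eq_bigr => i _ /=; rewrite [X in _ = _ * X]mxE mulr_sumr.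
apply: eq_bigr => j _; rewrite mevalZ -/(eval3 _ x) eval3_subst ev_lin; ring.
Qed.

Lemma std_quad_swap i : comp3 (lin (tperm_mx i0 i)) (std_quad C) =
  comp3 (std_quad C) (lin (tperm_mx i0 i)).
Proof.
apply: triple_ext => x; apply/rowP => j; rewrite !ev_comp3 !ev_lin -!xcolE mxE !evE.
rewrite /eval3 !tnth_mktuple !rmorph_prod (reindex_inj (perm_inj (s := tperm i0 i))) /=.
apply: eq_big => [k|k _]; first by rewrite (inj_eq perm_inj).
by rewrite !mevalXU mxE.
Qed.

Lemma invariant_transversely_projective F A B : A \in unitmx -> B \in unitmx ->
  foliation 2 F ->
  pullback_has_degree (comp3 (lin A) (comp3 (std_quad C) (lin B))) F 2 ->
  transversely_projective F.
Proof.
move=> uA uB FF [D [w' [D0 [hw' _ _]]]].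
rewrite !pullback_comp3; set w1 := pullback_triple (lin A) F => E.
have Fw1 : foliation 2 w1 by exact: foliation_lin.
have {}E : pullback_triple (lin B) (pullback_triple (std_quad C) w1) = mulr3 D w'.
  by apply: eq_from_tnth => j; rewrite E [RHS]tnth_mktuple.
(* Pulling back by the inverse of [lin B] leaves sigma^* w1 alone, and the cofactor of the new D is
   still cubic. *)
have {}E := congr1 (pullback_triple (lin (invmx B))) E.
rewrite pullback_linK // pullback_mulr in E.
have [||i dvd1] := @std_quad_pullback_gcd _ w1 (pullback_triple (lin (invmx B)) w')
  (subst3 D (lin (invmx B))) Fw1.
- exact: pullback_lin_homog.
- by move=> j; rewrite E tnth_mktuple.
(* sigma commutes with transpositions of the coordinates, so the variable whose square divides the
   pullback may be taken to be x. *)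
pose P := tperm_mx i0 i : 'M[C]_3; have uP : P \in unitmx by exact: unitmx_perm.
pose w := pullback_triple (lin P) w1.
have Fw : foliation 2 w by exact: foliation_lin.
have uM : P *m A \in unitmx by rewrite unitmx_mul uP.
have wM : w = pullback_triple (lin (P *m A)) F by rewrite -comp_lin_lin pullback_comp3.
have dvd j : mdvd (var3 C i0 ^+ 2) (tnth (pullback_triple (std_quad C) w) j).
  rewrite /w -pullback_comp3 std_quad_swap pullback_comp3 tnth_pullback_lin.
  have /choice[q qE] := dvd1.
  exists (\sum_(k < 3) P j k *: subst3 (q k) (lin P)); rewrite mulr_sumr.
  apply: eq_bigr => k _; rewrite qE -scalerAr; congr (_ *: _).
  rewrite /subst3 rmorphM rmorphXn /= comp_mpolyXU' tnth_mktuple; congr (_ ^+ 2 * _).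
  apply: eval3_ext => x; rewrite /eval3 meval_lform mevalXU.
  transitivity ((x *m P) 0 i); last by rewrite -xcolE mxE tpermR.
  by rewrite mxE; apply: eq_bigr => l _; rewrite mulrC.
have [[a300 a210 a201] [[a120 a111 a102] [b300 b210 b030]]] := riccati_coef0 Fw dvd.
have [hw _ _] := Fw.
have wA x : eval3 (tnth w i0) x = cubic_coef (tnth w i0) 0 3 0 * x 0 i1 ^+ 3
  + cubic_coef (tnth w i0) 0 2 1 * (x 0 i1 ^+ 2 * x 0 i2)
  + cubic_coef (tnth w i0) 0 1 2 * (x 0 i1 * x 0 i2 ^+ 2) + cubic_coef (tnth w i0) 0 0 3 * x 0 i2 ^+ 3.
  rewrite (cubicE x (hw i0)) a300 a210 a201 a120 a111 a102.
  by move: (cubic_coef (tnth w i0)) => a; ring.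
(* A does not depend on x, so z A would be the zero form if it vanished at every (0, y, z). *)
have [y1 [z1 G0]] : exists y1 z1, z1 * eval3 (tnth w i0) (pt 0 y1 z1) != 0.
  apply: contrapT => H; have /negP := foliation_first_neq0 Fw; apply.
  rewrite -(mulrI_eq0 _ (lregP (mpolyX_neq0 C (mnm1 i2)))); apply/eqP/eval3_ext => x.
  rewrite eval3M eval3_var /eval3 meval0 -/(eval3 _ x); apply/eqP/negPn/negP => x0.
  by apply: H; exists (x 0 i1), (x 0 i2); move: x0; rewrite !wA !ptE.
rewrite wA !ptE in G0.
apply: (@riccati_transversely_projective C (invmx (P *m A)) (cubic_coef (tnth w i1) 2 0 1)
  (cubic_coef (tnth w i1) 1 2 0) (cubic_coef (tnth w i1) 1 1 1) (cubic_coef (tnth w i1) 1 0 2)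
  (cubic_coef (tnth w i1) 0 2 1) (cubic_coef (tnth w i1) 0 1 2) (cubic_coef (tnth w i1) 0 0 3) _ _ _ _ _ _ _ G0 w).
- by rewrite unitmx_inv.
- exact: wA.
- move=> x; rewrite (cubicE x (hw i1)) b300 b210 b030.
  by move: (cubic_coef (tnth w i1)) => b; ring.
- by move=> x; exact: (foliation_eval x Fw).
- by move=> x v; rewrite -{1}(pullback_linK F uM) -wM form1_pullback_lin.
- exact: hw.
Qed.

End NumericalInvariance.

(** * Normal form of quadratic birational maps *)

Lemma det3 (R : comNzRingType) (M : 'M[R]_3) : \det M = M i0 i0 * (M i1 i1 * M i2 i2 - M i1 i2 * M i2 i1)
  - M i0 i1 * (M i1 i0 * M i2 i2 - M i1 i2 * M i2 i0)
  + M i0 i2 * (M i1 i0 * M i2 i1 - M i1 i1 * M i2 i0).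
Proof.
(* Entries are indexed by natural numbers so that ordinals differing only in their bound proofs
   become the same atom for [ring]. *)
pose m (i j : nat) := M (inord i) (inord j).
have mE i j : M i j = m i j by rewrite /m !inord_val.
rewrite (expand_det_row _ i0) big3 /cofactor /=.
rewrite !(expand_det_row _ ord0) !big_ord_recl !big_ord0 /cofactor /=.
rewrite !det_mx11 !mxE !mE /= /bump /= !expr1 !expr0 ?exprS ?expr0.
by ring.
Qed.

(** * Linear independence and bases in dimension 3 *)

Section Cross.
Variable C : numFieldType.
Implicit Types (x y v : 'rV[C]_3) (M : 'M[C]_3).

Definition cross x y := pt (x 0 i1 * y 0 i2 - x 0 i2 * y 0 i1)
  (x 0 i2 * y 0 i0 - x 0 i0 * y 0 i2) (x 0 i0 * y 0 i1 - x 0 i1 * y 0 i0).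

Lemma cross_eq0P x y : cross x y = 0 <->
  exists s t, (s, t) != (0, 0) /\ s *: x + t *: y = 0.
Proof.
split=> [c0|[s [t [st E]]]].
  have c k : cross x y 0 k = 0 by rewrite c0 mxE.
  have e12 : x 0 i1 * y 0 i2 = x 0 i2 * y 0 i1.
    by apply/eqP; rewrite -subr_eq0; apply/eqP; have := c i0; rewrite ptE.
  have e20 : x 0 i2 * y 0 i0 = x 0 i0 * y 0 i2.
    by apply/eqP; rewrite -subr_eq0; apply/eqP; have := c i1; rewrite ptE.
  have e01 : x 0 i0 * y 0 i1 = x 0 i1 * y 0 i0.
    by apply/eqP; rewrite -subr_eq0; apply/eqP; have := c i2; rewrite ptE.
  have e i j : x 0 i * y 0 j = x 0 j * y 0 i.
    by elim/ord3_ind: i; elim/ord3_ind: j; rewrite ?e12 ?e20 ?e01.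
  have [[k yk]|y0] := pselect (exists k, y 0 k != 0).
    exists (y 0 k), (- x 0 k); split; first by rewrite xpair_eqE negb_and yk.
    apply/rowP => j; rewrite !mxE.
    by rewrite mulNr mulrC (e j k) subrr.
  exists 0, 1; split; first by rewrite xpair_eqE oner_eq0 andbF.
  rewrite scale0r add0r scale1r; apply/rowP => k; rewrite mxE.
  by apply/eqP/negPn/negP => yk; apply: y0; exists k.
have e k : s * x 0 k + t * y 0 k = 0.
  by have := congr1 (fun v : 'rV_3 => v 0 k) E; rewrite !mxE.
have m (a b : C) i j : (s != 0) || (t != 0) -> x 0 i * y 0 j - x 0 j * y 0 i = 0.
  case/orP => [s0|t0].
    apply: (mulfI s0); rewrite mulr0.
    transitivity ((s * x 0 i + t * y 0 i) * y 0 j - (s * x 0 j + t * y 0 j) * y 0 i).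
      by ring.
    by rewrite !e !mul0r subr0.
  apply: (mulfI t0); rewrite mulr0.
  transitivity ((s * x 0 j + t * y 0 j) * x 0 i - (s * x 0 i + t * y 0 i) * x 0 j).
    by ring.
  by rewrite !e !mul0r subr0.
rewrite xpair_eqE negb_and in st.
by apply/rowP; apply: ord3_ind; rewrite ptE m ?mxE.
Qed.

Lemma cross_mulmx x y M : M \in unitmx -> (cross (x *m M) (y *m M) == 0) = (cross x y == 0).
Proof.
move=> uM; apply/eqP/eqP => /cross_eq0P[s [t [st E]]]; apply/cross_eq0P; exists s, t.
  split=> //; apply: (can_inj (mulmxK uM)).
  by rewrite mul0mx mulmxDl -!scalemxAl.
by split=> //; rewrite !scalemxAl -mulmxDl E mul0mx.
Qed.

Definition rows3 x y v : 'M[C]_3 := \matrix_i nth 0 [:: x; y; v] i.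

Lemma mulmx_rows3 a b c x y v : pt a b c *m rows3 x y v = a *: x + b *: y + c *: v.
Proof.
by rewrite mulmx_sum_row big3 /= !ptE !rowK addrA.
Qed.

Lemma det_rows3 x y v : \det (rows3 x y v) =
  cross x y 0 i0 * v 0 i0 + cross x y 0 i1 * v 0 i1 + cross x y 0 i2 * v 0 i2.
Proof. by rewrite det3 !mxE /=; ring. Qed.

Lemma complete2 x y : cross x y != 0 -> exists v, rows3 x y v \in unitmx.
Proof.
move=> c0; have [k ck] : exists k, cross x y 0 k != 0.
  apply/not_existsP => H; case/eqP: c0; apply/rowP => k; rewrite [RHS]mxE.
  apply/eqP/negPn/negP; exact: H.
exists (delta_mx 0 k); rewrite unitmxE unitfE det_rows3.
have dE j : (delta_mx 0 k : 'rV[C]_3) 0 j = (j == k)%:R by rewrite mxE eqxx.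
rewrite !dE; elim/ord3_ind: k ck {dE} => /= ck.
all: by rewrite ?mulr1 ?mulr0 ?addr0 ?add0r.
Qed.

Lemma complete1 x : x != 0 -> exists y v, rows3 x y v \in unitmx.
Proof.
move=> x0; suff [y /complete2[v u]] : exists y, cross x y != 0 by exists y, v.
apply/not_existsP => H; case/eqP: x0.
have c y : cross x y = 0 by apply/eqP; apply: contrapT => /negP; exact: H.
have := (congr1 (fun v : 'rV_3 => v 0 i0) (c (pt 0 0 1)),
  congr1 (fun v : 'rV_3 => v 0 i1) (c (pt 1 0 0)), congr1 (fun v : 'rV_3 => v 0 i2) (c (pt 0 1 0))).
rewrite !ptE !mxE !mulr0 !mulr1 !subr0 => -[[e1 e2] e0].
by apply/rowP; apply: ord3_ind; rewrite mxE.
Qed.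

End Cross.

(** * Polar forms and contracted lines *)

Section QuadraticNets.
Variable C : numClosedFieldType.
Local Notation V := 'rV[C]_3.
Implicit Types (x y v : V) (P Q : 'M[C]_3) (b : V -> V -> V).

(* The properties of the polar form b of a quadratic map x |-> b x x that follow
   from its being birational. *)
Definition cremona_polar b := [/\ forall x y, b x y = b y x,
  forall k x y z, b (k *: x + y) z = k *: b x z + b y z,
  forall x v, cross x v != 0 -> b x v = 0 -> cross (b x x) (b v v) = 0,
  forall x v, cross x v != 0 -> b x x = 0 -> b x v = 0 -> b v v = 0 -> False
  & forall L : 'cV[C]_3, (forall x, b x x *m L = 0) -> L = 0].

Lemma cremona_polar_change b P Q : P \in unitmx -> Q \in unitmx ->
  cremona_polar b -> cremona_polar (fun x v => b (x *m P) (v *m P) *m Q).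
Proof.
move=> uP uQ [sym lin S N I]; split.
- by move=> x y; rewrite sym.
- by move=> k x y z; rewrite mulmxDl -scalemxAl lin mulmxDl -scalemxAl.
- move=> x v xv b0; apply/eqP; rewrite cross_mulmx //; apply/eqP; apply: S.
    by rewrite cross_mulmx.
  by apply: (can_inj (mulmxK uQ)); rewrite b0 mul0mx.
- move=> x v xv b1 b2 b3; apply: (N (x *m P) (v *m P)); first by rewrite cross_mulmx.
  + by apply: (can_inj (mulmxK uQ)); rewrite b1 mul0mx.
  + by apply: (can_inj (mulmxK uQ)); rewrite b2 mul0mx.
  + by apply: (can_inj (mulmxK uQ)); rewrite b3 mul0mx.
- move=> L bL; apply: (can_inj (mulKmx uQ)); rewrite mulmx0; apply: I => x.
  by rewrite mulmxA -[x](mulmxKV uP) bL.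
Qed.

Section Polar.
Variable b : V -> V -> V.
Hypothesis b_sym : forall x y, b x y = b y x.
Hypothesis b_lin : forall k x y z, b (k *: x + y) z = k *: b x z + b y z.

Lemma polar0 y : b 0 y = 0.
Proof.
by have := b_lin 1 0 0 y; rewrite !scale1r addr0 => /eqP; rewrite -subr_eq0 opprD addNKr oppr_eq0 => /eqP.
Qed.

Lemma polarZ k x y : b (k *: x) y = k *: b x y.
Proof. by rewrite -[k *: x]addr0 b_lin polar0 addr0. Qed.

Lemma polarD x y z : b (x + y) z = b x z + b y z.
Proof. by have := b_lin 1 x y z; rewrite !scale1r. Qed.

Lemma polarZr k x y : b x (k *: y) = k *: b x y.
Proof. by rewrite b_sym polarZ b_sym. Qed.

Lemma polarDr x y z : b x (y + z) = b x y + b x z.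
Proof. by rewrite b_sym polarD ![b x _]b_sym. Qed.

Definition polar_mx x : 'M[C]_3 := rows3 (b x (pt 1 0 0)) (b x (pt 0 1 0)) (b x (pt 0 0 1)).

Lemma pt_sum (x : V) : x = x 0 i0 *: pt 1 0 0 + x 0 i1 *: pt 0 1 0 + x 0 i2 *: pt 0 0 1.
Proof.
by apply/rowP; apply: ord3_ind; rewrite !mxE /= ?mulr0 ?mulr1 ?addr0 ?add0r.
Qed.

Lemma polar_mxE x v : b x v = v *m polar_mx x.
Proof.
rewrite [in RHS](pt_eta v) mulmx_rows3 [in LHS](pt_sum v).
by rewrite !polarDr !polarZr.
Qed.

Lemma polar_mx_lin s t x y : polar_mx (s *: x + t *: y) = s *: polar_mx x + t *: polar_mx y.
Proof.
apply/matrixP => i j; rewrite !mxE.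
by elim/ord3_ind: i; rewrite /= polarD !polarZ !mxE.
Qed.

End Polar.

(** If [M2] is invertible, an eigenvalue a of [M1 *m invmx M2] gives the pair (1, -a). *)
Lemma pencil_singular (M1 M2 : 'M[C]_3) :
  exists s t, (s, t) != (0, 0) /\ \det (s *: M1 + t *: M2) = 0.
Proof.
have [d2|d2] := eqVneq (\det M2) 0.
  by exists 0, 1; rewrite xpair_eqE oner_eq0 andbF scale0r add0r scale1r.
have u2 : M2 \in unitmx by rewrite unitmxE unitfE.
have [a ra] : exists a, root (char_poly (M1 *m invmx M2)) a.
  by apply: closed_rootP; rewrite size_char_poly.
exists 1, (- a); split; first by rewrite xpair_eqE oner_eq0.
have /eigenvalueP[v vE v0] : eigenvalue (M1 *m invmx M2) a by rewrite eigenvalue_root_char.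
apply/eqP/det0P; exists v => //.
rewrite scale1r mulmxDr -scalemxAr scaleNr; apply/eqP; rewrite subr_eq0; apply/eqP.
by rewrite scalemxAl -vE mulmxA mulmxKV.
Qed.

(** The cubic det b(x, .) = 0 meets every line. *)
Lemma polar_kernel b p q : cremona_polar b -> exists s t v,
  [/\ (s, t) != (0, 0), v != 0 & b (s *: p + t *: q) v = 0].
Proof.
move=> [sym lin _ _ _].
have [s [t [st d0]]] := pencil_singular (polar_mx b p) (polar_mx b q).
move/eqP/det0P: d0 => [v v0 E]; exists s, t, v; split=> //.
by rewrite (polar_mxE sym lin) polar_mx_lin.
Qed.

(** As b(x, v) = 0, the values on the line xv are combinations of b(x, x) and b(v, v), which are
    proportional. Independence of x and v comes from pairing a relation s x + t v = 0 with x, which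
    gives s b(x, x) = 0. *)
Lemma steiner_line b x v : cremona_polar b -> b x x != 0 -> v != 0 -> b x v = 0 ->
  exists y c, [/\ cross x y != 0, c != 0 & exists s1 s2 s3,
    [/\ b x x = s1 *: c, b x y = s2 *: c & b y y = s3 *: c]].
Proof.
move=> bP bx v0 bxv; have [sym lin S _ _] := bP.
have xv : cross x v != 0.
  apply: contra_neq bx => /cross_eq0P[s [t [st E]]].
  have : b x (s *: x + t *: v) = 0 by rewrite E sym polar0.
  rewrite (polarDr sym lin) !(polarZr sym lin) bxv scaler0 addr0 => /eqP.
  rewrite scaler_eq0 => /orP[/eqP s0|/eqP//].
  case/negP: st; rewrite s0 xpair_eqE eqxx /=; move/eqP: E.
  by rewrite s0 scale0r add0r scaler_eq0 (negPf v0) orbF.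
exists v, (b x x); split=> //; exists 1, 0.
have /cross_eq0P[s [t [st E]]] := S _ _ xv bxv.
have t0 : t != 0.
  apply: contraNneq st => t0; rewrite t0 xpair_eqE eqxx andbT.
  by move/eqP: E; rewrite t0 scale0r addr0 scaler_eq0 (negPf bx) orbF.
exists (- s / t); split; rewrite ?scale1r ?scale0r //.
apply: (scalerI t0); rewrite scalerA mulrC divfK // scaleNr.
by apply/eqP; rewrite -addr_eq0 addrC E.
Qed.

Lemma contracted_line b : cremona_polar b -> exists x y c,
  [/\ cross x y != 0, c != 0 & exists s1 s2 s3,
    [/\ b x x = s1 *: c, b x y = s2 *: c & b y y = s3 *: c]].
Proof.
move=> bP; have [sym lin S N _] := bP.
have [s1 [t1 [v1 [st1 v10 E1]]]] := polar_kernel (pt 0 1 0) (pt 0 0 1) bP.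
set x1 := _ + _ in E1.
have x1E : (x1 0 i0 = 0) * (x1 0 i1 = s1) * (x1 0 i2 = t1).
  by rewrite !mxE /= !mulr0 !mulr1 !addr0 !add0r.
have [x2 [v2 [v20 E2 x12]]] : exists x2 v2, [/\ v2 != 0, b x2 v2 = 0 & cross x1 x2 != 0].
  have [t10|t10] := eqVneq t1 0.
    have s10 : s1 != 0 by apply: contraNneq st1 => ->; rewrite t10 eqxx.
    have [s2 [t2 [v2 [st2 v20 E2]]]] := polar_kernel (pt 1 0 0) (pt 0 0 1) bP.
    exists (s2 *: pt 1 0 0 + t2 *: pt 0 0 1), v2; split=> //.
    apply: contraNneq st2 => c0; rewrite xpair_eqE.
    have := (congr1 (fun v : 'rV_3 => v 0 i0) c0, congr1 (fun v : 'rV_3 => v 0 i2) c0).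
    rewrite !ptE !x1E t10 !mxE /= !mulr0 !mulr1 !addr0 ?add0r ?mul0r ?subr0 ?sub0r.
    by move=> [/eqP + /eqP]; rewrite oppr_eq0 !mulf_eq0 (negPf s10) /= => -> ->.
  have [s2 [t2 [v2 [st2 v20 E2]]]] := polar_kernel (pt 1 0 0) (pt 0 1 0) bP.
  exists (s2 *: pt 1 0 0 + t2 *: pt 0 1 0), v2; split=> //.
  apply: contraNneq st2 => c0; rewrite xpair_eqE.
  have := (congr1 (fun v : 'rV_3 => v 0 i0) c0, congr1 (fun v : 'rV_3 => v 0 i1) c0).
  rewrite !ptE !x1E !mxE /= !mulr0 !mulr1 !addr0 ?add0r ?mul0r ?subr0 ?sub0r.
  rewrite mulr0 sub0r => -[/eqP + /eqP].
  by rewrite oppr_eq0 !mulf_eq0 (negPf t10) /= => -> ->.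
have [b1|b1] := eqVneq (b x1 x1) 0; last first.
  by have [y [c H]] := steiner_line bP b1 v10 E1; exists x1, y, c.
have [b2|b2] := eqVneq (b x2 x2) 0; last first.
  by have [y [c H]] := steiner_line bP b2 v20 E2; exists x2, y, c.
exists x1, x2, (b x1 x2); split=> //.
  by apply/eqP => b12; exact: (N x1 x2).
by exists 0, 1, 0; rewrite b1 b2 scale0r scale1r.
Qed.

End QuadraticNets.

Section NormalForm.
Variable C : numClosedFieldType.
Local Notation V := 'rV[C]_3.
Implicit Types (x y v : V) (P Q : 'M[C]_3) (b : V -> V -> V).
Local Notation e0 := (pt 1 0 0 : 'rV[C]_3).
Local Notation e1 := (pt 0 1 0 : 'rV[C]_3).
Local Notation e2 := (pt 0 0 1 : 'rV[C]_3).

Lemma polarization b x y : cremona_polar b ->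
  2%:R *: b x y = b (x + y) (x + y) - b x x - b y y.
Proof.
move=> [sym lin _ _ _]; rewrite !(polarD lin) !(polarDr sym lin) [b y x]sym.
by apply/rowP => k; rewrite !mxE; ring.
Qed.

Section LinePencil.
Variables (b : V -> V -> V) (m0 m1 m2 : C).
Hypothesis bP : cremona_polar b.
Let m x := m0 * x 0 i0 + m1 * x 0 i1 + m2 * x 0 i2.
Hypothesis b1 : forall x, b x x 0 i1 = m x * x 0 i1.
Hypothesis b2 : forall x, b x x 0 i2 = m x * x 0 i2.
Hypothesis m_neq0 : [|| m0 != 0, m1 != 0 | m2 != 0].

Let n2 : 2%:R != 0 :> C. Proof. by rewrite pnatr_eq0. Qed.

Lemma pencil_polar1 x v : b x v 0 i1 = (m x * v 0 i1 + m v * x 0 i1) / 2%:R.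
Proof.
have := congr1 (fun u : V => u 0 i1) (polarization x v bP).
rewrite !mxE !b1 !mxE => E; apply: (mulfI n2); rewrite E [RHS]mulrC divfK //.
by rewrite /m !mxE; ring.
Qed.

Lemma pencil_polar2 x v : b x v 0 i2 = (m x * v 0 i2 + m v * x 0 i2) / 2%:R.
Proof.
have := congr1 (fun u : V => u 0 i2) (polarization x v bP).
rewrite !mxE !b2 !mxE => E; apply: (mulfI n2); rewrite E [RHS]mulrC divfK //.
by rewrite /m !mxE; ring.
Qed.

Lemma pt_shift (X w1 w2 : C) : pt X w1 w2 = X *: e0 + pt 0 w1 w2.
Proof.
by apply/rowP; apply: ord3_ind; rewrite !mxE /= ?mulr0 ?mulr1 ?addr0 ?add0r.
Qed.

Lemma polar_shift X Y w1 w2 (w := pt 0 w1 w2) :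
  b (pt X w1 w2) (pt Y w1 w2) 0 i0 =
  X * Y * b e0 e0 0 i0 + (X + Y) * b e0 w 0 i0 + b w w 0 i0.
Proof.
have [sym lin _ _ _] := bP.
rewrite (pt_shift X) (pt_shift Y) !(polarD lin) !(polarDr sym lin).
rewrite !(polarZ lin) !(polarZr sym lin) -/w [b w e0]sym !mxE; ring.
Qed.

(** On a line through [pt 1 0 0] with coordinate X the map is (E X^2 + 2 n X + k : m), with m of
    degree at most 1 in X and E the entry in question. If E is nonzero, this has degree 2, which is
    incompatible with birationality: a pair of points with b(x, y) = 0 must have proportional
    images. If m is constant on these lines, m turns out to be zero; otherwise every point of the
    line m = 0 is a base point. *)
Lemma line_pencil_base_point : b e0 e0 0 i0 = 0.
Proof.
apply/eqP/negPn/negP => e; have [sym lin S N _] := bP.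
have e0' := e; set E := b e0 e0 0 i0 in e.
have [m00|m00] := eqVneq m0 0.
  have beta w1 w2 : (w1, w2) != (0, 0) -> m1 * w1 + m2 * w2 = 0.
    move=> ww; pose n := b e0 (pt 0 w1 w2) 0 i0.
    (* The vertex of the parabola E X^2 + 2 n X + k, which is the point of the line conjugate to
       [pt 1 0 0]. *)
    pose v := pt (- n / E) w1 w2.
    have c : cross (b e0 e0) (b v v) = 0.
      apply: (S).
    - apply: contraNneq ww => c; rewrite xpair_eqE.
      have := (congr1 (fun v : V => v 0 i1) c, congr1 (fun v : V => v 0 i2) c).
      rewrite !ptE !mul1r !mul0r subr0 sub0r !mxE => -[/eqP + ->].
      by rewrite oppr_eq0 eqxx.
    - apply/rowP; apply: ord3_ind.
      + rewrite /v (pt_shift (- n / E)) (polarDr sym lin) (polarZr sym lin) !mxE -/E -/n.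
        by rewrite divfK // addNr.
      + by rewrite pencil_polar1 /m /v !ptE m00 mxE; field.
      + by rewrite pencil_polar2 /m /v !ptE m00 mxE; field.
    have := (congr1 (fun v : V => v 0 i1) c, congr1 (fun v : V => v 0 i2) c).
    rewrite !ptE -/E !b1 !b2 /m !ptE m00 !mul0r !add0r !mulr0 !mul0r !subr0 !sub0r !mxE.
    move=> [/eqP + /eqP]; rewrite oppr_eq0 !mulf_eq0 (negPf e) /=.
    by move: ww; rewrite xpair_eqE negb_and => /orP[|] /negPf -> /=; rewrite orbF => ? ?; apply/eqP.
  have := (beta 1 0, beta 0 1); rewrite !xpair_eqE oner_eq0 !andbF !mulr0 !mulr1 addr0 add0r.
  by move=> [/(_ isT) m10 /(_ isT) m20]; move: m_neq0; rewrite m00 m10 m20 eqxx.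
pose z w1 w2 := pt (- (m1 * w1 + m2 * w2) / m0) w1 w2.
have mz w1 w2 : m (z w1 w2) = 0.
  by rewrite /m !ptE; field.
have bz w1 w2 : (w1, w2) != (0, 0) -> b (z w1 w2) (z w1 w2) = 0.
  move=> ww; apply/rowP; apply: ord3_ind; rewrite [RHS]mxE; last 2 first.
  - by rewrite b1 mz mul0r.
  - by rewrite b2 mz mul0r.
  pose w := pt 0 w1 w2; pose n := b e0 w 0 i0; pose k := b w w 0 i0.
  pose mu := - (m1 * w1 + m2 * w2) / m0.
  have zE : z w1 w2 = pt mu w1 w2 by [].
  rewrite zE polar_shift -/E -/w -/n -/k.
  (* m takes opposite values at mu + d and mu - d, so the last two components of b vanish on this
     pair; d is chosen to make the first vanish too. By [dE], d = 0 means that z is a base point. *)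
  pose d := sqrtC (mu ^+ 2 + (k + 2%:R * n * mu) / E).
  have dE : E * d ^+ 2 = E * mu ^+ 2 + k + 2%:R * n * mu.
    by rewrite sqrtCK; field.
  have [d0|d0] := eqVneq d 0.
    by move: dE; rewrite d0 expr0n mulr0 => ->; ring.
  have mE X : m (pt X w1 w2) = m0 * (X - mu).
    by rewrite /m !ptE /mu; field.
  pose x := pt (mu + d) w1 w2; pose y := pt (mu - d) w1 w2.
  have c : cross (b x x) (b y y) = 0.
    apply: (S).
  - apply: contraNneq ww => c; rewrite xpair_eqE.
    have := (congr1 (fun v : V => v 0 i1) c, congr1 (fun v : V => v 0 i2) c).
    rewrite !ptE !mxE => -[c1 c2].
    have d2 : 2%:R * d != 0 by rewrite mulf_neq0.
    apply/andP; split; apply/eqP; apply: (mulfI d2); rewrite mulr0.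
      by rewrite -c2; ring.
    by rewrite -[RHS]oppr0 -c1; ring.
  - apply/rowP; apply: ord3_ind; rewrite [RHS]mxE.
    + rewrite polar_shift -/E -/w -/n -/k.
      transitivity (E * mu ^+ 2 + k + 2%:R * n * mu - E * d ^+ 2); first by ring.
      by rewrite dE subrr.
    + by rewrite pencil_polar1 !mE !ptE; field.
    + by rewrite pencil_polar2 !mE !ptE; field.
  have := (congr1 (fun v : V => v 0 i1) c, congr1 (fun v : V => v 0 i2) c).
  have bx0 : b x x 0 i0 = (mu + d) * (mu + d) * E + (mu + d + (mu + d)) * n + k.
    exact: polar_shift.
  have by0 : b y y 0 i0 = (mu - d) * (mu - d) * E + (mu - d + (mu - d)) * n + k.
    exact: polar_shift.
  rewrite !ptE !b1 !b2 !mE !ptE bx0 by0 ![(0 : V) 0 _]mxE => -[c1 c2].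
  have [] : w1 = 0 /\ w2 = 0.
    have d4 : 4%:R * m0 * E * d ^+ 3 != 0.
      by rewrite !mulf_neq0 ?expf_neq0 // pnatr_eq0.
    (* The sum of the first components at x and y. As m is opposite at the two points, the cross
       product of the images is, up to sign, this sum times m0 d (w1, w2) in its last two
       entries. *)
    have aux : 2%:R * (E * (mu ^+ 2 + d ^+ 2) + 2%:R * n * mu + k) = 4%:R * E * d ^+ 2.
      transitivity (2%:R * (E * d ^+ 2 + (E * mu ^+ 2 + k + 2%:R * n * mu))); first by ring.
      by rewrite -dE; ring.
    split; apply: (mulfI d4); rewrite mulr0.
      transitivity (m0 * d * w1 * (4%:R * E * d ^+ 2)); first by ring.
      by rewrite -aux -[RHS]oppr0 -c2; ring.
    transitivity (m0 * d * w2 * (4%:R * E * d ^+ 2)); first by ring.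
    by rewrite -aux -c1; ring.
  by move=> w10 w20; case/negP: ww; rewrite w10 w20.
(* All points of the line m = 0 are base points, so by polarization b vanishes on the whole line. *)
apply: (N (z 1 0) (z 0 1)).
- apply/eqP => /(congr1 (fun v : V => v 0 i0)); rewrite !ptE mulr1 mulr0 subr0 mxE.
  by move/eqP; rewrite oner_eq0.
- by apply: bz; rewrite xpair_eqE oner_eq0.
- apply: (scalerI n2); rewrite scaler0 (polarization _ _ bP).
  rewrite !bz ?xpair_eqE ?oner_eq0 ?andbF // !subr0.
  have -> : z 1 0 + z 0 1 = z 1 1.
    apply/rowP; apply: ord3_ind; rewrite !mxE /= ?addr0 ?add0r //.
    by rewrite -mulrDl; congr (_ / _); ring.
  by rewrite bz // xpair_eqE oner_eq0.
- by apply: bz; rewrite xpair_eqE oner_eq0 andbF.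
Qed.

End LinePencil.

Definition jonq (al be1 be2 n1 n2 k1 k2 k3 : C) y : V :=
  let m := al * y 0 i0 + be1 * y 0 i1 + be2 * y 0 i2 in
  pt (y 0 i0 * (n1 * y 0 i1 + n2 * y 0 i2)
      + (k1 * y 0 i1 ^+ 2 + k2 * (y 0 i1 * y 0 i2) + k3 * y 0 i2 ^+ 2))
     (m * y 0 i1) (m * y 0 i2).

(** Move the contracted line to z = 0 and its image to (1 : 0 : 0). The last two components then
    vanish on z = 0, so they are z l_1 and z l_2 with l_1, l_2 independent linear forms. With l_1
    and l_2 as the new last two coordinates, the old z becomes the linear form m. *)
Lemma line_pencil_coordinates b : cremona_polar b ->
  exists P Q (m : 'I_3 -> C), [/\ P \in unitmx, Q \in unitmx, exists i, m i != 0 &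
    forall y, let mx := m i0 * y 0 i0 + m i1 * y 0 i1 + m i2 * y 0 i2 in
    let z := b (y *m P) (y *m P) *m Q in z 0 i1 = mx * y 0 i1 /\ z 0 i2 = mx * y 0 i2].
Proof.
move=> bP; have [x [y [c [xy c0 [s1 [s2 [s3 [bxx bxy byy]]]]]]]] := contracted_line bP.
have [v uP] := complete2 xy; set P := rows3 x y v in uP.
have [u [u' uR]] := complete1 c0; set R := rows3 c u u' in uR.
have uQ : invmx R \in unitmx by rewrite unitmx_inv.
have bP' := cremona_polar_change uP uQ bP; set b' := (fun x v => _) in bP'.
have [sym lin _ _ I] := bP'.
have e0P : e0 *m P = x by rewrite mulmx_rows3 !scale0r scale1r !addr0.
have e1P : e1 *m P = y by rewrite mulmx_rows3 !scale0r scale1r addr0 add0r.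
have cR : c *m invmx R = e0.
  by apply: (can_inj (mulmxK uR)); rewrite mulmxKV // mulmx_rows3 !scale0r scale1r !addr0.
have b00 : b' e0 e0 = s1 *: e0 by rewrite /b' e0P bxx -scalemxAl cR.
have b01 : b' e0 e1 = s2 *: e0 by rewrite /b' e0P e1P bxy -scalemxAl cR.
have b11 : b' e1 e1 = s3 *: e0 by rewrite /b' e1P byy -scalemxAl cR.
have mxD (u1 u2 : V) k : (u1 + u2) 0 k = u1 0 k + u2 0 k by rewrite mxE.
have mxZ a (u1 : V) k : (a *: u1) 0 k = a * u1 0 k by rewrite mxE.
pose l k := pt (2%:R * b' e0 e2 0 k) (2%:R * b' e1 e2 0 k) (b' e2 e2 0 k).
have lE z k : k != i0 -> b' z z 0 k = z 0 i2 * (z 0 i0 * l k 0 i0 + z 0 i1 * l k 0 i1 + z 0 i2 * l k 0 i2).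
  move=> k0; have e0k : e0 0 k = 0 by elim/ord3_ind: k k0; rewrite ?ptE ?eqxx.
  rewrite [in LHS](pt_sum z) !(polarD lin) !(polarDr sym lin) !(polarZ lin) !(polarZr sym lin).
  rewrite b00 [b' e1 e0]sym b01 b11 [b' e2 e0]sym [b' e2 e1]sym !ptE.
  by rewrite !mxD !mxZ e0k; ring.
have lind : cross (l i1) (l i2) != 0.
  apply/eqP => /cross_eq0P[s [t [st E]]].
  have E' j : s * l i1 0 j + t * l i2 0 j = 0 by rewrite -!mxZ -mxD E mxE.
  have L0 : (pt 0 s t)^T = 0.
    apply: I => z; apply/matrixP => i j; rewrite !ord1 [RHS]mxE mxE big3 /= ![(pt _ _ _)^T _ _]mxE !ptE.
    rewrite mulr0 add0r !lE //.
    transitivity (z 0 i2 * (z 0 i0 * (s * l i1 0 i0 + t * l i2 0 i0)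
      + z 0 i1 * (s * l i1 0 i1 + t * l i2 0 i1) + z 0 i2 * (s * l i1 0 i2 + t * l i2 0 i2))).
      by ring.
    by rewrite !E' !mulr0 !addr0 mulr0.
  have := (congr1 (fun L : 'cV[C]_3 => L i1 0) L0, congr1 (fun L : 'cV[C]_3 => L i2 0) L0).
  by rewrite ![(pt _ _ _)^T _ _]mxE !ptE !mxE => -[s0 t0]; rewrite s0 t0 eqxx in st.
have [r ur] := complete2 lind.
(* The columns of [W^T] are r, l_1 and l_2, so [z *m W^T] has l_1(z) and l_2(z) as its last
   coordinates. *)
pose W := rows3 r (l i1) (l i2); have uW : W^T \in unitmx.
  move: ur; rewrite unitmx_tr !unitmxE !det_rows3 /cross !ptE; congr (_ \is a GRing.unit).
  by ring.
have uV : invmx W^T \in unitmx by rewrite unitmx_inv.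
exists (invmx W^T *m P), (invmx R), (fun i => invmx W^T i i2); split=> //.
- by rewrite unitmx_mul uV.
- apply/not_existsP => m0; have := congr1 (fun M : 'M[C]_3 => M i2 i2) (mulmxV uW).
  rewrite /= mxE big1 ?mxE => [|i _]; first by move/esym/eqP; rewrite oner_eq0.
  by have /negP/negPn/eqP -> := m0 i; rewrite mulr0.
move=> q /=; rewrite !mulmxA -/(b' _ _); set z := q *m invmx W^T.
have zm : z 0 i2 = invmx W^T i0 i2 * q 0 i0 + invmx W^T i1 i2 * q 0 i1 + invmx W^T i2 i2 * q 0 i2.
  by rewrite mxE big3 /=; ring.
have zl i : q 0 i = z 0 i0 * W i i0 + z 0 i1 * W i i1 + z 0 i2 * W i i2.
  by rewrite -[in LHS](mulmxKV uW q) mxE big3 /= !mxE; ring.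
have rE k j : rows3 r (l i1) (l i2) k j = nth 0 [:: r; l i1; l i2] k 0 j by rewrite mxE.
rewrite !lE // -zm.
by split; rewrite (zl _) /W !rE.
Qed.

Lemma cremona_normal_form b : cremona_polar b ->
  exists P Q al be1 be2 n1 n2 k1 k2 k3, [/\ P \in unitmx, Q \in unitmx &
    forall x, b x x = jonq al be1 be2 n1 n2 k1 k2 k3 (x *m P) *m Q].
Proof.
move=> bP; have [P [Q [m [uP uQ [i mi] H]]]] := line_pencil_coordinates bP.
have bP' := cremona_polar_change uP uQ bP; set b' := (fun x v => _) in bP'.
have [sym lin _ _ _] := bP'.
have m0 : [|| m i0 != 0, m i1 != 0 | m i2 != 0].
  by elim/ord3_ind: i mi => ->; rewrite ?orbT.
have E := line_pencil_base_point bP' (fun x => proj1 (H x)) (fun x => proj2 (H x)) m0.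
exists (invmx P), (invmx Q), (m i0), (m i1), (m i2), (2%:R * b' e0 e1 0 i0), (2%:R * b' e0 e2 0 i0),
  (b' e1 e1 0 i0), (2%:R * b' e1 e2 0 i0), (b' e2 e2 0 i0).
rewrite !unitmx_inv; split=> // x.
apply: (can_inj (mulmxK uQ)). rewrite mulmxKV // -[x in LHS](mulmxKV uP).
set y := x *m invmx P; apply/rowP; apply: ord3_ind; rewrite ptE; last 2 first.
- exact: (proj1 (H y)).
- exact: (proj2 (H y)).
rewrite -[LHS]/(b' y y 0 i0) [in LHS](pt_sum y).
rewrite !(polarD lin) !(polarDr sym lin) !(polarZ lin) !(polarZr sym lin).
rewrite [b' e1 e0]sym [b' e2 e0]sym [b' e2 e1]sym.
have mxD (u u' : V) k : (u + u') 0 k = u 0 k + u' 0 k by rewrite mxE.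
have mxZ a (u : V) k : (a *: u) 0 k = a * u 0 k by rewrite mxE.
by rewrite !mxD !mxZ E; ring.
Qed.

End NormalForm.

(** * The polar form of a quadratic birational map *)

Section PolarOfCremona.
Variable C : numClosedFieldType.
Local Notation V := 'rV[C]_3.
Implicit Types (x y v : V) (phi psi : triple C) (p : form3 C).

Lemma polyfun_line p y v : polyfun (fun t => eval3 p (y + t *: v)).
Proof.
have [q qE] : polyfun (fun t => meval (fun i => y 0 i + t * v 0 i) p).
  apply: polyfun_meval => i; apply: polyfunD; first exact: polyfun_cst.
  by apply: polyfunM; [exact: polyfun_id | exact: polyfun_cst].
by exists q => t; rewrite -qE /eval3; apply: meval_eq => i; rewrite !mxE.
Qed.

(** The cross product is the equation of the plane spanned by x and y, and by [mdvd_lform_vanish] it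
    would divide every component. *)
Lemma no_plane_vanish psi x y : cross x y != 0 -> no_common_factor psi ->
  (forall a c, ev psi (a *: x + c *: y) = 0) -> False.
Proof.
move=> xy npsi psi0; have [r ur] := complete2 xy; set R := rows3 x y r in ur.
pose l := lform (fun j => cross x y 0 j).
have lE z : eval3 l z = cross x y 0 i0 * z 0 i0 + cross x y 0 i1 * z 0 i1 + cross x y 0 i2 * z 0 i2.
  by rewrite /eval3 meval_lform big3 /= addrA.
have lr : eval3 l r != 0 by rewrite lE -det_rows3 -unitfE -unitmxE.
have lxy : (eval3 l x = 0) * (eval3 l y = 0) by rewrite !lE !ptE; split; ring.
have lD u v : eval3 l (u + v) = eval3 l u + eval3 l v by rewrite !lE !mxE; ring.
have lZ a u : eval3 l (a *: u) = a * eval3 l u by rewrite !lE !mxE; ring.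
have [k ck] : exists k, cross x y 0 k != 0.
  apply/not_existsP => H; case/eqP: xy; apply/rowP => k; rewrite [RHS]mxE.
  by apply/eqP/negPn/negP; exact: H.
have : (msize l <= 1)%N.
  apply: npsi => i; apply: (mdvd_lform_vanish ck) => v v0.
  have vE : meval v (tnth psi i) = eval3 (tnth psi i) (\row_j v j).
    by rewrite /eval3; apply: meval_eq => j; rewrite mxE.
  rewrite vE; set z := \row_j v j.
  have lz : eval3 l z = 0.
    rewrite -[RHS]v0 /l /eval3 meval_lform; apply: eq_bigr => j _.
    by rewrite [z 0 j]mxE.
  have zE : z = (z *m invmx R) 0 i0 *: x + (z *m invmx R) 0 i1 *: y + (z *m invmx R) 0 i2 *: r.
    by rewrite -mulmx_rows3 -pt_eta mulmxKV.
  move: lz; rewrite zE !lD !lZ !lxy !mulr0 !add0r => /eqP.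
  rewrite mulf_eq0 (negPf lr) orbF => /eqP ->.
  by rewrite scale0r addr0 -evE psi0 mxE.
rewrite (@msize_dhomog _ 1) //; last exact: lform_homog.
by apply: contraNneq lr => ->; rewrite /eval3 meval0.
Qed.

Definition polar phi x y : V := 2%:R^-1 *: (ev phi (x + y) - ev phi x - ev phi y).

Lemma polarE phi x y k (c := quadratic_coef (tnth phi k)) : homogeneous_triple 2 phi ->
  polar phi x y 0 k = c 0%N * (x 0 i0 * y 0 i0) + c 1%N * (x 0 i1 * y 0 i1)
    + c 2%N * (x 0 i2 * y 0 i2) + (c 3%N * (x 0 i0 * y 0 i1 + x 0 i1 * y 0 i0)
    + c 4%N * (x 0 i0 * y 0 i2 + x 0 i2 * y 0 i0)
    + c 5%N * (x 0 i1 * y 0 i2 + x 0 i2 * y 0 i1)) / 2%:R.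
Proof.
move=> hp; have n2 : 2%:R != 0 :> C by rewrite pnatr_eq0.
have mxD (u u' : V) : (u + u') 0 k = u 0 k + u' 0 k by rewrite mxE.
have mxN (u : V) : (- u) 0 k = - u 0 k by rewrite mxE.
rewrite /polar [LHS]mxE !mxD !mxN !evE !(quadraticE _ (hp k)).
by rewrite ![(x + y) 0 _]mxE {}/c; move: (quadratic_coef (tnth phi k)) => c; field.
Qed.

Lemma polar_diag phi x : homogeneous_triple 2 phi -> polar phi x x = ev phi x.
Proof.
move=> hp; have n2 : 2%:R != 0 :> C by rewrite pnatr_eq0.
apply/rowP => k; rewrite polarE // evE (quadraticE _ (hp k)).
by move: (quadratic_coef (tnth phi k)) => c; field.
Qed.

Lemma polar_cremona phi : Bir2 phi -> cremona_polar (polar phi).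
Proof.
move=> [hp np [l [psi [hpsi npsi [P [P0 /subst_scaleP PE]] [Q [Q0 /subst_scaleP QE]]]]]].
have n2 : 2%:R != 0 :> C by rewrite pnatr_eq0.
have sym x y : polar phi x y = polar phi y x.
  apply/rowP => k; rewrite !polarE //.
  by move: (quadratic_coef (tnth phi k)) => c; field.
have lin a x y z : polar phi (a *: x + y) z = a *: polar phi x z + polar phi y z.
  apply/rowP => k; rewrite [RHS]mxE [X in _ = X + _]mxE !polarE // !mxE.
  by move: (quadratic_coef (tnth phi k)) => c; field.
have evD s t x y : ev phi (s *: x + t *: y) =
    s ^+ 2 *: ev phi x + (2%:R * s * t) *: polar phi x y + t ^+ 2 *: ev phi y.
  rewrite -!polar_diag // !(polarD lin) !(polarDr sym lin) !(polarZ lin) !(polarZr sym lin).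
  rewrite [polar phi y x]sym; move: (polar phi x x) (polar phi x y) (polar phi y y) => u1 u2 u3.
  by apply/rowP => k; rewrite !mxE; ring.
split=> //.
- move=> x v xv bxv; rewrite !polar_diag //; apply/eqP/negPn/negP => fxv.
  have ind s t : s *: x + t *: v = 0 -> s = 0 /\ t = 0.
    move=> E; apply: contrapT => st; case/eqP: xv; apply/cross_eq0P; exists s, t; split=> //.
    by apply/negP => /eqP[s0 t0]; apply: st.
  have E t : ev phi (x + t *: v) = ev phi x + t ^+ 2 *: ev phi v.
    by rewrite -[x in LHS]scale1r evD bxv scaler0 addr0 expr1n scale1r.
  have psi1 t : t != 0 -> ev psi (ev phi x + t ^+ 2 *: ev phi v) = 0.
    move=> t0; have e1 := PE (x + t *: v); have e2 := PE (x + (- t) *: v).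
    rewrite !E sqrrN in e1 e2.
    (* The images of x + tv and x - tv agree, hence P(x + tv) (x + tv) = P(x - tv) (x - tv); by
       independence of x and v both values of P vanish. *)
    have [|u1 u2] := ind (eval3 P (x + t *: v) - eval3 P (x + - t *: v))
        (t * (eval3 P (x + t *: v) + eval3 P (x + - t *: v))).
      apply/rowP => k; have := congr1 (fun u : V => u 0 k) (etrans (esym e1) e2).
      rewrite !mxE => H; apply/eqP; rewrite -subr_eq0 subr0.
      by move/eqP: H; rewrite -subr_eq0 => H; apply/eqP; rewrite -[RHS](eqP H); ring.
    move/eqP: u2; rewrite mulf_eq0 (negPf t0) /= => /eqP u2.
    have P1 : eval3 P (x + t *: v) = 0.
      by apply: (mulfI n2); rewrite mulr0 -[RHS]addr0 -{1}u1 -{1}u2; ring.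
    by rewrite e1 P1 scale0r.
  (* Homogeneity of psi reduces to a = 1, and t is a square root of c / a. *)
  have psi2 a c : a != 0 -> c != 0 -> ev psi (a *: ev phi x + c *: ev phi v) = 0.
    move=> a0 c0; have -> : a *: ev phi x + c *: ev phi v =
        a *: (ev phi x + sqrtC (c / a) ^+ 2 *: ev phi v).
      by rewrite sqrtCK scalerDr scalerA [a * _]mulrC divfK.
    by rewrite (ev_homogZ _ _ hpsi) psi1 ?scaler0 // sqrtC_eq0 mulf_neq0 ?invr_eq0.
  apply: (no_plane_vanish fxv npsi) => a c; apply/rowP => k; rewrite evE [RHS]mxE.
  pose y := a *: ev phi x + c *: ev phi v.
  have pf := polyfun_line (tnth psi k) y (ev phi x + ev phi v).
  (* Both coefficients are shifted by t, so that the cases a = 0 and c = 0 follow by polynomial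
     continuation to t = 0. *)
  pose g t := (a + t) * (c + t).
  have pg : polyfun g.
    by apply: polyfunM; apply: polyfunD; (exact: polyfun_cst || exact: polyfun_id).
  have [t0 gt0] : exists t0, g t0 != 0.
    case: pg => q qE; apply/not_existsP => H.
    have q0 : q = 0.
      by apply: horner_eq0_poly => t; rewrite -qE; apply/eqP/negPn/negP; exact: H.
    (* The second difference of a monic quadratic polynomial is 2. *)
    have : g (1 - a) - 2%:R * g (- a) + g (- 1 - a) = 0.
      by rewrite !qE q0 !horner0; ring.
    rewrite (_ : _ - _ + _ = 2%:R); last by rewrite /g; ring.
    by move/eqP; rewrite (negPf n2).
  suff H t : eval3 (tnth psi k) (y + t *: (ev phi x + ev phi v)) = 0.
    by have := H 0; rewrite scale0r addr0.
  apply: (polyfun_eq0 pf pg gt0) => {}t.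
  rewrite mulf_eq0 negb_or => /andP[a0 c0].
  rewrite -evE (_ : y + _ = (a + t) *: ev phi x + (c + t) *: ev phi v).
    by rewrite psi2 // mxE.
  by apply/rowP => j; rewrite !mxE; ring.
- move=> x v xv bxx bxv bvv; apply: (no_plane_vanish xv np) => a c.
  by rewrite evD -!polar_diag // bxx bxv bvv !scaler0 !addr0.
- move=> L phiL.
  (* phi o psi = Q id, so a linear relation between the components of phi gives one between the
     coordinates, multiplied by Q. *)
  have : Q * lform (fun j => L j 0) = 0.
    apply: eval3_ext => x; rewrite eval3M /eval3 meval_lform meval0 -/(eval3 _ _).
    have := phiL (ev psi x); rewrite polar_diag // QE -scalemxAl => /matrixP/(_ 0 0).
    rewrite !mxE => H; rewrite -[RHS]H; congr (_ * _); apply: eq_bigr => j _; exact: mulrC.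
  move/eqP; rewrite mulf_eq0 (negPf Q0) => /eqP l0.
  apply/matrixP => i j; rewrite ord1 [RHS]mxE.
  have := congr1 (fun p => eval3 p (\row_k (k == i)%:R)) l0.
  rewrite /eval3 meval_lform meval0 (bigD1 i) //= mxE eqxx mulr1 big1 ?addr0 //.
  by move=> k /negPf ki; rewrite mxE ki mulr0.
Qed.

End PolarOfCremona.

(** * The hypersurface *)

Section Jacobian.
Variable C : numFieldType.
Local Notation V := 'rV[C]_3.
Implicit Types (x y z : V) (P Q : 'M[C]_3).
Local Notation e0 := (pt 1 0 0 : 'rV[C]_3).
Local Notation e1 := (pt 0 1 0 : 'rV[C]_3).
Local Notation e2 := (pt 0 0 1 : 'rV[C]_3).

(** The discriminant of a s^3 + b s^2 t + c s t^2 + d t^3. It is stated over any commutative ring to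
    serve both for values and for polynomials in the 18 coordinates. *)
Definition disc4 (R : comNzRingType) (a b c d : R) : R :=
  b ^+ 2 * c ^+ 2 - 4%:R * a * c ^+ 3 - 4%:R * b ^+ 3 * d - 27%:R * a ^+ 2 * d ^+ 2
  + 18%:R * a * b * c * d.

(* If det (s J0 + t J1) = a s^3 + b s^2 t + c s t^2 + d t^3, the arguments of
   disc4 are 2a, 2b, 2c and 2d. *)
Definition pencil_disc (R : comNzRingType) (J0 J1 : 'M[R]_3) : R :=
  disc4 (2%:R * \det J0) (\det (J0 + J1) - \det (J0 - J1) - 2%:R * \det J1)
    (\det (J0 + J1) + \det (J0 - J1) - 2%:R * \det J0) (2%:R * \det J1).

Lemma pencil_disc_double (J0 J1 : 'M[C]_3) p q r u :
  (forall s t, \det (s *: J0 + t *: J1) = (p * s + q * t) ^+ 2 * (r * s + u * t)) ->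
  pencil_disc J0 J1 = 0.
Proof.
move=> E; have := (E 1 0, E 0 1, E 1 1, E 1 (-1)).
rewrite !scale1r !scale0r addr0 add0r scaleN1r => -[[[d0 d1] d2] d3].
by rewrite /pencil_disc d0 d1 d2 d3 /disc4; ring.
Qed.

(* quadratic_coord phi in terms of the values of phi. *)
Definition qc (f : V -> V) (k : 'I_18) : C :=
  nth 0 [:: f e0; f e1; f e2; f (e0 + e1) - f e0 - f e1; f (e0 + e2) - f e0 - f e2;
    f (e1 + e2) - f e1 - f e2] (k %% 6)%N 0 (inord (k %/ 6)%N).

Lemma qcE f (k : 'I_3) j : (j < 6)%N -> qc f (inord (6 * k + j)) =
  nth 0 [:: f e0; f e1; f e2; f (e0 + e1) - f e0 - f e1; f (e0 + e2) - f e0 - f e2;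
    f (e1 + e2) - f e1 - f e2] j 0 k.
Proof.
move=> j6; rewrite /qc inordK; last by case: k => -[|[|[|//]]] _ /=; lia.
by rewrite mulnC modnMDl divnMDl // modn_small // divn_small // addn0 inord_val.
Qed.

Lemma quadratic_coordE (phi : triple C) k : homogeneous_triple 2 phi ->
  quadratic_coord phi k = qc (ev phi) k.
Proof.
move=> hp; rewrite quadratic_coord_coefE /qc; set i := inord _ : 'I_3.
have -> : nth 0 phi (k %/ 6)%N = tnth phi i.
  by rewrite (tnth_nth 0) inordK // ltn_divLR.
have mxB (u v : V) : (u - v) 0 i = u 0 i - v 0 i by rewrite !mxE.
have k6 : (k %% 6 < 6)%N by rewrite ltn_mod.
have [c cE] : exists c, quadratic_coef (tnth phi i) = c by eexists.
have eE x : ev phi x 0 i = c 0%N * x 0 i0 ^+ 2 + c 1%N * x 0 i1 ^+ 2 + c 2%N * x 0 i2 ^+ 2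
    + c 3%N * (x 0 i0 * x 0 i1) + c 4%N * (x 0 i0 * x 0 i2) + c 5%N * (x 0 i1 * x 0 i2).
  by rewrite evE (quadraticE _ (hp i)) cE.
have [e01 [e02 e12]] : e0 + e1 = pt 1 1 0 /\ e0 + e2 = pt 1 0 1 /\ e1 + e2 = pt 0 1 1.
  by do !split; apply/rowP; apply: ord3_ind; rewrite mxE !ptE ?addr0 ?add0r.
rewrite cE e01 e02 e12.
case: (k %% 6)%N k6 => [|[|[|[|[|[|//]]]]]] _ /=; rewrite ?mxB !eE !ptE; ring.
Qed.

(* If u lists the coordinates of phi, s J0 + t J1 is the transposed Jacobian
   matrix of phi at (s, t, 0). *)
Definition J0 (R : nzRingType) (u : 'I_18 -> R) : 'M[R]_3 := \matrix_(m, k)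
  nth 0 [:: 2%:R * u (inord (6 * k)); u (inord (6 * k + 3)); u (inord (6 * k + 4))] m.

Definition J1 (R : nzRingType) (u : 'I_18 -> R) : 'M[R]_3 := \matrix_(m, k)
  nth 0 [:: u (inord (6 * k + 3)); 2%:R * u (inord (6 * k + 1)); u (inord (6 * k + 5))] m.

End Jacobian.

(** * The Jacobian of the de Jonquieres form *)

Section JonqJacobian.
Variable C : numClosedFieldType.
Local Notation V := 'rV[C]_3.
Implicit Types (x y z : V) (P Q : 'M[C]_3).
Local Notation e0 := (pt 1 0 0 : 'rV[C]_3).
Local Notation e1 := (pt 0 1 0 : 'rV[C]_3).
Local Notation e2 := (pt 0 0 1 : 'rV[C]_3).
Variables (al be1 be2 n1 n2 k1 k2 k3 : C).

Definition jonq_jac y : 'M[C]_3 :=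
  let m := al * y 0 i0 + be1 * y 0 i1 + be2 * y 0 i2 in
  rows3 (pt (n1 * y 0 i1 + n2 * y 0 i2) (al * y 0 i1) (al * y 0 i2))
    (pt (n1 * y 0 i0 + 2%:R * k1 * y 0 i1 + k2 * y 0 i2) (be1 * y 0 i1 + m) (be1 * y 0 i2))
    (pt (n2 * y 0 i0 + k2 * y 0 i1 + 2%:R * k3 * y 0 i2) (be2 * y 0 i1) (be2 * y 0 i2 + m)).

(** The binary form D of the overview, after cancellation of the terms in x. *)
Definition jonq_disc (y1 y2 : C) : C := (n1 * y1 + n2 * y2) * (be1 * y1 + be2 * y2)
  - al * (k1 * y1 ^+ 2 + k2 * (y1 * y2) + k3 * y2 ^+ 2).

Lemma det_jonq_jac y : \det (jonq_jac y) =
  2%:R * (al * y 0 i0 + be1 * y 0 i1 + be2 * y 0 i2) * jonq_disc (y 0 i1) (y 0 i2).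
Proof. by rewrite det_rows3 /cross !ptE /jonq_disc; ring. Qed.

Local Notation g := (jonq al be1 be2 n1 n2 k1 k2 k3).

Lemma mul_jonq_jac y z : z *m jonq_jac y =
  pt (z 0 i0 * (n1 * y 0 i1 + n2 * y 0 i2) + z 0 i1 * (n1 * y 0 i0 + 2%:R * k1 * y 0 i1 + k2 * y 0 i2)
       + z 0 i2 * (n2 * y 0 i0 + k2 * y 0 i1 + 2%:R * k3 * y 0 i2))
     (z 0 i0 * (al * y 0 i1)
      + z 0 i1 * (be1 * y 0 i1 + (al * y 0 i0 + be1 * y 0 i1 + be2 * y 0 i2))
      + z 0 i2 * (be2 * y 0 i1))
     (z 0 i0 * (al * y 0 i2) + z 0 i1 * (be1 * y 0 i2)
      + z 0 i2 * (be2 * y 0 i2 + (al * y 0 i0 + be1 * y 0 i1 + be2 * y 0 i2))).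
Proof.
rewrite [z in LHS]pt_eta mulmx_rows3; apply/rowP => k.
have mxD (u u' : V) : (u + u') 0 k = u 0 k + u' 0 k by rewrite mxE.
have mxZ a (u : V) : (a *: u) 0 k = a * u 0 k by rewrite mxE.
by rewrite !mxD !mxZ; elim/ord3_ind: k {mxD mxZ}; rewrite !ptE.
Qed.

Lemma jonq_polar y z : g (y + z) - g y - g z = z *m jonq_jac y.
Proof.
rewrite mul_jonq_jac; apply/rowP => k.
have mxB (u u' : V) j : (u - u') 0 j = u 0 j - u' 0 j by rewrite !mxE.
have mxD (u u' : V) j : (u + u') 0 j = u 0 j + u' 0 j by rewrite mxE.
rewrite !mxB; elim/ord3_ind: k; rewrite !ptE !mxD; ring.
Qed.

Lemma jonq_polar_diag y : 2%:R *: g y = y *m jonq_jac y.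
Proof.
rewrite mul_jonq_jac; apply/rowP => k; rewrite [LHS]mxE.
by elim/ord3_ind: k; rewrite !ptE; ring.
Qed.

Lemma jonq_jac_sym y z : z *m jonq_jac y = y *m jonq_jac z.
Proof.
rewrite !mul_jonq_jac; apply/rowP => k; elim/ord3_ind: k; rewrite !ptE; ring.
Qed.

Lemma jonq_jac_lin s t y z : jonq_jac (s *: y + t *: z) = s *: jonq_jac y + t *: jonq_jac z.
Proof.
have mxD (u u' : V) j : (u + u') 0 j = u 0 j + u' 0 j by rewrite mxE.
have mxZ a (u : V) j : (a *: u) 0 j = a * u 0 j by rewrite mxE.
apply/matrixP => i j; rewrite [RHS]mxE ![(_ *: jonq_jac _) _ _]mxE.
rewrite /jonq_jac ![rows3 _ _ _ _ _]mxE !mxD !mxZ.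
by elim/ord3_ind: i; rewrite /=; elim/ord3_ind: j; rewrite !ptE; ring.
Qed.

Lemma pencil_of_jonq P Q (f : V -> V) : (forall x, f x = g (x *m P) *m Q) ->
  forall s t, s *: J0 (qc f) + t *: J1 (qc f) = P *m jonq_jac ((s *: e0 + t *: e1) *m P) *m Q.
Proof.
move=> fE s t.
have polf x y : f (x + y) - f x - f y = x *m (P *m jonq_jac (y *m P) *m Q).
  by rewrite !fE mulmxDl -!mulmxBl jonq_polar jonq_jac_sym !mulmxA.
have diagf x : 2%:R *: f x = x *m (P *m jonq_jac (x *m P) *m Q).
  by rewrite fE scalemxAl jonq_polar_diag !mulmxA.
rewrite mulmxDl -!scalemxAl jonq_jac_lin mulmxDr mulmxDl -!scalemxAr -!scalemxAl.
suff [-> ->] : J0 (qc f) = P *m jonq_jac (e0 *m P) *m Q /\ J1 (qc f) = P *m jonq_jac (e1 *m P) *m Q.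
  by [].
have e0M (M : 'M[C]_3) k : M i0 k = (e0 *m M) 0 k by rewrite mxE big3 /= !mxE /=; ring.
have e1M (M : 'M[C]_3) k : M i1 k = (e1 *m M) 0 k by rewrite mxE big3 /= !mxE /=; ring.
have e2M (M : 'M[C]_3) k : M i2 k = (e2 *m M) 0 k by rewrite mxE big3 /= !mxE /=; ring.
have mxZ2 (u : V) k : 2%:R * u 0 k = (2%:R *: u) 0 k by rewrite mxE.
set j0 := P *m jonq_jac (e0 *m P) *m Q; set j1 := P *m jonq_jac (e1 *m P) *m Q.
have pol0 x : x *m j0 = f (x + e0) - f x - f e0 by rewrite polf.
have pol1 x : x *m j1 = f (x + e1) - f x - f e1 by rewrite polf.
have dia0 : e0 *m j0 = 2%:R *: f e0 by rewrite diagf.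
have dia1 : e1 *m j1 = 2%:R *: f e1 by rewrite diagf.
split; apply/matrixP => i k; rewrite mxE; elim/ord3_ind: i; rewrite [LHS]/=.
- by rewrite -[(6 * k)%N]addn0 qcE // e0M dia0 [LHS]/= mxZ2.
- by rewrite qcE // e1M pol0 [LHS]/= [e1 + e0]addrC addrAC.
- by rewrite qcE // e2M pol0 [LHS]/= [e2 + e0]addrC addrAC.
- by rewrite qcE // e0M pol1 [LHS]/=.
- by rewrite qcE // e1M dia1 [LHS]/= mxZ2.
- by rewrite qcE // e2M pol1 [LHS]/= [e2 + e1]addrC addrAC.
Qed.

Lemma pencil_det_jonq P Q (f : V -> V) : (forall x, f x = g (x *m P) *m Q) ->
  forall s t, let y j := s * P i0 j + t * P i1 j in
  \det (s *: J0 (qc f) + t *: J1 (qc f)) = \det P * \det Q *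
   (2%:R * (al * y i0 + be1 * y i1 + be2 * y i2) * jonq_disc (y i1) (y i2)).
Proof.
move=> fE s t y; rewrite (pencil_of_jonq fE) !det_mulmx det_jonq_jac.
have yE j : ((s *: e0 + t *: e1) *m P) 0 j = y j.
  by rewrite mxE big3 /= !mxE /= /y; ring.
by rewrite !yE; ring.
Qed.

End JonqJacobian.

(** * Reduction of the de Jonquieres form to sigma *)

Section StandardForm.
Variable C : numClosedFieldType.
Local Notation V := 'rV[C]_3.
Implicit Types (x z : V) (P Q : 'M[C]_3).
Variables (al be1 be2 n1 n2 k1 k2 k3 : C).
Local Notation g := (jonq al be1 be2 n1 n2 k1 k2 k3).

(** The discriminant of the binary quadratic form [jonq_disc]. *)
Definition discr_jonq := (n1 * be2 + n2 * be1 - al * k2) ^+ 2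
  - 4%:R * (n1 * be1 - al * k1) * (n2 * be2 - al * k3).

(** In either degenerate case the Jacobian cubic has a square factor: for al = 0 it is 2 n m^2 up to
    a constant, and if the discriminant of D vanishes, D is a multiple of a square. *)
Lemma pencil_disc_neq0 P Q (f : V -> V) : (forall x, f x = g (x *m P) *m Q) ->
  pencil_disc (J0 (qc f)) (J1 (qc f)) != 0 -> al != 0 /\ discr_jonq != 0.
Proof.
move=> fE H; have D := pencil_det_jonq fE.
have n2' : 2%:R != 0 :> C by rewrite pnatr_eq0.
split; apply: contraNneq H => H0; apply/eqP.
  apply: (@pencil_disc_double _ _ _ (be1 * P i0 i1 + be2 * P i0 i2) (be1 * P i1 i1 + be2 * P i1 i2)
    (2%:R * \det P * \det Q * (n1 * P i0 i1 + n2 * P i0 i2))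
    (2%:R * \det P * \det Q * (n1 * P i1 i1 + n2 * P i1 i2))) => s t.
  by rewrite D /jonq_disc H0; ring.
pose A := n1 * be1 - al * k1; pose B := n1 * be2 + n2 * be1 - al * k2.
pose E := n2 * be2 - al * k3.
have jE y1 y2 : jonq_disc al be1 be2 n1 n2 k1 k2 k3 y1 y2 = A * y1 ^+ 2 + B * (y1 * y2) + E * y2 ^+ 2.
  by rewrite /jonq_disc /A /B /E; ring.
have {}H0 : B ^+ 2 = 4%:R * A * E by apply/eqP; rewrite -subr_eq0; apply/eqP.
have [[a1 a2] [c jsq]] : exists a : C * C, exists c, forall y1 y2,
    A * y1 ^+ 2 + B * (y1 * y2) + E * y2 ^+ 2 = c * (a.1 * y1 + a.2 * y2) ^+ 2.
  have [A0|A0] := eqVneq A 0.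
    exists (0, 1), E => y1 y2 /=; move/eqP: H0; rewrite A0 mulr0 mul0r expf_eq0 /= => /eqP ->.
    by ring.
  exists (1, B / (2%:R * A)), A => y1 y2 /=.
  have -> : E = B ^+ 2 / (4%:R * A) by rewrite H0; field; rewrite ?A0 ?pnatr_eq0.
  by field; rewrite ?A0 ?pnatr_eq0.
apply: (@pencil_disc_double _ _ _ (a1 * P i0 i1 + a2 * P i0 i2) (a1 * P i1 i1 + a2 * P i1 i2)
    (2%:R * \det P * \det Q * c * (al * P i0 i0 + be1 * P i0 i1 + be2 * P i0 i2))
    (2%:R * \det P * \det Q * c * (al * P i1 i0 + be1 * P i1 i1 + be2 * P i1 i2))) => s t.
by rewrite D jE jsq /=; ring.
Qed.

Lemma binary_quadratic_split (A B E : C) : exists a1 a2 c1 c2,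
  [/\ a1 * c1 = A, a1 * c2 + a2 * c1 = B & a2 * c2 = E].
Proof.
have [->|A0] := eqVneq A 0.
  by exists 0, 1, B, E; split; ring.
pose d := sqrtC (B ^+ 2 - 4%:R * A * E).
have dE : d ^+ 2 = B ^+ 2 - 4%:R * A * E by rewrite sqrtCK.
exists A, ((B - d) / 2%:R), 1, ((B + d) / (2%:R * A)); split; first by rewrite mulr1.
  by field.
transitivity ((B ^+ 2 - d ^+ 2) / (4%:R * A)); first by field; rewrite ?A0 ?pnatr_eq0.
by rewrite dE; field; rewrite ?A0 ?pnatr_eq0.
Qed.

(** Factor D = l_1 l_2 and let B send y to (m, l_1, l_2), so that sigma gives (l_1 l_2, m l_2, m
    l_1). As l_1 and l_2 are independent, y m, z m and n m are combinations of the last two, and x n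
    + k = (n m - D) / al. The matrix A collects these coefficients. *)
Lemma jonq_std_quad : al != 0 -> discr_jonq != 0 ->
  exists A B, [/\ A \in unitmx, B \in unitmx & forall y, g y = ev (std_quad C) (y *m B) *m A].
Proof.
move=> al0 D0.
have [a1 [a2 [c1 [c2 [eA eB eE]]]]] := binary_quadratic_split (n1 * be1 - al * k1)
  (n1 * be2 + n2 * be1 - al * k2) (n2 * be2 - al * k3).
pose d := a1 * c2 - a2 * c1.
have d0 : d != 0.
  suff : d ^+ 2 != 0 by apply: contra_neq => ->; rewrite expr0n.
  rewrite (_ : d ^+ 2 = discr_jonq) // /discr_jonq -eA -eB -eE /d; ring.
pose B : 'M[C]_3 := rows3 (pt al 0 0) (pt be1 a1 c1) (pt be2 a2 c2).
pose A : 'M[C]_3 := rows3 (pt (- al^-1) 0 0)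
  (pt ((n2 * a1 - n1 * a2) / (d * al)) (- a2 / d) (a1 / d))
  (pt ((n1 * c2 - n2 * c1) / (d * al)) (c2 / d) (- c1 / d)).
exists A, B; split.
- rewrite unitmxE unitfE det_rows3 !ptE.
  rewrite (_ : _ + _ = (al * d)^-1); first by rewrite invr_eq0 mulf_neq0.
  by rewrite /d; field; rewrite ?al0 -?/d ?d0.
- rewrite unitmxE unitfE det_rows3 !ptE (_ : _ + _ = al * d) ?mulf_neq0 //.
  by rewrite /d; ring.
move=> y; have [f0 f1 f2] := ev_std_quad (y *m B).
have [b0 b1 b2] : [/\ (y *m B) 0 i0 = al * y 0 i0 + be1 * y 0 i1 + be2 * y 0 i2,
    (y *m B) 0 i1 = a1 * y 0 i1 + a2 * y 0 i2 & (y *m B) 0 i2 = c1 * y 0 i1 + c2 * y 0 i2].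
  by split; rewrite mxE big3 /= ![B _ _]mxE !ptE; ring.
rewrite b0 b1 b2 in f0 f1 f2.
apply/rowP => k; rewrite [RHS]mxE big3 /= f0 f1 f2 ![A _ _]mxE.
elim/ord3_ind: k; rewrite !ptE.
- have h1 : al * k1 = n1 * be1 - a1 * c1 by rewrite eA; ring.
  have h2 : al * k2 = n1 * be2 + n2 * be1 - (a1 * c2 + a2 * c1) by rewrite eB; ring.
  have h3 : al * k3 = n2 * be2 - a2 * c2 by rewrite eE; ring.
  apply: (mulfI al0).
  transitivity (al * y 0 i0 * (n1 * y 0 i1 + n2 * y 0 i2) + (al * k1 * y 0 i1 ^+ 2
    + al * k2 * (y 0 i1 * y 0 i2) + al * k3 * y 0 i2 ^+ 2)); first by ring.
  by rewrite h1 h2 h3 /d; field; rewrite ?al0 -?/d ?d0.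
- by rewrite /d; field; rewrite -?/d ?d0.
- by rewrite /d; field; rewrite -?/d ?d0.
Qed.

End StandardForm.

(** * The discriminant hypersurface and the density of its complement *)

Section Hypersurface.
Variable C : numClosedFieldType.
Local Notation V := 'rV[C]_3.
Implicit Types (x : V) (phi psi : triple C) (P Q A B : 'M[C]_3).

Lemma disc4_map (R S : comNzRingType) (f : {rmorphism R -> S}) a b c d :
  f (disc4 a b c d) = disc4 (f a) (f b) (f c) (f d).
Proof. by rewrite /disc4 rmorphD !rmorphB !(rmorphXn, rmorph_nat, rmorphM). Qed.

Lemma pencil_disc_map (R S : comNzRingType) (f : {rmorphism R -> S}) (M N : 'M[R]_3) :
  f (pencil_disc M N) = pencil_disc (map_mx f M) (map_mx f N).
Proof.
rewrite /pencil_disc disc4_map -map_mxD -map_mxB !det_map_mx.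
by rewrite !rmorphB !rmorphM !rmorph_nat rmorphD.
Qed.

Definition disc_hyp : mpoly 18 C :=
  pencil_disc (J0 (fun k => mpolyX C (mnm1 k))) (J1 (fun k => mpolyX C (mnm1 k))).

Lemma meval_disc_hyp u : meval u disc_hyp = pencil_disc (J0 u) (J1 u).
Proof.
rewrite -[LHS]/(meval u (pencil_disc _ _)) pencil_disc_map.
suff [-> ->] : map_mx (meval u) (J0 (fun k => mpolyX C (mnm1 k))) = J0 u /\
    map_mx (meval u) (J1 (fun k => mpolyX C (mnm1 k))) = J1 u by [].
split; apply/matrixP => i k; rewrite [LHS]mxE [in LHS]mxE [RHS]mxE.
  by elim/ord3_ind: i; rewrite /= ?mevalM ?rmorph_nat ?mevalXU.
by elim/ord3_ind: i; rewrite /= ?mevalM ?rmorph_nat ?mevalXU.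
Qed.

Lemma homog_natM n d k (p : mpoly n C) : homog d p -> homog d (k%:R * p).
Proof. by move=> hp; rewrite mulr_natl; apply: rpredMn. Qed.

Lemma det3_homog n (M : 'M[mpoly n C]_3) : (forall i j, homog 1 (M i j)) -> homog 3 (\det M).
Proof.
move=> hM; have h2 i j k l : homog 2 (M i j * M k l) by apply: (@dhomogM _ _ _ 1 _ 1); exact: hM.
have h3 i j p : homog 2 p -> homog 3 (M i j * p).
  by move=> hp; apply: (@dhomogM _ _ _ 1 _ 2); [exact: hM | exact: hp].
by rewrite det3; apply: rpredD; [apply: rpredB|]; apply: h3; apply: rpredB; apply: h2.
Qed.

Lemma disc_hyp_homog : homog 12 disc_hyp.
Proof.
have hX k : homog 1 (mpolyX C (mnm1 k) : mpoly 18 C) by rewrite -lform_delta; apply: lform_homog.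
have h0 i j : homog 1 (J0 (fun k => mpolyX C (mnm1 k) : mpoly 18 C) i j).
  by rewrite mxE; elim/ord3_ind: i => /=; first [exact: hX | apply: homog_natM; exact: hX].
have h1 i j : homog 1 (J1 (fun k => mpolyX C (mnm1 k) : mpoly 18 C) i j).
  by rewrite mxE; elim/ord3_ind: i => /=; first [exact: hX | apply: homog_natM; exact: hX].
have hD : homog 3 (\det (J0 (fun k => mpolyX C (mnm1 k) : mpoly 18 C)
    + J1 (fun k => mpolyX C (mnm1 k) : mpoly 18 C))).
  by apply: det3_homog => i j; rewrite mxE; apply: rpredD; [exact: h0 | exact: h1].
have hB : homog 3 (\det (J0 (fun k => mpolyX C (mnm1 k) : mpoly 18 C)
    - J1 (fun k => mpolyX C (mnm1 k) : mpoly 18 C))).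
  by apply: det3_homog => i j; rewrite mxE [X in _ + X]mxE; apply: rpredB; [exact: h0 | exact: h1].
have hd4 (a b c d : mpoly 18 C) : homog 3 a -> homog 3 b -> homog 3 c -> homog 3 d ->
    homog 12 (disc4 a b c d).
  move=> ha hb hc hd; rewrite /disc4.
  have hM k l (p q : mpoly 18 C) : homog k p -> homog l q -> homog (k + l) (p * q) by exact: dhomogM.
  have hE k (p : mpoly 18 C) : homog 3 p -> homog (3 * k) (p ^+ k) by exact: dhomogMn.
  apply: rpredD; first apply: rpredB; first apply: rpredB; first apply: rpredB.
  - by apply: (hM 6 6); exact: hE.
  - by apply: (hM 3 9); [exact: homog_natM | exact: hE].
  - by apply: (hM 9 3) => //; apply: homog_natM; exact: hE.
  - by apply: (hM 6 6); [apply: homog_natM|]; exact: hE.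
  - by apply: (hM 9 3) => //; apply: (hM 6 3) => //; apply: (hM 3 3) => //; exact: homog_natM.
have hJ0 := homog_natM 2 (det3_homog h0); have hJ1 := homog_natM 2 (det3_homog h1).
apply: hd4; [exact: hJ0 | apply: rpredB | apply: rpredB | exact: hJ1].
- by apply: rpredB; [exact: hD | exact: hB].
- exact: hJ1.
- by apply: rpredD; [exact: hD | exact: hB].
- exact: hJ0.
Qed.

Lemma at_triple_disc_hyp phi : homogeneous_triple 2 phi ->
  at_triple disc_hyp phi = pencil_disc (J0 (qc (ev phi))) (J1 (qc (ev phi))).
Proof.
move=> hp; rewrite /at_triple meval_disc_hyp (_ : quadratic_coord phi = qc (ev phi)) //.
by apply/funext => k; exact: quadratic_coordE.
Qed.

Lemma Bir2_normal_form phi : Bir2 phi -> exists P Q al be1 be2 n1 n2 k1 k2 k3,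
  [/\ P \in unitmx, Q \in unitmx &
    forall x, ev phi x = jonq al be1 be2 n1 n2 k1 k2 k3 (x *m P) *m Q].
Proof.
move=> bphi; have [hp _ _] := bphi.
have [P [Q [al [be1 [be2 [n1 [n2 [k1 [k2 [k3 [uP uQ E]]]]]]]]]]] :=
  cremona_normal_form (polar_cremona bphi).
exists P, Q, al, be1, be2, n1, n2, k1, k2, k3; split=> // x.
by rewrite -E polar_diag.
Qed.

Lemma Bir2_std_quad phi : Bir2 phi -> at_triple disc_hyp phi != 0 ->
  exists A B, [/\ A \in unitmx, B \in unitmx & phi = comp3 (lin A) (comp3 (std_quad C) (lin B))].
Proof.
move=> bphi; have [hp _ _] := bphi; rewrite at_triple_disc_hyp // => H.
have [P [Q [al [be1 [be2 [n1 [n2 [k1 [k2 [k3 [uP uQ E]]]]]]]]]]] := Bir2_normal_form bphi.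
have [al0 d0] := pencil_disc_neq0 E H.
have [A [B [uA uB gE]]] := jonq_std_quad al0 d0.
exists (A *m Q), (P *m B); rewrite !unitmx_mul uA uB uP uQ; split=> //.
by apply: triple_ext => x; rewrite E gE !ev_comp3 !ev_lin !mulmxA.
Qed.

(** The Jacobian of sigma is a multiple of xyz, which vanishes on all of z = 0. This point makes
    Sigma nonempty. *)
Lemma std_quad_disc_hyp : at_triple disc_hyp (std_quad C) = 0.
Proof.
rewrite at_triple_disc_hyp; last exact: std_quad_homog.
have E x : ev (std_quad C) x = jonq 1 0 0 0 0 0 1 0 (x *m 1%:M) *m
    rows3 (pt 1 0 0) (pt 0 0 1) (pt 0 1 0).
  rewrite mulmx1 /jonq mulmx_rows3; have [f0 f1 f2] := ev_std_quad x.
  have mxD (u u' : V) k : (u + u') 0 k = u 0 k + u' 0 k by rewrite mxE.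
  have mxZ a (u : V) k : (a *: u) 0 k = a * u 0 k by rewrite mxE.
  by apply/rowP; apply: ord3_ind; rewrite ?f0 ?f1 ?f2 !mxD !mxZ !ptE; ring.
apply: (@pencil_disc_double _ _ _ 0 0 0 0) => s t.
by rewrite (pencil_det_jonq E) /jonq_disc !mxE /=; ring.
Qed.

Definition line_to (a b t : C) := a + t * (b - a).

Lemma polyfun_line_to a b : polyfun (line_to a b).
Proof.
by apply: polyfunD; [|apply: polyfunM]; try exact: polyfun_cst; exact: polyfun_id.
Qed.

Lemma line_to0 a b : line_to a b 0 = a.
Proof. by rewrite /line_to mul0r addr0. Qed.

Lemma line_to1 a b : line_to a b 1 = b.
Proof. by rewrite /line_to mul1r addrC subrK. Qed.

Definition mx_line_to P Q t : 'M[C]_3 := \matrix_(i, j) line_to (P i j) (Q i j) t.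

Lemma mx_line_to0 P Q : mx_line_to P Q 0 = P.
Proof. by apply/matrixP => i j; rewrite mxE line_to0. Qed.

Lemma mx_line_to1 P Q : mx_line_to P Q 1 = Q.
Proof. by apply/matrixP => i j; rewrite mxE line_to1. Qed.

Local Ltac polyfun_tac := repeat first [ exact: polyfun_cst | exact: polyfun_line_to
  | apply: polyfunB | apply: polyfunD | apply: polyfunM | apply: polyfunX ].

Lemma polyfun_ext (f f' : C -> C) : f =1 f' -> polyfun f' -> polyfun f.
Proof. by move=> E [p pE]; exists p => t; rewrite E pE. Qed.

Lemma polyfun_det (M : C -> 'M[C]_3) : (forall i j, polyfun (fun t => M t i j)) ->
  polyfun (fun t => \det (M t)).
Proof.
move=> pM; apply: polyfun_ext (fun t => det3 (M t)) _.
by repeat first [ exact: pM | apply: polyfunB | apply: polyfunD | apply: polyfunM ].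
Qed.

Lemma polyfun_mx_line_to P Q i j : polyfun (fun t => mx_line_to P Q t i j).
Proof.
by apply: polyfun_ext (polyfun_line_to (P i j) (Q i j)) => t; rewrite mxE.
Qed.

Lemma polyfun_row_mul (r : C -> V) (M : C -> 'M[C]_3) k : (forall i, polyfun (fun t => r t 0 i)) ->
  (forall i j, polyfun (fun t => M t i j)) -> polyfun (fun t => (r t *m M t) 0 k).
Proof.
move=> pr pM; apply: (@polyfun_ext _ (fun t => \sum_i r t 0 i * M t i k)).
  by move=> t; rewrite mxE.
by apply: polyfun_sum => i; apply: polyfunM.
Qed.

Lemma polyfun_jonq (al be1 be2 n1 n2 k1 k2 k3 : C -> C) (r : C -> V) k :
  polyfun al -> polyfun be1 -> polyfun be2 -> polyfun n1 -> polyfun n2 ->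
  polyfun k1 -> polyfun k2 -> polyfun k3 -> (forall i, polyfun (fun t => r t 0 i)) ->
  polyfun (fun t => jonq (al t) (be1 t) (be2 t) (n1 t) (n2 t) (k1 t) (k2 t) (k3 t) (r t) 0 k).
Proof.
move=> *; elim/ord3_ind: k.
- apply: polyfun_ext (fun t => (ptE _ _ _).1.1) _.
  by repeat first [ assumption | apply: polyfunD | apply: polyfunM | apply: polyfunX ].
- apply: polyfun_ext (fun t => (ptE _ _ _).1.2) _.
  by repeat first [ assumption | apply: polyfunD | apply: polyfunM | apply: polyfunX ].
- apply: polyfun_ext (fun t => (ptE _ _ _).2) _.
  by repeat first [ assumption | apply: polyfunD | apply: polyfunM | apply: polyfunX ].
Qed.

Lemma polyfun_qc (f : C -> V -> V) k : (forall x i, polyfun (fun t => f t x 0 i)) ->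
  polyfun (fun t => qc (f t) k).
Proof.
move=> pf; rewrite /qc; set i := inord _ : 'I_3.
have k6 : (k %% 6 < 6)%N by rewrite ltn_mod.
have pB (g g' : C -> V) : polyfun (fun t => g t 0 i) -> polyfun (fun t => g' t 0 i) ->
    polyfun (fun t => (g t - g' t) 0 i).
  by move=> pg pg'; apply: polyfun_ext (polyfunB pg pg') => t; rewrite !mxE.
case: (k %% 6)%N k6 => [|[|[|[|[|[|//]]]]]] _ /=.
all: by repeat first [exact: pf | apply: (pB)].
Qed.

(* phi is joined to a map off the hypersurface by a line in the parameters
   (P, Q, al, ..., k3) of the normal form. *)
Lemma Bir2_dense (G : mpoly 18 C) :
  (forall phi, Bir2 phi -> at_triple disc_hyp phi != 0 -> at_triple G phi = 0) ->
  forall phi, Bir2 phi -> at_triple G phi = 0.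
Proof.
move=> G0 phi bphi; have [hp _ _] := bphi.
have [P [Q [al [be1 [be2 [n1 [n2 [k1 [k2 [k3 [_ _ E]]]]]]]]]]] := Bir2_normal_form bphi.
(* The endpoint at t = 1 is sigma, up to a permutation, after the change [P1], which sends (s, t, 0)
   to (s, t, s + t). The Jacobian there is a multiple of s t (s + t), with three distinct roots. *)
pose P1 := rows3 (pt 1 0 1) (pt 0 1 1) (pt 0 0 1) : 'M[C]_3.
pose Pt := mx_line_to P P1; pose Qt := mx_line_to Q 1%:M.
pose alt := line_to al 1; pose be1t := line_to be1 0; pose be2t := line_to be2 0.
pose n1t := line_to n1 0; pose n2t := line_to n2 0.
pose k1t := line_to k1 0; pose k2t := line_to k2 1; pose k3t := line_to k3 0.
pose f t x := jonq (alt t) (be1t t) (be2t t) (n1t t) (n2t t) (k1t t) (k2t t) (k3t t)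
  (x *m Pt t) *m Qt t.
pose dt t := discr_jonq (alt t) (be1t t) (be2t t) (n1t t) (n2t t) (k1t t) (k2t t) (k3t t).
have pu k : polyfun (fun t => qc (f t) k).
  apply: polyfun_qc => x i; apply: polyfun_row_mul => *; last exact: polyfun_mx_line_to.
  apply: polyfun_jonq => *; try exact: polyfun_line_to.
  apply: polyfun_row_mul => *; last exact: polyfun_mx_line_to.
  exact: polyfun_cst.
(* Where [gd] is nonzero, the map is equivalent to sigma, hence birational, and lies off the
   hypersurface, so the hypothesis on G applies. At t = 0, the given phi, [gd] may vanish. *)
pose gd t := \det (Pt t) * \det (Qt t) * alt t * dt t * meval (qc (f t)) disc_hyp.
have pgd : polyfun gd.
  do !apply: polyfunM; rewrite ?/dt ?/discr_jonq.
  - by apply: polyfun_det => *; exact: polyfun_mx_line_to.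
  - by apply: polyfun_det => *; exact: polyfun_mx_line_to.
  - exact: polyfun_line_to.
  - by polyfun_tac.
  - exact: polyfun_meval.
have f1 x : f 1 x = jonq 1 0 0 0 0 0 1 0 (x *m P1) *m 1%:M.
  by rewrite /f /alt /be1t /be2t /n1t /n2t /k1t /k2t /k3t /Pt /Qt !line_to1 !mx_line_to1.
have detP1 : \det P1 = 1 by rewrite det_rows3 !ptE; ring.
have gd1 : gd 1 != 0.
  rewrite /gd /dt /alt /be1t /be2t /n1t /n2t /k1t /k2t /k3t /Pt /Qt !line_to1 !mx_line_to1.
  rewrite detP1 det1 !mul1r meval_disc_hyp mulf_neq0 //.
    by rewrite /discr_jonq (_ : _ - _ = 1) ?oner_eq0 //; ring.
  have D s t : \det (s *: J0 (qc (f 1)) + t *: J1 (qc (f 1))) = - (2%:R * s * t * (s + t)).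
    by rewrite (pencil_det_jonq f1) /jonq_disc detP1 det1 !mxE /=; ring.
  have := (D 1 0, D 0 1, D 1 1, D 1 (-1)).
  rewrite !scale1r !scale0r addr0 add0r scaleN1r => -[[[d0 d1] d2] d3].
  rewrite /pencil_disc d0 d1 d2 d3 /disc4 (_ : _ + _ = 256%:R) ?pnatr_eq0 //; ring.
have fG t : gd t != 0 -> meval (qc (f t)) G = 0.
  rewrite /gd !mulf_eq0 !negb_or -!andbA => /and5P[uP uQ al0 d0 H].
  have [A [B [uA uB gE]]] := jonq_std_quad al0 d0.
  pose psi := comp3 (lin (A *m Qt t)) (comp3 (std_quad C) (lin (Pt t *m B))).
  have bpsi : Bir2 psi.
    by apply: birational_lin; rewrite ?unitmx_mul ?uA ?uB ?unitmxE ?unitfE ?uP ?uQ //;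
      exact: std_quad_birational.
  have fpsi : ev psi = f t.
    by apply/funext => x; rewrite /f gE !ev_comp3 !ev_lin !mulmxA.
  have cE : quadratic_coord psi = qc (f t).
    by apply/funext => k; rewrite quadratic_coordE ?fpsi //; case: bpsi.
  by have := G0 psi bpsi; rewrite /at_triple cE; apply.
have := polyfun_eq0 (polyfun_meval G pu) pgd gd1 fG 0.
rewrite /at_triple (_ : qc (f 0) = quadratic_coord phi) //.
apply/funext => k; rewrite quadratic_coordE //; congr (qc _ k); apply/funext => x.
by rewrite E /f /alt /be1t /be2t /n1t /n2t /k1t /k2t /k3t /Pt /Qt !line_to0 !mx_line_to0.
Qed.

End Hypersurface.

Theorem theorem2 (R : realType) :
  exists Sigma : set (triple (CC R)),
    hypersurface_in (@Bir2 (CC R)) Sigma /\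
    forall F : triple (CC R), foliation 2 F ->
      (exists phi : triple (CC R),
         (@Bir2 (CC R) `\` Sigma)%classic phi /\ pullback_has_degree phi F 2) ->
      transversely_projective F.
Proof.
exists (@Bir2 (CC R) `&` [set phi | at_triple (disc_hyp (CC R)) phi = 0]); split.
  exists 12%N, (disc_hyp (CC R)); split=> //.
  - exact: disc_hyp_homog.
  - by exists (std_quad _); split; [exact: std_quad_birational | exact: std_quad_disc_hyp].
  - move=> G G0; apply: Bir2_dense => phi bphi H0; apply: G0; split=> //.
    by move=> [_ /= H]; rewrite H eqxx in H0.
move=> F FF [phi [[bphi nS] degphi]].
have H : at_triple (disc_hyp (CC R)) phi != 0 by apply/eqP => H; apply: nS.
have [A [B [uA uB phiE]]] := Bir2_std_quad bphi H.
by apply: (invariant_transversely_projective uA uB FF); rewrite -phiE.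
Qed.
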